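(* Let $A,P\in\mathrm{GL}(d,\mathbb R)$ and let $\pi$ be the quasi-regular representation of $G=\mathbb R^d\rtimes\langle A\rangle$ on $L^2(\mathbb R^d)$. Suppose $\psi\in\mathcal B_\pi$ and that the system $\{\pi(A^jPk,A^j)\psi\}_{j\in\mathbb Z,k\in\mathbb Z^d}=\{|\det A|^{-j/2}\psi(A^{-j}\cdot-Pk)\}_{j\in\mathbb Z,k\in\mathbb Z^d}$ is a frame for $L^2(\mathbb R^d)$ with frame bounds $0<C_1\le C_2<\infty$. Then $\{\pi(x,A^j)\psi\}_{x\in\mathbb R^d,j\in\mathbb Z}$ is a continuous frame for $L^2(\mathbb R^d)$ with frame bounds $C_1|\det P|$ and $C_2|\det P|$, i.e. $$C_1|\det P|\,\|f\|^2\le\sum_{j\in\mathbb Z}\int_{\mathbb R^d}|\langle f,\pi(x,A^j)\psi\rangle|^2\,|\det A|^{-j}\,dx\le C_2|\det P|\,\|f\|^2\quad\forall f\in L^2(\mathbb R^d),$$ and $$C_1\le\frac{1}{|\det P|}\sum_{j\in\mathbb Z}|\widehat\psi((A^t)^j\xi)|^2\le C_2\quad\text{for a.e. }\xi\in\mathbb R^d.$$ In particular, if the discrete system is a Parseval frame ($C_1=C_2=1$), then the continuous system is a tight frame and $\sum_{j\in\mathbb Z}|\widehat\psi((A^t)^j\xi)|^2=|\det P|$ for a.e. $\xi$.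
   Context: For $A\in\mathrm{GL}(d,\mathbb R)$, $G=\mathbb R^d\rtimes\langle A\rangle$ is the group of pairs $(x,A^j)$, $x\in\mathbb R^d$, $j\in\mathbb Z$ (indexed by $(x,j)\in\mathbb R^d\times\mathbb Z$), with product $(x,A^j)(y,A^k)=(x+A^jy,A^{j+k})$; left Haar measure $d\mu_G(x,A^j)=|\det A|^{-j}dx\,d\mu_c(j)$ ($\mu_c$ counting measure), and $L^2(G)$ is with respect to $\mu_G$. The quasi-regular representation is $\pi(x,A^j)f(t)=|\det A|^{-j/2}f(A^{-j}(t-x))$, $t\in\mathbb R^d$, a unitary representation on $L^2(\mathbb R^d)$. For $\psi,f\in L^2(\mathbb R^d)$, $C_\psi f(g)=\langle f,\pi(g)\psi\rangle$, $g\in G$. For a fixed compact neighborhood $Q$ of the identity of $G$, $MF(g)=\sup_{q\in Q}|F(gq)|$, $W(L^2)=\{F\in L^\infty_{loc}(G): MF\in L^2(G)\}$ (independent of $Q$), and $\mathcal B_\pi=\{\psi\in L^2(\mathbb R^d): C_\psi f\in W(L^2)\ \forall f\in L^2(\mathbb R^d)\}$; equivalently, $\psi\in\mathcal B_\pi$ iff $\{\pi(\lambda)\psi\}_{\lambda\in\Lambda}$ is a Bessel sequence for every relatively separated $\Lambda\subseteq G$. Fourier transform: $\widehat f(\xi)=\int_{\mathbb R^d}f(x)e^{-2\pi i x\cdot\xi}dx$; $A^t$ is the transpose of $A$. *)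

(* Defs.v *)
From HB Require Import structures.
From mathcomp Require Import all_boot all_order all_algebra.
From mathcomp Require Import all_classical all_reals all_analysis.
From mathcomp Require Import complex.
Set Implicit Arguments.
Unset Strict Implicit.
Unset Printing Implicit Defensive.
Import Order.TTheory GRing.Theory Num.Theory.
Local Open Scope ring_scope.
Local Open Scope classical_set_scope.

Section Defs.
Context (R : realType) (d : nat).
(* points of R^d are d-tuples of reals; the measurable structure on
   d.-tuple R is the product (= Borel) sigma-algebra of the library *)
Local Notation V := (d.-tuple R).

Definition vadd (x y : V) : V := [tuple tnth x i + tnth y i | i < d].
Definition vsub (x y : V) : V := [tuple tnth x i - tnth y i | i < d].
Definition mxapp (M : 'M[R]_d) (x : V) : V :=
  [tuple \sum_(j < d) M i j * tnth x j | i < d].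
Definition dotv (x y : V) : R := \sum_(i < d) tnth x i * tnth y i.
Definition intvec (k : d.-tuple int) : V := [tuple (tnth k i)%:~R | i < d].
Definition mxpowz (M : 'M[R]_d) (j : int) : 'M[R]_d :=
  match j with Posz n => M ^+ n | Negz n => invmx M ^+ n.+1 end.

(* lam is Lebesgue measure on R^d: it gives every half-open box its volume
   (this determines the measure uniquely on the Borel sets) *)
Definition is_lebesgue (lam : {measure set V -> \bar R}) : Prop :=
  forall a b : V, (forall i, tnth a i <= tnth b i) ->
    lam [set x | forall i, tnth a i <= tnth x i < tnth b i]
    = (\prod_(i < d) (tnth b i - tnth a i))%:E.

Variable lam : {measure set V -> \bar R}.

Definition abs2 (z : R[i]) : R := complex.Re z ^+ 2 + complex.Im z ^+ 2.

Definition cint (D : set V) (f : V -> R[i]) : R[i] :=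
  Complex (Rintegral lam D (fun x => complex.Re (f x)))
          (Rintegral lam D (fun x => complex.Im (f x))).

Definition memL2 (f : V -> R[i]) : Prop :=
  [/\ measurable_fun setT (fun x => complex.Re (f x)),
      measurable_fun setT (fun x => complex.Im (f x)) &
      (\int[lam]_x (abs2 (f x))%:E < +oo)%E].

Definition ip (f g : V -> R[i]) : R[i] := cint setT (fun x => f x * (g x)^*%C).
Definition l2norm2 (f : V -> R[i]) : R := Rintegral lam setT (fun x => abs2 (f x)).

Definition qreg (A : 'M[R]_d) (x : V) (j : int) (f : V -> R[i]) : V -> R[i] :=
  fun t => ((Num.sqrt `|\det A|) ^ (- j))%:C%C * f (mxapp (mxpowz A (- j)) (vsub t x)).

Definition wcoef (A : 'M[R]_d) (psi f : V -> R[i]) (x : V) (j : int) : R[i] :=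
  ip f (qreg A x j psi).

(* the fixed compact neighbourhood Q = [-1,1]^d x {A^0} of the identity of G *)
Definition Qbox : set V := [set y | forall i, `|tnth y i| <= 1].

(* MF(x, A^j) = sup_{q in Q} |F((x,A^j) q)|, with (x,A^j)(y,A^0) = (x + A^j y, A^j) *)
Definition maxfun (A : 'M[R]_d) (F : V -> int -> R[i]) (x : V) (j : int) : \bar R :=
  ereal_sup [set (Num.sqrt (abs2 (F (vadd x (mxapp (mxpowz A j) y)) j)))%:E | y in Qbox].

(* integral w.r.t. the left Haar measure |det A|^{-j} dx d(counting)(j) *)
Definition haar_int (A : 'M[R]_d) (h : V -> int -> \bar R) : \bar R :=
  (\esum_(j in [set: int]) ((`|\det A| ^ (- j))%:E * \int[lam]_x h x j))%E.

Definition Linf_loc (F : V -> int -> R[i]) : Prop :=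
  (forall j, measurable_fun setT (fun x => complex.Re (F x j)) /\
             measurable_fun setT (fun x => complex.Im (F x j))) /\
  (forall (j : int) (r : R), exists M : R,
     {ae lam, forall x, (forall i, `|tnth x i| <= r) -> Num.sqrt (abs2 (F x j)) <= M}).

Definition in_W (A : 'M[R]_d) (F : V -> int -> R[i]) : Prop :=
  Linf_loc F /\
  (haar_int A (fun x j => maxfun A F x j * maxfun A F x j) < +oo)%E.

Definition in_Bpi (A : 'M[R]_d) (psi : V -> R[i]) : Prop :=
  memL2 psi /\ forall f, memL2 f -> in_W A (wcoef A psi f).

Definition disc_frame (A P : 'M[R]_d) (psi : V -> R[i]) (C1 C2 : R) : Prop :=
  forall f, memL2 f ->
  ((C1 * l2norm2 f)%:E
    <= \esum_(jk in [set: int * d.-tuple int])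
         (abs2 (wcoef A psi f (mxapp (mxpowz A jk.1) (mxapp P (intvec jk.2))) jk.1))%:E
    <= (C2 * l2norm2 f)%:E)%E.

Definition cont_sum (A : 'M[R]_d) (psi f : V -> R[i]) : \bar R :=
  (\esum_(j in [set: int])
     \int[lam]_x (abs2 (wcoef A psi f x j) * `|\det A| ^ (- j))%:E)%E.

Definition cexp (t : R) : R[i] := Complex (cos t) (sin t).

Definition fourier_trunc (psi : V -> R[i]) (N : nat) : V -> R[i] := fun xi =>
  cint [set x | forall i, `|tnth x i| <= N%:R]
       (fun x => psi x * cexp (- (2 * pi * dotv x xi))).

Definition is_fourierL2 (psi F : V -> R[i]) : Prop :=
  memL2 F /\
  ((fun N : nat => \int[lam]_xi (abs2 (F xi - fourier_trunc psi N xi))%:E)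
     @ \oo --> (0 : \bar R))%E.

End Defs.

(* Main.v *)
Require Import Defs.
From HB Require Import structures.
From mathcomp Require Import all_boot all_order all_algebra fingroup perm.
From mathcomp Require Import all_classical all_reals all_analysis.
From mathcomp Require Import complex measurable_realfun ring lra.
Set Implicit Arguments.
Unset Strict Implicit.
Unset Printing Implicit Defensive.
Import Order.TTheory GRing.Theory Num.Theory.
Import numFieldNormedType.Exports.
Local Open Scope ring_scope.
Local Open Scope classical_set_scope.

(** The averages of the discrete frame inequality over the translates f(. + y),
    with y in a large cube, are Riemann-type sums of x |-> |<f, pi(x, A^j) psi>|^2
    over the lattices A^j P Z^d, so each level j contributes
    |det A^j P|^-1 times the integral; membership in B_pi dominates the levels
    uniformly and permits the limit.  This gives the continuous frame bounds.
    Testing them on the modulated Gaussians exp(-a|t|^2) exp(2 pi i t.omega),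
    Plancherel turns the continuous sum into the integral of
    sum_j |psi^((A^t)^j .)|^2 against a Gaussian centred at omega, of arbitrary
    width.  Narrow Gaussians form an approximate identity, so the bounds hold
    for the sum itself almost everywhere. *)

(** * Lebesgue measure on the Borel sets of R^d *)

(** The obstacle to averaging is that A^j P distorts the unit cell differently at each level, so one
    averaging cube serves only finitely many j. For the upper bound this suffices, since a sum over
    the levels is a supremum of finite partial sums. For the lower bound the omitted levels must be
    small uniformly in the translate y. Half-open boxes of side delta at the points of P Z^d are
    disjoint, so at level j the samples are controlled by delta^(-d) times the weighted integral of
    the squared maximal function, and these bounds are summable over j. On the Fourier side both
    halves of the Gaussian Plancherel identity are reduced to the same double integral of u(s) u(t)
    K(s,t): the autocorrelation of a Gaussian is again a Gaussian in s - t, hence a Fourier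
    transform of a Gaussian. A truncation turns psi into an integrable function for this, and an
    isometry argument removes it. The passage to almost every point is proved in one direction only:
    Gaussian averages bounded by C force T <= C almost everywhere. The lower bound follows by
    applying this to the upper bound minus the truncated sum. *)

Section Boxes.
Context (R : realType) (d : nat).
Local Notation V := (d.-tuple R).

Definition box (a b : V) : set V :=
  [set x | forall i, tnth a i <= tnth x i < tnth b i].

Definition cvec (c : R) : V := [tuple c | _ < d].

Lemma tnth_cvec c i : tnth (cvec c) i = c.
Proof. by rewrite tnth_mktuple. Qed.

Lemma vext (x y : V) : (forall i, tnth x i = tnth y i) -> x = y.
Proof. exact: eq_from_tnth. Qed.

Lemma measurable_slab (i : 'I_d) (B : set R) :
  measurable B -> measurable [set x : V | B (tnth x i)].
Proof.
move=> mB; have := @measurable_tnth _ R d i measurableT B mB.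
by rewrite setTI.
Qed.

Lemma boxE a b : box a b =
  \bigcap_(i in [set: 'I_d]) [set x : V | `[tnth a i, tnth b i[%classic (tnth x i)].
Proof.
apply/seteqP; split => [x h i _|x h i].
  by rewrite /= in_itv /=; exact: h.
by have := h i I; rewrite /= in_itv.
Qed.

Lemma measurable_box a b : measurable (box a b).
Proof.
rewrite boxE; apply: fin_bigcap_measurable => // i _.
exact: measurable_slab.
Qed.

Lemma box_cover (x : V) : exists n : nat, box (cvec (- n%:R)) (cvec n%:R) x.
Proof.
exists (\max_(i < d) (Num.bound `|tnth x i|)).+1 => i.
rewrite !tnth_cvec.
have h : `|tnth x i| < (\max_(i < d) (Num.bound `|tnth x i|)).+1%:R.
  apply: lt_le_trans (archi_boundP (normr_ge0 _)) _.
  by rewrite ler_nat; apply: leqW; apply: (leq_bigmax i).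
by move: h; rewrite ltr_norml => /andP[h1 h2]; rewrite (ltW h1) h2.
Qed.

Definition boxes : set (set V) := [set X | exists a b, X = box a b].

Lemma boxesI : setI_closed boxes.
Proof.
move=> _ _ [a [b ->]] [a' [b' ->]].
exists [tuple Num.max (tnth a i) (tnth a' i) | i < d],
       [tuple Num.min (tnth b i) (tnth b' i) | i < d].
apply/seteqP; split => x /=.
  move=> [h h'] i; rewrite !tnth_mktuple ge_max lt_min.
  by case/andP: (h i) => -> ->; case/andP: (h' i) => -> ->.
by move=> h; split => i; have := h i;
   rewrite !tnth_mktuple ge_max lt_min => /andP[/andP[? ?] /andP[? ?]]; apply/andP.
Qed.

(** For a fixed coordinate, the sets B whose slab lies in S form a sigma-algebra containing the rays
    [c, +oo[, hence all Borel sets; slabs generate the product structure. Keeping S arbitrary lets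
    the lemma serve both the generation by boxes and the regularity argument. *)
Lemma halfspaces_generate (S : set (set V)) : sigma_algebra setT S ->
  (forall i c, S [set x | c <= tnth x i]) -> @measurable _ V `<=` S.
Proof.
move=> [S0 SC SU] hS.
have key : forall i (B : set R), measurable B -> S [set x : V | B (tnth x i)].
  move=> i; pose E := [set B : set R | S [set x : V | B (tnth x i)]].
  suff : measurable `<=` E by move=> h B mB; exact: h.
  have -> : @measurable _ R = (@RGenCInfty.G R).-sigma.-measurable.
    exact: RGenCInfty.measurableE.
  apply: smallest_sub.
    split.
    - exact: S0.
    - move=> A EA; exact: (SC _ EA).
    - by move=> F EF; apply: SU.
  move=> _ [c ->]; rewrite /E /=.
  have -> // : [set x : V | `[c, +oo[%classic (tnth x i)] = [set x | c <= tnth x i].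
  by apply/seteqP; split => x /=; rewrite in_itv /= andbT.
apply: smallest_sub; first by split.
rewrite -bigcup_seq => A [i _] [B mB <-]; rewrite setTI.
exact: key.
Qed.

Lemma boxes_generate : @measurable _ V = <<s boxes >>.
Proof.
apply/seteqP; split; last first.
  apply: smallest_sub; first exact: sigma_algebra_measurable.
  by move=> _ [a [b ->]]; exact: measurable_box.
apply: halfspaces_generate => [|i c]; first exact: smallest_sigma_algebra.
(* The half-space is exhausted by boxes whose lower face in direction i stays at c while all other
   faces recede to infinity. *)
have -> : [set x : V | c <= tnth x i] =
  \bigcup_n box [tuple (if j == i then c else - n%:R) | j < d]
                [tuple (if j == i then c + n%:R else n%:R) | j < d].
  apply/seteqP; split => x /=.
    move=> cx; have [n nx] := box_cover x.
    exists (n + Num.bound `|tnth x i - c|%R)%N => //= j; rewrite !tnth_mktuple.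
    case: eqP => [->|_].
      rewrite cx /= -ltrBlDl natrD.
      apply: le_lt_trans (ler_norm _) _.
      apply: lt_le_trans (archi_boundP (normr_ge0 _)) _.
      by rewrite lerDr ler0n.
    have := nx j; rewrite !tnth_cvec natrD => /andP[h1 h2].
    rewrite (le_trans _ h1) ?lerN2 ?lerDl ?ler0n //=.
    by rewrite (lt_le_trans h2) // lerDl ler0n.
  by move=> [n _ /(_ i)]; rewrite !tnth_mktuple eqxx => /andP[].
apply: sigma_algebra_bigcup => n; apply: sub_sigma_algebra; by eexists; eexists.
Qed.

(** Dynkin's theorem: boxes are stable under intersection, generate the Borel sets, and the cubes
    [-n, n[^d exhaust the space with finite measure. A box with some a_i > b_i is empty, so
    agreement on properly ordered corners is enough. *)
Lemma box_measure_unique (m1 m2 : {measure set V -> \bar R}) :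
  (forall a b, (forall i, tnth a i <= tnth b i) -> m1 (box a b) = m2 (box a b)) ->
  (forall a b, (forall i, tnth a i <= tnth b i) -> (m1 (box a b) < +oo)%E) ->
  forall E, measurable E -> m1 E = m2 E.
Proof.
move=> m12 m1f E mE.
apply: (measure_unique boxes (fun n => box (cvec (- n%:R)) (cvec n%:R))) => //.
- exact: boxes_generate.
- exact: boxesI.
- by move=> n; eexists; eexists.
- by apply/seteqP; split => // x _; have [n] := box_cover x; exists n.
- move=> _ [a [b ->]].
  have [h|] := pselect (forall i, tnth a i <= tnth b i); first exact: m12.
  move=> /existsNP[i /negP]; rewrite -ltNge => bai.
  have -> : box a b = set0; last by rewrite !measure0.
  rewrite -subset0 => x /(_ i) /andP[h1 h2].
  by have := lt_trans (le_lt_trans h1 h2) bai; rewrite ltxx.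
- move=> n; apply: m1f => i; rewrite !tnth_cvec.
  by rewrite (le_trans _ (ler0n _ _)) // oppr_le0 ler0n.
Qed.

End Boxes.

Section Pushforward.
Context d1 d2 (T1 : measurableType d1) (T2 : measurableType d2) (R : realType).

Definition pushm (m : {measure set T1 -> \bar R}) (f : T1 -> T2)
    (mf : measurable_fun setT f) : {measure set T2 -> \bar R} :=
  measure_function_pushforward__canonical__measure_function_Measure m mf.

Lemma pushmE m f (mf : measurable_fun setT f) A : pushm m mf A = m (f @^-1` A).
Proof. by []. Qed.

Lemma ge0_integral_pushm m f (mf : measurable_fun setT f) (h : T2 -> \bar R) :
  measurable_fun setT h -> (forall y, 0 <= h y)%E ->
  (\int[pushm m mf]_y h y = \int[m]_x h (f x))%E.
Proof.
by move=> mh h0; rewrite (@ge0_integral_pushforward _ _ _ _ _ f mf m setT h).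
Qed.

End Pushforward.

Section LinearMaps.
Context (R : realType) (d : nat).
Local Notation V := (d.-tuple R).

Lemma measurable_to_vec d1 (T : measurableType d1) (f : T -> V) :
  (forall i, measurable_fun setT (fun x => tnth (f x) i)) -> measurable_fun setT f.
Proof. by move=> h; apply/measurable_fun_tnthP. Qed.

Lemma measurable_coord d1 (T : measurableType d1) (f : T -> V) i :
  measurable_fun setT f -> measurable_fun setT (fun x => tnth (f x) i).
Proof. by move=> /measurable_fun_tnthP /(_ i). Qed.

Lemma measurable_vadd d1 (T : measurableType d1) (f g : T -> V) :
  measurable_fun setT f -> measurable_fun setT g ->
  measurable_fun setT (fun x => vadd (f x) (g x)).
Proof.
move=> mf mg; apply: measurable_to_vec => i.
under eq_fun do rewrite tnth_mktuple.
by apply: measurable_funD; exact: measurable_coord.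
Qed.

Lemma measurable_vsub d1 (T : measurableType d1) (f g : T -> V) :
  measurable_fun setT f -> measurable_fun setT g ->
  measurable_fun setT (fun x => vsub (f x) (g x)).
Proof.
move=> mf mg; apply: measurable_to_vec => i.
under eq_fun do rewrite tnth_mktuple.
by apply: measurable_funB; exact: measurable_coord.
Qed.

Lemma measurable_mxapp d1 (T : measurableType d1) (M : 'M[R]_d) (f : T -> V) :
  measurable_fun setT f -> measurable_fun setT (fun x => mxapp M (f x)).
Proof.
move=> mf; apply: measurable_to_vec => i.
under eq_fun do rewrite tnth_mktuple.
apply: measurable_sum => j; apply: measurable_funM => //.
exact: measurable_coord.
Qed.

Lemma measurable_dotv d1 (T : measurableType d1) (f g : T -> V) :
  measurable_fun setT f -> measurable_fun setT g ->
  measurable_fun setT (fun x => dotv (f x) (g x)).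
Proof.
move=> mf mg; apply: measurable_sum => j.
by apply: measurable_funM; exact: measurable_coord.
Qed.

Lemma mxappM (M N : 'M[R]_d) x : mxapp (M *m N) x = mxapp M (mxapp N x).
Proof.
apply: vext => i; rewrite !tnth_mktuple.
under [RHS]eq_bigr => j _ do rewrite tnth_mktuple big_distrr /=.
rewrite exchange_big /=; apply: eq_bigr => j _.
by rewrite mxE big_distrl /=; apply: eq_bigr => k _; rewrite mulrA.
Qed.

Lemma mxapp1 x : mxapp (1%:M : 'M[R]_d) x = x.
Proof.
apply: vext => i; rewrite !tnth_mktuple (bigD1 i) //= mxE eqxx mul1r.
by rewrite big1 ?addr0 // => j ji; rewrite mxE eq_sym (negPf ji) mul0r.
Qed.

Lemma mxapp_vadd (M : 'M[R]_d) x y : mxapp M (vadd x y) = vadd (mxapp M x) (mxapp M y).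
Proof.
apply: vext => i; rewrite !tnth_mktuple -big_split /=; apply: eq_bigr => j _.
by rewrite tnth_mktuple mulrDr.
Qed.

Lemma mxapp_vsub (M : 'M[R]_d) x y : mxapp M (vsub x y) = vsub (mxapp M x) (mxapp M y).
Proof.
apply: vext => i; rewrite !tnth_mktuple -sumrB /=; apply: eq_bigr => j _.
by rewrite tnth_mktuple mulrBr.
Qed.

Lemma vaddK (x y : V) : vsub (vadd x y) y = x.
Proof. by apply: vext => i; rewrite !tnth_mktuple addrK. Qed.

Lemma vaddC (x y : V) : vadd x y = vadd y x.
Proof. by apply: vext => i; rewrite !tnth_mktuple addrC. Qed.

Lemma vaddA (x y z : V) : vadd x (vadd y z) = vadd (vadd x y) z.
Proof. by apply: vext => i; rewrite !tnth_mktuple addrA. Qed.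

Lemma mxapp_tr (M : 'M[R]_d) x y : dotv (mxapp M x) y = dotv x (mxapp M^T y).
Proof.
rewrite /dotv.
under eq_bigr => i _ do rewrite tnth_mktuple big_distrl /=.
under [RHS]eq_bigr => i _ do rewrite tnth_mktuple big_distrr /=.
rewrite exchange_big /=; apply: eq_bigr => i _; apply: eq_bigr => j _.
by rewrite mxE mulrA (mulrC (tnth x i)).
Qed.

Lemma dotvC (x y : V) : dotv x y = dotv y x.
Proof. by apply: eq_bigr => i _; rewrite mulrC. Qed.

Lemma dotvDr (x y z : V) : dotv x (vadd y z) = dotv x y + dotv x z.
Proof.
by rewrite /dotv -big_split /=; apply: eq_bigr => i _; rewrite tnth_mktuple mulrDr.
Qed.

Lemma dotvDl (x y z : V) : dotv (vadd y z) x = dotv y x + dotv z x.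
Proof. by rewrite !(dotvC _ x) dotvDr. Qed.

Lemma dotvBr (x y z : V) : dotv x (vsub y z) = dotv x y - dotv x z.
Proof.
by rewrite /dotv -sumrB /=; apply: eq_bigr => i _; rewrite tnth_mktuple mulrBr.
Qed.

Lemma dotvBl (x y z : V) : dotv (vsub y z) x = dotv y x - dotv z x.
Proof. by rewrite !(dotvC _ x) dotvBr. Qed.

Lemma dotv_ge0 (x : V) : 0 <= dotv x x.
Proof. by apply: sumr_ge0 => i _; rewrite -expr2 sqr_ge0. Qed.

End LinearMaps.

(** * Lebesgue measure under affine and linear maps *)

Lemma lebesgue_measure_affine (R : realType) (a b : R) (B : set R) : a != 0 -> measurable B ->
  (lebesgue_measure [set y : R | B (a * y + b)%R] = (`|a|^-1)%:E * lebesgue_measure B)%E.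
Proof.
move=> a0 mB.
have mf : measurable_fun [set: measurableTypeR R] (fun y : measurableTypeR R => a * y + b : measurableTypeR R).
  by apply: measurable_funD => //; apply: measurable_funM.
have na0 : 0 < `|a| by rewrite normr_gt0.
(* The pushforward rescaled by |a| agrees with Lebesgue measure on the intervals ]u, v], so
   uniqueness identifies the two. *)
pose m1 : {measure set (measurableTypeR R) -> \bar R} :=
  mscale (NngNum (normr_ge0 a)) (pushm lebesgue_measure mf).
have h : lebesgue_measure B = m1 B.
  apply: lebesgue_measure_unique => // _ [[u v]] _ <- /=.
  rewrite /m1 /mscale /= lebesgue_measure_itv /=.
  rewrite /pushforward /=.
  have [ap|an|/eqP] := ltgtP 0 a; last by rewrite eq_sym (negPf a0).
    have -> : (fun y : R => a * y + b) @^-1` `]u, v] = `](u - b) / a, (v - b) / a]%classic.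
      apply/seteqP; split => y /=; rewrite !in_itv /=.
        by rewrite ltr_pdivrMr // ler_pdivlMr // ltrBlDr lerBrDr mulrC.
      by rewrite ltr_pdivrMr // ler_pdivlMr // ltrBlDr lerBrDr mulrC.
    rewrite lebesgue_measure_itv /= !lte_fin ltr_pM2r ?invr_gt0 // ltrD2r.
    case: ifP => _; last by rewrite mule0.
    rewrite -EFinB -EFinM; congr EFin; rewrite gtr0_norm //; field.
    exact: a0.
  (* A negative slope swaps the endpoints, and the half-open side with them; the length is
     unaffected. *)
  have -> : (fun y : R => a * y + b) @^-1` `]u, v] = `[(v - b) / a, (u - b) / a[%classic.
    apply/seteqP; split => y /=; rewrite !in_itv /=.
      by rewrite ltr_ndivlMr // ler_ndivrMr // ltrBlDr lerBrDr mulrC andbC.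
    by rewrite ltr_ndivlMr // ler_ndivrMr // ltrBlDr lerBrDr mulrC andbC.
  rewrite lebesgue_measure_itv /= !lte_fin ltr_nM2r ?invr_lt0 // ltrD2r.
  case: ifP => _; last by rewrite mule0.
  rewrite -EFinB -EFinM; congr EFin; rewrite ltr0_norm //; field.
  exact: a0.
rewrite h /m1 /mscale /= muleA -EFinM mulVf ?mul1e //.
by rewrite normr_eq0.
Qed.

Section Lebesgue.
Context (R : realType) (d : nat).
Local Notation V := (d.-tuple R).
Variable lam : {measure set V -> \bar R}.
Hypothesis lamL : is_lebesgue lam.

Lemma lam_box (a b : V) : (forall i, tnth a i <= tnth b i) ->
  lam (box a b) = (\prod_(i < d) (tnth b i - tnth a i))%:E.
Proof. exact: lamL. Qed.

Lemma lam_box_lty (a b : V) : (forall i, tnth a i <= tnth b i) -> (lam (box a b) < +oo)%E.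
Proof. by move=> ab; rewrite lam_box // ltry. Qed.

Lemma lam_sigma_finite : sigma_finite setT lam.
Proof.
exists (fun n => box (cvec d (- n%:R)) (cvec d n%:R)).
  by apply/esym/seteqP; split => // x _; have [n] := box_cover x; exists n.
move=> n; split; first exact: measurable_box.
apply: lam_box_lty => i; rewrite !tnth_cvec.
by rewrite (le_trans _ (ler0n _ _)) // oppr_le0 ler0n.
Qed.

Let lamF : set V -> \bar R := lam.
HB.instance Definition _ := Measure.on lamF.
HB.instance Definition _ := Measure_isSigmaFinite.Build _ _ _ lamF lam_sigma_finite.

(** The same measure bundled with its sigma-finiteness, the form that Tonelli and Fubini require. *)
Definition lamS : {sigma_finite_measure set V -> \bar R} := lamF.

Lemma lam_unique (m : {measure set V -> \bar R}) :
  (forall a b, (forall i, tnth a i <= tnth b i) -> m (box a b) = lam (box a b)) ->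
  forall E, measurable E -> m E = lam E.
Proof.
move=> h E mE; apply: box_measure_unique mE => // a b ab.
by rewrite h // lam_box_lty.
Qed.

Lemma measurable_preimage d1 d2 (T1 : measurableType d1) (T2 : measurableType d2)
  (f : T1 -> T2) (E : set T2) : measurable_fun setT f -> measurable E ->
  measurable [set x | E (f x)].
Proof. by move=> mf mE; have := mf measurableT E mE; rewrite setTI. Qed.

Lemma lam_translate (v : V) E : measurable E -> lam [set x | E (vadd x v)] = lam E.
Proof.
move=> mE.
have mf : measurable_fun setT (fun x : V => vadd x v) by exact: measurable_vadd.
apply: (lam_unique (m := pushm lam mf)) mE => a b ab.
rewrite pushmE.
have -> : (fun x : V => vadd x v) @^-1` box a b = box (vsub a v) (vsub b v).
  apply/seteqP; split => x h i; have := h i; rewrite !tnth_mktuple.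
    by rewrite lerBlDr ltrBrDr.
  by rewrite lerBlDr ltrBrDr.
rewrite !lam_box //; last by move=> i; rewrite !tnth_mktuple lerB.
congr EFin; apply: eq_bigr => i _; rewrite !tnth_mktuple; ring.
Qed.

Definition cupd (k : 'I_d) (x : V) (y : R) : V :=
  [tuple if j == k then y else tnth x j | j < d].

Lemma measurable_cupd d1 (T : measurableType d1) k (f : T -> V) (g : T -> R) :
  measurable_fun setT f -> measurable_fun setT g ->
  measurable_fun setT (fun x => cupd k (f x) (g x)).
Proof.
move=> mf mg; apply: measurable_to_vec => i.
under eq_fun do rewrite tnth_mktuple.
by case: eqP => // _; exact: measurable_coord.
Qed.

(** Restricted to this slab, the k-th coordinate contributes a factor 1 to the volume of a box.
    Overwriting it with a fresh real variable of Lebesgue measure then restores the whole space. *)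
Let slab01 k : set V := [set x | `[0, 1[%classic (tnth x k)].

Let mslab01 k : measurable (slab01 k).
Proof. exact: measurable_slab. Qed.

Let mcupd k : measurable_fun setT (fun p : V * measurableTypeR R => cupd k p.1 p.2).
Proof. by apply: measurable_cupd. Qed.

(* Lebesgue measure disintegrated along the k-th coordinate. *)
Let disint k : {measure set V -> \bar R} :=
  pushm (mrestr lam (mslab01 k) \x @lebesgue_measure R)%E (mcupd k).

Lemma disintE k E : measurable E -> disint k E = lam E.
Proof.
move: E; apply: lam_unique => a b ab; rewrite pushmE.
(* The corners of the box whose k-th side has been replaced by [0, 1[. *)
pose a' := cupd k a 0; pose b' := cupd k b 1.
have -> : (fun p : V * measurableTypeR R => cupd k p.1 p.2) @^-1` box a b =
   [set x : V | forall j, j != k -> tnth a j <= tnth x j < tnth b j] `*`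
   `[tnth a k, tnth b k[%classic.
  apply/seteqP; split => [[x y]|[x y]] /=.
    move=> h; split => [j jk|].
      by have := h j; rewrite !tnth_mktuple /= (negPf jk).
    by have := h k; rewrite !tnth_mktuple /= eqxx in_itv.
  rewrite in_itv /= => -[h h2] j; rewrite !tnth_mktuple /=.
  by case: eqP => [->//|/eqP]; exact: h.
have E1 : [set x : V | forall j, j != k -> tnth a j <= tnth x j < tnth b j] `&` slab01 k
   = box a' b'.
  apply/seteqP; split => x.
    move=> [h h2] j; rewrite !tnth_mktuple; case: eqP => [->|/eqP]; last exact: h.
    by move: h2; rewrite /slab01 /= in_itv.
  move=> h; split => [j jk|].
    by have := h j; rewrite !tnth_mktuple (negPf jk).
  by have := h k; rewrite !tnth_mktuple eqxx /slab01 /= in_itv.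
rewrite [LHS](@product_measure1E _ _ _ (measurableTypeR R) R
  (mrestr lam (mslab01 k)) (@lebesgue_measure R)) //.
  transitivity (lam (box a' b') * @lebesgue_measure R `[tnth a k, tnth b k[%classic)%E.
    by rewrite -E1.
  rewrite !lam_box //; last first.
    by move=> i; rewrite !tnth_mktuple; case: ifP.
  rewrite lebesgue_measure_itv /= lte_fin [RHS](_ : _ = ((\prod_(i < d) (tnth b' i - tnth a' i)) * (tnth b k - tnth a k))%:E).
    case: ltP => h; first by rewrite EFinM EFinB.
    have -> : tnth b k = tnth a k by apply/le_anti; rewrite h ab.
    by rewrite subrr mulr0 mule0.
  congr EFin; rewrite (bigD1 k) //= [in RHS](bigD1 k) //= !tnth_mktuple eqxx subr0 mul1r mulrC.
  congr (_ * _); apply: eq_bigr => i ik.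
  by rewrite !tnth_mktuple (negPf ik).
have -> : [set x : V | forall j, j != k -> tnth a j <= tnth x j < tnth b j] =
  \bigcap_(j in [set j | j != k]) [set x : V | `[tnth a j, tnth b j[%classic (tnth x j)].
  apply/seteqP; split => x h j jk; first by rewrite /= in_itv /= h.
  by have := h j jk; rewrite /= in_itv.
apply: fin_bigcap_measurable => [|j _]; last exact: measurable_slab.
exact: (@sub_finite_set _ _ [set: 'I_d]).
Qed.

(** Only coordinate k changes under N, and on each line in direction k the map is affine with slope
    N k k. Disintegrating along k reduces the claim to the one-dimensional scaling law. *)
Lemma lam_row_map k (N : 'M[R]_d) E :
  (forall i j, i != k -> N i j = (i == j)%:R) -> N k k != 0 -> measurable E ->
  lam [set x | E (mxapp N x)] = ((`|N k k|^-1)%:E * lam E)%E.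
Proof.
move=> hN a0 mE.
have mE' : measurable [set x | E (mxapp N x)].
  by apply: measurable_preimage mE; exact: measurable_mxapp.
rewrite -(disintE k mE') -(disintE k mE) !pushmE.
rewrite /product_measure1 -ge0_integralZl //; last first.
  apply: measurable_fun_xsection.
  exact: (measurable_preimage (mcupd k) mE).
apply: eq_integral => x _ /=.
(* The shift of coordinate k, constant along the line. *)
pose be := \sum_(j < d | j != k) N k j * tnth x j.
have mB : measurable [set y : R | E (cupd k x y)].
  apply: measurable_preimage mE.
  by apply: measurable_cupd.
have e1 : xsection ((fun p : V * measurableTypeR R => cupd k p.1 p.2) @^-1` E) x =
  [set y : R | E (cupd k x y)].
  by apply/seteqP; split => y; [move=> /set_mem | move=> ?; apply/mem_set].
have e2 : xsection ((fun p : V * measurableTypeR R => cupd k p.1 p.2) @^-1` [set x0 | E (mxapp N x0)]) x =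
  [set y : R | [set y : R | E (cupd k x y)] (N k k * y + be)].
  have eN y : mxapp N (cupd k x y) = cupd k x (N k k * y + be).
    apply: vext => i; rewrite !tnth_mktuple.
    case: (eqVneq i k) => [->|ik].
      rewrite (bigD1 k) //= tnth_mktuple eqxx; congr (_ + _).
      by apply: eq_bigr => j jk; rewrite tnth_mktuple (negPf jk).
    rewrite (bigD1 i) //= hN // eqxx mul1r tnth_mktuple (negPf ik) big1 ?addr0 //.
    by move=> j ji; rewrite hN // eq_sym (negPf ji) mul0r.
  by apply/seteqP; split => y; [move=> /set_mem /=|move=> /= ?; apply/mem_set => /=]; rewrite eN.
by rewrite e1 e2 lebesgue_measure_affine.
Qed.

(** The cofactors of row k do not see row k, so they are those of the identity, read off from its
    adjugate. *)
Lemma det_row_map k (N : 'M[R]_d) :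
  (forall i j, i != k -> N i j = (i == j)%:R) -> \det N = N k k.
Proof.
move=> hN; rewrite (expand_det_row _ k).
have hc j : cofactor N k j = (j == k)%:R.
  have -> : cofactor N k j = cofactor 1%:M k j.
    rewrite /cofactor; congr (_ * \det _); apply/matrixP => u v; rewrite !mxE.
    by rewrite hN // eq_sym neq_lift.
  have : (\adj (1%:M : 'M[R]_d)) j k = (j == k)%:R.
    by have := mul_mx_adj (1%:M : 'M[R]_d); rewrite mul1mx det1 => ->; rewrite mxE.
  by rewrite mxE.
rewrite (bigD1 k) //= hc eqxx mulr1 big1 ?addr0 // => j jk.
by rewrite hc (negPf jk) mulr0.
Qed.

Definition scales (M : 'M[R]_d) := forall E, measurable E ->
  lam [set x | E (mxapp M x)] = ((`|\det M|^-1)%:E * lam E)%E.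

Lemma scales1 : scales 1%:M.
Proof.
move=> E mE; rewrite det1 normr1 invr1 mul1e; congr (lam _).
by apply/seteqP; split => x /=; rewrite mxapp1.
Qed.

Lemma scalesM M N : scales M -> scales N -> scales (M *m N).
Proof.
move=> hM hN E mE.
have -> : [set x | E (mxapp (M *m N) x)] = [set x | [set y | E (mxapp M y)] (mxapp N x)].
  by apply/seteqP; split => x /=; rewrite mxappM.
rewrite hN; last by apply: measurable_preimage mE; exact: measurable_mxapp.
by rewrite hM // muleA -EFinM det_mulmx normrM invfM mulrC.
Qed.

Lemma scales_row k (N : 'M[R]_d) :
  (forall i j, i != k -> N i j = (i == j)%:R) -> N \in unitmx -> scales N.
Proof.
move=> hN; rewrite unitmxE unitfE (det_row_map hN) => a0 E mE.
by rewrite (det_row_map hN); exact: lam_row_map.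
Qed.

Lemma scales_perm (s : {perm 'I_d}) : scales (perm_mx s).
Proof.
move=> E mE; rewrite det_perm normr_sign invr1 mul1e.
have mf : measurable_fun setT (fun x : V => mxapp (perm_mx s) x) by exact: measurable_mxapp.
have pE x i : tnth (mxapp (perm_mx s) x : V) i = tnth x (s i).
  rewrite tnth_mktuple (bigD1 (s i)) //= !mxE eqxx mul1r big1 ?addr0 // => j ji.
  by rewrite !mxE eq_sym (negPf ji) mul0r.
apply: (lam_unique (m := pushm lam mf)) mE => a b ab.
rewrite pushmE.
have -> : (fun x : V => mxapp (perm_mx s) x) @^-1` box a b =
  box [tuple tnth a ((s^-1)%g i) | i < d] [tuple tnth b ((s^-1)%g i) | i < d].
  apply/seteqP; split => x h i.
    have := h ((s^-1)%g i); rewrite pE !tnth_mktuple.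
    by rewrite permKV.
  by have := h (s i); rewrite pE !tnth_mktuple permK.
rewrite !lam_box //; last by move=> i; rewrite !tnth_mktuple.
congr EFin; rewrite [RHS](reindex_inj (@perm_inj _ (s^-1)%g)) /=.
by apply: eq_bigr => i _; rewrite !tnth_mktuple.
Qed.

Let rows (M : 'M[R]_d) (k : nat) : 'M[R]_d :=
  \matrix_(i, j) if (i < k)%N then M i j else (i == j)%:R.

(** [rows M k] has the first k rows of M above rows of the identity. Two consecutive ones differ in
    a single row, so their quotient is a row map as in [lam_row_map]; M is the product of these
    quotients. *)
Lemma scales_rows M : (forall k, rows M k \in unitmx) -> scales M.
Proof.
move=> hu.
have -> : M = rows M d by apply/matrixP => i j; rewrite mxE ltn_ord.
suff : forall k, (k <= d)%N -> scales (rows M k) by move=> h; exact: h.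
elim=> [_|k IH kd].
  have -> : rows M 0 = 1%:M by apply/matrixP => i j; rewrite !mxE ltn0.
  exact: scales1.
pose N := rows M k.+1 *m invmx (rows M k).
have -> : rows M k.+1 = N *m rows M k by rewrite /N mulmxKV.
apply: scalesM; last by apply: IH; exact: ltnW.
apply: (@scales_row (Ordinal kd)); last first.
  by rewrite /N unitmx_mul hu unitmx_inv hu.
move=> i j ik.
have : row i N = row i (1%:M : 'M[R]_d).
  rewrite /N row_mul.
  have -> : row i (rows M k.+1) = row i (rows M k).
    apply/rowP => l; rewrite !mxE ltnS leq_eqVlt.
    by have -> : (i == k :> nat) = false by apply/negbTE; apply: contraNneq ik => e; apply/eqP/val_inj.
  by rewrite -row_mul mulmxV.
by move/rowP => /(_ j); rewrite !mxE.
Qed.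

(** Each [rows M k] is again triangular, with diagonal entries taken from M or equal to 1, hence
    invertible. *)
Lemma scales_lower (M : 'M[R]_d) : is_trig_mx M -> M \in unitmx -> scales M.
Proof.
move=> /is_trig_mxP tM uM; apply: scales_rows => k.
have tk : is_trig_mx (rows M k).
  apply/is_trig_mxP => i j ij; rewrite mxE; case: ifP => _; first exact: tM.
  by have -> : (i == j) = false by apply/negbTE; rewrite neq_ltn ij.
rewrite unitmxE unitfE (det_trig tk) prodf_seq_neq0; apply/allP => i _ /=.
rewrite mxE eqxx; case: ifP => _; last exact: oner_neq0.
move: uM; rewrite unitmxE unitfE det_trig; last exact/is_trig_mxP.
by rewrite prodf_seq_neq0 => /allP /(_ i (mem_index_enum _)).
Qed.

Lemma scales_upper (M : 'M[R]_d) : is_trig_mx M^T -> M \in unitmx -> scales M.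
Proof.
move=> /is_trig_mxP tM uM; apply: scales_rows => k.
have tk : is_trig_mx (rows M k)^T.
  apply/is_trig_mxP => i j ij; rewrite mxE mxE; case: ifP => _.
    by have := tM i j ij; rewrite mxE.
  by have -> : (j == i) = false by apply/negbTE; rewrite neq_ltn ij orbT.
rewrite unitmxE unitfE -det_tr (det_trig tk) prodf_seq_neq0; apply/allP => i _ /=.
rewrite mxE mxE eqxx; case: ifP => _; last exact: oner_neq0.
move: uM; rewrite unitmxE unitfE -det_tr det_trig; last exact/is_trig_mxP.
by rewrite prodf_seq_neq0 => /allP /(_ i (mem_index_enum _)); rewrite /= mxE.
Qed.

End Lebesgue.

Section LinearChange.
Context (R : realType) (d : nat).
Local Notation V := (d.-tuple R).
Variable lam : {measure set V -> \bar R}.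
Hypothesis lamL : is_lebesgue lam.

Lemma lam_linear (M : 'M[R]_d) E : M \in unitmx -> measurable E ->
  lam [set x | E (mxapp M x)] = ((`|\det M|^-1)%:E * lam E)%E.
Proof.
(* The LUP decomposition concerns matrices of positive size; in dimension 0 the only matrix is the
   identity. *)
move: lam lamL M E; case: d => [|n] mu muL M E uM.
  have -> : M = 1%:M by rewrite [LHS]flatmx0 [RHS]flatmx0.
  exact: scales1.
move: E; rewrite -/(scales mu M).
have := cormen_lup_correct M; have := cormen_lup_perm M; have := cormen_lup_detL M.
have := @cormen_lup_lower _ _ M; have := @cormen_lup_upper _ _ M.
case: (cormen_lup M) => [[P L] U] /= hU hL dL /is_perm_mxP [s ->].
rewrite -!mulmxE => e.
have e' : M = perm_mx s^-1 *m (L *m U).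
  by rewrite -e mulmxA -perm_mxM mulVg perm_mx1 mul1mx.
have uLU : (L \in unitmx) && (U \in unitmx).
  by rewrite -unitmx_mul -e unitmx_mul unitmx_perm.
case/andP: uLU => uL uU.
rewrite e'; apply: scalesM; first exact: scales_perm.
apply: scalesM.
  apply: scales_lower => //; apply/is_trig_mxP => i j ij.
  rewrite hL; last exact: ltnW.
  by have -> : (i == j) = false by apply/negbTE; rewrite neq_ltn ij.
apply: scales_upper => //; apply/is_trig_mxP => i j ij.
by rewrite mxE hU.
Qed.

Lemma integral_translate (v : V) (f : V -> \bar R) :
  measurable_fun setT f -> (forall x, 0 <= f x)%E ->
  (\int[lam]_x f (vadd x v) = \int[lam]_x f x)%E.
Proof.
move=> mf f0.
have mt : measurable_fun setT (fun x : V => vadd x v) by exact: measurable_vadd.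
rewrite -(ge0_integral_pushm lam mt mf f0).
by apply: eq_measure_integral => A mA _; rewrite pushmE; exact: (lam_translate lamL).
Qed.

Lemma integral_linear (M : 'M[R]_d) (f : V -> \bar R) : M \in unitmx ->
  measurable_fun setT f -> (forall x, 0 <= f x)%E ->
  (\int[lam]_x f (mxapp M x) = (`|\det M|^-1)%:E * \int[lam]_x f x)%E.
Proof.
move=> uM mf f0.
have mt : measurable_fun setT (fun x : V => mxapp M x) by exact: measurable_mxapp.
rewrite -(ge0_integral_pushm lam mt mf f0).
have a0 : 0 <= `|\det M|^-1 by rewrite invr_ge0.
rewrite (@eq_measure_integral _ _ _ _ (mscale (NngNum a0) lam)); last first.
  by move=> A mA _; rewrite pushmE; exact: lam_linear.
by rewrite ge0_integral_mscale.
Qed.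

Lemma lam_tonelli (f : V * V -> \bar R) :
  measurable_fun setT f -> (forall x, 0 <= f x)%E ->
  (\int[lam]_x \int[lam]_y f (x, y) = \int[lam]_y \int[lam]_x f (x, y))%E.
Proof.
by move=> mf f0; exact: (@fubini_tonelli _ _ _ _ _ (lamS lamL) (lamS lamL)).
Qed.

Lemma measurable_int_r d1 (T : measurableType d1) (f : T * V -> \bar R) :
  measurable_fun setT f -> (forall x, 0 <= f x)%E ->
  measurable_fun setT (fun x => \int[lam]_y f (x, y))%E.
Proof.
by move=> mf f0; exact: (@measurable_fun_fubini_tonelli_F _ _ _ _ _ (lamS lamL)).
Qed.

(** Measurability is not asked for, because the integral of a nonnegative function is a supremum
    over the simple functions below it. This permits comparison with [maxfun], a supremum over
    uncountably many points. *)
Lemma ge0_le_integralT (f g : V -> \bar R) : (forall x, 0 <= f x)%E ->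
  (forall x, f x <= g x)%E -> (\int[lam]_x f x <= \int[lam]_x g x)%E.
Proof.
move=> f0 fg.
have g0 x : (0 <= g x)%E by exact: le_trans (f0 x) (fg x).
rewrite !ge0_integralTE //; apply: ereal_sup_le => _ [h hf <-].
by exists h => // x; exact: le_trans (hf x) (fg x).
Qed.

End LinearChange.

(** * Averaging lattice sums *)

Section CountableSums.
Context d (V : measurableType d) (R : realType) (mu : {measure set V -> \bar R}) (T : countType).

(** Turns an unordered sum into a series over the codes of T, with 0 at the integers that code
    nothing, so that termwise integration of series applies. *)
Lemma esum_count (a : T -> \bar R) : (forall k, 0 <= a k)%E ->
  (\esum_(k in [set: T]) a k = \sum_(n <oo) oapp a 0 (pickle_inv n))%E.
Proof.
move=> a0; rewrite nneseries_esumT; last by move=> n; case: pickle_inv.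
transitivity (\esum_(n in range (@pickle T)) oapp a 0%E (pickle_inv n)).
  rewrite (@reindex_esum R T nat setT (range (@pickle T)) (@pickle T)).
    by apply: eq_esum => k _; rewrite pickleK_inv.
  split; [by []| |by []].
  by move=> x y _ _; exact: (pcan_inj (@pickleK_inv T)).
rewrite esum_mkcond; apply: eq_esum => n _; case: ifP => // /negP h.
case e : (pickle_inv n) => [k|//]; exfalso; apply: h; apply/mem_set.
by exists k => //; have := @pickle_invK T n; rewrite e.
Qed.

Lemma measurable_esum (f : T -> V -> \bar R) :
  (forall k, measurable_fun setT (f k)) -> (forall k x, 0 <= f k x)%E ->
  measurable_fun setT (fun x => \esum_(k in [set: T]) f k x).
Proof.
move=> mf f0; under eq_fun do rewrite esum_count //.
apply: (@ge0_emeasurable_sum _ _ _ _ (fun n x => oapp (f ^~ x) 0%E (pickle_inv n)) xpredT).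
  by move=> n x _ _; case: pickle_inv => [k|] //=.
by move=> n _; case: pickle_inv => [k|] /=; [exact: mf|exact: measurable_cst].
Qed.

Lemma integral_esum (f : T -> V -> \bar R) :
  (forall k, measurable_fun setT (f k)) -> (forall k x, 0 <= f k x)%E ->
  (\int[mu]_x (\esum_(k in [set: T]) f k x) = \esum_(k in [set: T]) (\int[mu]_x f k x))%E.
Proof.
move=> mf f0; rewrite esum_count; last by move=> k; apply: integral_ge0.
under eq_integral do rewrite esum_count //.
rewrite integral_nneseries //.
- by apply: eq_eseriesr => n _; case: pickle_inv => //=; rewrite integral0.
- by move=> n; case: pickle_inv => [k|] /=; [exact: mf|exact: measurable_cst].
- by move=> n x _; case: pickle_inv => [k|] //=.
Qed.

End CountableSums.

Section CountableSums2.
Context (R : realType) (T : countType).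

Lemma esumZl (c : R) (a : T -> \bar R) : 0 <= c -> (forall k, 0 <= a k)%E ->
  (\esum_(k in [set: T]) (c%:E * a k) = c%:E * \esum_(k in [set: T]) a k)%E.
Proof.
move=> c0 a0; rewrite !esum_count //; last by move=> k; apply: mule_ge0.
rewrite -nneseriesZl //; last by move=> n _; case: pickle_inv => /=.
by apply: eq_eseriesr => n _; case: pickle_inv => //=; rewrite mule0.
Qed.

Lemma esum_single (k0 : T) (a : T -> \bar R) : (0 <= a k0)%E -> (forall k, k <> k0 -> a k = 0%E) ->
  \esum_(k in [set: T]) a k = a k0.
Proof.
move=> a0 h; rewrite -[RHS]esum_set1 // [RHS]esum_mkcond; apply: eq_esum => k _.
by case: ifP => // /negP hk; apply: h => e; apply: hk; rewrite e; apply/mem_set.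
Qed.

End CountableSums2.

Section Lattice.
Context (R : realType) (d : nat).
Local Notation V := (d.-tuple R).
Variable lam : {measure set V -> \bar R}.
Hypothesis lamL : is_lebesgue lam.

Definition ind (E : set V) (x : V) : \bar R := (\1_E x)%:E.

Lemma ind_ge0 E x : (0 <= ind E x)%E.
Proof. by rewrite lee_fin. Qed.

Lemma measurable_ind E : measurable E -> measurable_fun setT (ind E).
Proof. by move=> mE; apply/measurable_EFinP; exact: measurable_indic. Qed.

Lemma ind1 (E : set V) x : E x -> ind E x = 1%E.
Proof. by move=> h; rewrite /ind indicE mem_set. Qed.

Lemma ind0 (E : set V) x : ~ E x -> ind E x = 0%E.
Proof. by move=> h; rewrite /ind indicE memNset. Qed.

Lemma integral_ind E : measurable E -> (\int[lam]_x ind E x = lam E)%E.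
Proof. by move=> mE; rewrite integral_indic // setIT. Qed.

Definition unitcube : set V := box (cvec d 0) (cvec d 1).
Definition cube (t : R) : set V := box (cvec d (- t)) (cvec d t).

Lemma lam_unitcube : lam unitcube = 1%E.
Proof.
rewrite (lam_box lamL) => [|i]; last by rewrite !tnth_cvec.
by congr EFin; rewrite big1 // => i _; rewrite !tnth_cvec subr0.
Qed.

Lemma lam_cube t : 0 <= t -> lam (cube t) = ((2 * t) ^+ d)%:E.
Proof.
move=> t0; rewrite (lam_box lamL) => [|i]; last by rewrite !tnth_cvec; lra.
congr EFin; under eq_bigr do rewrite !tnth_cvec.
rewrite prodr_const card_ord; congr (_ ^+ _); ring.
Qed.

(** Exactly one integer translate of the half-open unit cube contains x: the one at the vector of
    floors of its coordinates. *)
Lemma unitcube_tiles (x : V) (c : \bar R) : (0 <= c)%E ->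
  (\esum_(k in [set: d.-tuple int]) (ind unitcube (vsub x (intvec R k)) * c) = c)%E.
Proof.
move=> c0.
pose k0 : d.-tuple int := [tuple Num.floor (tnth x i) | i < d].
rewrite (esum_single (k0 := k0)); first 2 last.
- move=> k kk0; rewrite ind0 ?mul0e // => h; apply: kk0; apply: eq_from_tnth => i.
  have := h i; rewrite !tnth_mktuple => /andP[h1 h2].
  apply/esym/floor_def; rewrite intrD; lra.
- rewrite ind1 ?mul1e // => i; rewrite !tnth_mktuple.
  by have := floor_itv (tnth x i); rewrite intrD; lra.
- by rewrite mule_ge0 // ind_ge0.
Qed.

Lemma measurable_comp_vadd (f : V -> \bar R) (v : V) : measurable_fun setT f ->
  measurable_fun setT (fun x => f (vadd x v)).
Proof. by move=> mf; apply: (measurableT_comp mf); exact: measurable_vadd. Qed.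

Lemma measurable_comp_vsub (f : V -> \bar R) (v : V) : measurable_fun setT f ->
  measurable_fun setT (fun x => f (vsub x v)).
Proof. by move=> mf; apply: (measurableT_comp mf); exact: measurable_vsub. Qed.

Lemma measurable_comp_mx (f : V -> \bar R) (M : 'M[R]_d) : measurable_fun setT f ->
  measurable_fun setT (fun x => f (mxapp M x)).
Proof. by move=> mf; apply: (measurableT_comp mf); exact: measurable_mxapp. Qed.

Lemma integral_translateB (v : V) (f : V -> \bar R) :
  measurable_fun setT f -> (forall x, 0 <= f x)%E ->
  (\int[lam]_x f (vsub x v) = \int[lam]_x f x)%E.
Proof.
move=> mf f0; rewrite -(integral_translate lamL v) //; last exact: measurable_comp_vsub.
by apply: eq_integral => x _; rewrite vaddK.
Qed.

Lemma unitcube_measurable : measurable unitcube.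
Proof. exact: measurable_box. Qed.

Lemma cube_measurable t : measurable (cube t).
Proof. exact: measurable_box. Qed.

Hint Resolve ind_ge0 unitcube_measurable cube_measurable : core.

(** Insert the tiling by integer translates of the cube into the integral of h, integrate termwise,
    and translate each piece back to the cube. *)
Lemma integral_periodize (h : V -> \bar R) :
  measurable_fun setT h -> (forall x, 0 <= h x)%E ->
  (\int[lam]_p (ind unitcube p * \esum_(k in [set: d.-tuple int]) h (vadd p (intvec R k)))
   = \int[lam]_x h x)%E.
Proof.
move=> mh h0.
have mi := measurable_ind unitcube_measurable.
transitivity (\int[lam]_x (\esum_(k in [set: d.-tuple int])
     (ind unitcube (vsub x (intvec R k)) * h x)))%E; last first.
  by apply: eq_integral => x _; rewrite unitcube_tiles.
rewrite integral_esum; last 2 first.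
- by move=> k; apply: emeasurable_funM => //; apply: measurable_comp_vsub.
- by move=> k x; apply: mule_ge0.
under eq_integral do rewrite -esumZl //.
rewrite integral_esum; last 2 first.
- by move=> k; apply: emeasurable_funM => //; apply: measurable_comp_vadd.
- by move=> k x; apply: mule_ge0.
apply: eq_esum => k _.
rewrite -[RHS](integral_translate lamL (intvec R k)).
- by apply: eq_integral => x _; rewrite vaddK.
- by apply: emeasurable_funM => //; apply: measurable_comp_vsub.
- by move=> x; apply: mule_ge0.
Qed.

Definition lattice_sum (M : 'M[R]_d) (F : V -> \bar R) (y : V) : \bar R :=
  \esum_(k in [set: d.-tuple int]) F (vadd (mxapp M (intvec R k)) y).

Section Averages.
Variables (M : 'M[R]_d) (F : V -> \bar R).
Hypotheses (uM : M \in unitmx) (mF : measurable_fun setT F) (F0 : forall x, (0 <= F x)%E).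

Lemma lattice_sum_ge0 y : (0 <= lattice_sum M F y)%E.
Proof. by apply: esum_ge0. Qed.

Lemma measurable_lattice_sum : measurable_fun setT (lattice_sum M F).
Proof.
apply: measurable_esum => // k; apply: (measurableT_comp mF).
exact: measurable_vadd.
Qed.

Hint Resolve lattice_sum_ge0 measurable_lattice_sum : core.

(** As p runs over the unit cube and k over the integer vectors, p + k covers the space once; the
    averaged lattice sum unfolds into the integral of F(M p + y) dp. *)
Lemma lattice_sum_mean y :
  (\int[lam]_p (ind unitcube p * lattice_sum M F (vadd y (mxapp M p)))
   = (`|\det M|^-1)%:E * \int[lam]_x F x)%E.
Proof.
have mFy : measurable_fun setT (fun x => F (vadd x y)) by exact: measurable_comp_vadd.
transitivity (\int[lam]_p F (vadd (mxapp M p) y))%E; last first.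
  by rewrite (integral_linear lamL uM (f := fun x => F (vadd x y))) // integral_translate.
rewrite -(@integral_periodize (fun p => F (vadd (mxapp M p) y))) //; last first.
  exact: (@measurable_comp_mx (fun x => F (vadd x y))).
apply: eq_integral => p _; congr (_ * _)%E; apply: eq_esum => k _.
congr F; rewrite mxapp_vadd -vaddA [vadd y _]vaddC !vaddA.
by rewrite [vadd (mxapp M (intvec R k)) _]vaddC.
Qed.

(** A crude bound for the largest absolute row sum, hence for how far M moves a point of the unit
    cube in any coordinate. It is the width of the boundary layer in the two estimates below. *)
Definition mxbound : R := \sum_i \sum_j `|M i j|.

Lemma mxbound_ge0 : 0 <= mxbound.
Proof. by apply: sumr_ge0 => i _; apply: sumr_ge0. Qed.

Lemma mxboundP p i : unitcube p -> `|tnth (mxapp M p) i| <= mxbound.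
Proof.
move=> hp; rewrite tnth_mktuple (le_trans (ler_norm_sum _ _ _)) //.
rewrite /mxbound [leRHS](bigD1 i) //= -[leLHS]addr0 lerD //; last first.
  by apply: sumr_ge0 => j _; apply: sumr_ge0.
apply: ler_sum => j _; rewrite normrM ler_piMr //.
have := hp j; rewrite !tnth_cvec => /andP[h1 h2].
by rewrite ger0_norm // ltW.
Qed.

(** Replace the integral of F by its expression as a cell average based at each y of [cube t], then
    exchange the integrals. For fixed p the translation by M p carries [cube t] into
    [cube (t + r)]. *)
Lemma mxbound_lower t r : 0 <= t -> mxbound <= r ->
  (((2 * t) ^+ d * `|\det M|^-1)%:E * \int[lam]_x F x <=
    \int[lam]_y (ind (cube (t + r)) y * lattice_sum M F y))%E.
Proof.
move=> t0 hr; have r0 := le_trans mxbound_ge0 hr.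
have mi := measurable_ind unitcube_measurable.
have mc u := measurable_ind (cube_measurable u).
set g := lattice_sum M F.
rewrite EFinM -muleA -(lam_cube t0) -integral_ind // -ge0_integralZr //; last first.
  by rewrite mule_ge0 ?lee_fin ?invr_ge0 // integral_ge0.
under eq_integral => y _ do rewrite -(lattice_sum_mean y).
have mgp : measurable_fun setT (fun p : V * V => g (vadd p.1 (mxapp M p.2))).
  apply: measurableT_comp => //; apply: measurable_vadd => //.
  exact: measurable_mxapp.
rewrite [leLHS](_ : _ = \int[lam]_y \int[lam]_p
   (ind (cube t) y * (ind unitcube p * g (vadd y (mxapp M p)))))%E; last first.
  apply: eq_integral => y _; rewrite ge0_integralZl //.
    apply: emeasurable_funM => //; apply: measurableT_comp => //.
    by apply: measurable_vadd => //; exact: measurable_mxapp.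
  by move=> p _; exact: mule_ge0.
rewrite (lam_tonelli lamL (f := fun q : V * V => (ind (cube t) q.1 * (ind unitcube q.2 * g (vadd q.1 (mxapp M q.2))))%E)); last 2 first.
- apply: emeasurable_funM; first exact: measurableT_comp.
  apply: emeasurable_funM => //; exact: measurableT_comp.
- by move=> q; rewrite !mule_ge0.
have -> : (\int[lam]_y (ind (cube (t + r)) y * g y) =
   \int[lam]_p (ind unitcube p * \int[lam]_y (ind (cube (t + r)) y * g y)))%E.
  rewrite ge0_integralZr //; last by apply: integral_ge0 => y _; exact: mule_ge0.
  by rewrite integral_ind // lam_unitcube mul1e.
apply: ge0_le_integralT => p.
  by apply: integral_ge0 => y _; rewrite !mule_ge0.
have [hp|hp] := pselect (unitcube p); last first.
  by rewrite ind0 // mul0e integral0_eq // => y _; rewrite mul0e mule0.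
rewrite [leLHS](_ : _ = \int[lam]_y (ind (cube t) y * g (vadd y (mxapp M p))))%E; last first.
  by apply: eq_integral => y _ /=; rewrite (ind1 hp) mul1e.
rewrite (ind1 hp) mul1e -[leRHS](integral_translate lamL (mxapp M p)); last 2 first.
- by apply: emeasurable_funM.
- by move=> x; apply: mule_ge0.
apply: ge0_le_integralT => y; first by rewrite !mule_ge0.
have [hy|hy] := pselect (cube t y); last first.
  by rewrite ind0 // mul0e mule_ge0.
rewrite !ind1 // => i; have := hy i; have := mxboundP i hp.
by rewrite !tnth_mktuple ler_norml => /andP[h1 h2] /andP[h3 h4]; lra.
Qed.

(** The mirror estimate: a point that lies in [cube t] after translation by M p already lay in
    [cube (t + r)] before it. *)
Lemma mxbound_upper t r : 0 <= t -> mxbound <= r ->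
  (\int[lam]_y (ind (cube t) y * lattice_sum M F y) <=
    ((2 * (t + r)) ^+ d * `|\det M|^-1)%:E * \int[lam]_x F x)%E.
Proof.
move=> t0 hr; have r0 := le_trans mxbound_ge0 hr.
have mi := measurable_ind unitcube_measurable.
have mc u := measurable_ind (cube_measurable u).
set g := lattice_sum M F.
rewrite EFinM -muleA -(@lam_cube (t + r)) ?addr_ge0 // -integral_ind // -ge0_integralZr //; last first.
  by rewrite mule_ge0 ?lee_fin ?invr_ge0 // integral_ge0.
under [leRHS]eq_integral => y _ do rewrite -(lattice_sum_mean y).
have mgp : measurable_fun setT (fun p : V * V => g (vadd p.1 (mxapp M p.2))).
  apply: measurableT_comp => //; apply: measurable_vadd => //.
  exact: measurable_mxapp.
rewrite [leRHS](_ : _ = \int[lam]_y \int[lam]_p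
   (ind (cube (t + r)) y * (ind unitcube p * g (vadd y (mxapp M p)))))%E; last first.
  apply: eq_integral => y _; rewrite ge0_integralZl //.
    apply: emeasurable_funM => //; apply: measurableT_comp => //.
    by apply: measurable_vadd => //; exact: measurable_mxapp.
  by move=> p _; exact: mule_ge0.
rewrite (lam_tonelli lamL (f := fun q : V * V => (ind (cube (t + r)) q.1 * (ind unitcube q.2 * g (vadd q.1 (mxapp M q.2))))%E)); last 2 first.
- apply: emeasurable_funM; first exact: measurableT_comp.
  apply: emeasurable_funM => //; exact: measurableT_comp.
- by move=> q; rewrite !mule_ge0.
have -> : (\int[lam]_y (ind (cube t) y * g y) =
   \int[lam]_p (ind unitcube p * \int[lam]_y (ind (cube t) y * g y)))%E.
  rewrite ge0_integralZr //; last by apply: integral_ge0 => y _; exact: mule_ge0.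
  by rewrite integral_ind // lam_unitcube mul1e.
apply: ge0_le_integralT => p.
  by apply: mule_ge0 => //; apply: integral_ge0 => y _; rewrite !mule_ge0.
have [hp|hp] := pselect (unitcube p); last first.
  by rewrite ind0 // mul0e integral_ge0 // => y _; rewrite mul0e mule0.
rewrite [leRHS](_ : _ = \int[lam]_y (ind (cube (t + r)) y * g (vadd y (mxapp M p))))%E; last first.
  by apply: eq_integral => y _ /=; rewrite (ind1 hp) mul1e.
rewrite (ind1 hp) mul1e -[leLHS](integral_translate lamL (mxapp M p)); last 2 first.
- by apply: emeasurable_funM.
- by move=> x; apply: mule_ge0.
apply: ge0_le_integralT => y; first by rewrite !mule_ge0.
have [hy|hy] := pselect (cube t (vadd y (mxapp M p))); last first.
  by rewrite ind0 // mul0e mule_ge0.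
rewrite !ind1 // => i; have := hy i; have := mxboundP i hp.
by rewrite !tnth_mktuple ler_norml => /andP[h1 h2] /andP[h3 h4]; lra.
Qed.

End Averages.
End Lattice.

Section LimitRatio.
Context (R : realType) (d : nat).

Lemma cvg_ratio_pow (r : R) : 0 <= r ->
  (fun n : nat => ((n.+1%:R + r) / n.+1%:R) ^+ d) @ \oo --> (1 : R).
Proof.
move=> r0.
have h : (fun n : nat => 1 + r * n.+1%:R^-1 : R) @ \oo --> (1 + r * 0 : R).
  apply: cvgD; first exact: cvg_cst.
  by apply: cvgM; [exact: cvg_cst|exact: cvg_harmonic].
rewrite mulr0 addr0 in h.
have -> : (fun n : nat => ((n.+1%:R + r) / n.+1%:R) ^+ d) =
   (fun n : nat => (1 + r * n.+1%:R^-1) ^+ d) :> (nat -> R).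
  by apply/funext => n; rewrite mulrDl divff // pnatr_eq0.
rewrite -[X in _ --> X](expr1n R d).
elim: d => [|k IH]; first by under eq_fun do rewrite expr0; exact: cvg_cst.
by under eq_fun do rewrite exprS; rewrite exprS; apply: cvgM.
Qed.

(** A boundary layer of fixed width r is negligible against a cube of side n + 1: the ratio of the
    two volumes tends to 1. *)
Lemma ler_ratio (r a s : R) : 0 <= r ->
  (forall n : nat, n.+1%:R ^+ d * a <= (n.+1%:R + r) ^+ d * s) -> a <= s.
Proof.
move=> r0 h.
have c : (fun n : nat => ((n.+1%:R + r) / n.+1%:R) ^+ d * s) @ \oo --> (1 * s : R).
  by apply: cvgM; [exact: cvg_ratio_pow|exact: cvg_cst].
rewrite mul1r in c; rewrite -(cvg_lim _ c) //.
apply: limr_ge; first by apply/cvg_ex; exists s.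
apply: nearW => n.
rewrite exprMn exprVn mulrAC ler_pdivlMr ?exprn_gt0 // mulrC.
exact: h.
Qed.

Lemma lee_ratio_l (r a : R) (s : \bar R) : 0 <= r -> (0 <= s)%E ->
  (forall n : nat, (n.+1%:R ^+ d)%:E * s <= ((n.+1%:R + r) ^+ d * a)%:E)%E -> (s <= a%:E)%E.
Proof.
move=> r0; case: s => [s||] //.
  by move=> _ h; rewrite lee_fin; apply: (ler_ratio r0) => n; have := h n; rewrite -EFinM lee_fin.
(* The instance n = 0 already excludes an infinite s. *)
move=> _ /(_ 0%N); rewrite expr1n mul1e leye_eq //.
Qed.

Lemma lee_ratio_r (r a : R) (s : \bar R) : 0 <= r -> (0 <= s)%E ->
  (forall n : nat, (n.+1%:R ^+ d * a)%:E <= ((n.+1%:R + r) ^+ d)%:E * s)%E -> (a%:E <= s)%E.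
Proof.
move=> r0; case: s => [s||] //.
  by move=> _ h; rewrite lee_fin; apply: (ler_ratio r0) => n; have := h n; rewrite -EFinM lee_fin.
by move=> _ _; rewrite leey.
Qed.

End LimitRatio.

(** * Integer powers of the dilation and their determinants *)

Section MatrixPowers.
Context (R : realType) (d : nat).
Implicit Types (A : 'M[R]_d).

Lemma unitmx_exp A n : A \in unitmx -> A ^+ n \in unitmx.
Proof.
move=> uA; elim: n => [|n IH]; first by rewrite expr0 unitmx1.
by rewrite exprS -mulmxE unitmx_mul uA IH.
Qed.

Lemma mxpowz_unit A j : A \in unitmx -> mxpowz A j \in unitmx.
Proof.
by move=> uA; case: j => n /=; apply: unitmx_exp => //; rewrite unitmx_inv.
Qed.

Lemma det_exp A n : \det (A ^+ n) = \det A ^+ n.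
Proof.
elim: n => [|n IH]; first by rewrite !expr0 det1.
by rewrite !exprS -mulmxE det_mulmx IH.
Qed.

Lemma det_mxpowz A j : `|\det (mxpowz A j)| = `|\det A| ^ j.
Proof.
case: j => n /=; first by rewrite det_exp normrX.
by rewrite det_exp det_inv normrX normfV exprVn.
Qed.

Lemma expmxV A n : A \in unitmx -> invmx A ^+ n *m A ^+ n = 1%:M.
Proof.
move=> uA; elim: n => [|n IH]; first by rewrite !expr0 mulmx1.
by rewrite exprSr exprS -!mulmxE mulmxA -(mulmxA _ (invmx A)) mulVmx // mulmx1.
Qed.

Lemma mxpowzN A j : A \in unitmx -> mxpowz A (- j) *m mxpowz A j = 1%:M.
Proof.
move=> uA; case: j => [[|n]|n] /=; first by rewrite !expr0 mulmx1.
  exact: expmxV.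
by apply: mulmx1C; exact: expmxV.
Qed.

Lemma trmx_exp A n : (A ^+ n)^T = A^T ^+ n.
Proof.
elim: n => [|n IH]; first by rewrite !expr0 trmx1.
by rewrite exprS exprSr -!mulmxE trmx_mul IH.
Qed.

Lemma mxpowz_tr A j : mxpowz A^T j = (mxpowz A j)^T.
Proof. by case: j => n /=; rewrite trmx_exp ?trmx_inv. Qed.

End MatrixPowers.

(** * Measurability of complex-valued functions *)

Section ComplexMeasurability.
Context (R : realType) d (T : measurableType d).
Implicit Types f g : T -> R[i].

Definition cmeas f := measurable_fun setT (fun x => complex.Re (f x)) /\
  measurable_fun setT (fun x => complex.Im (f x)).

Lemma abs2_ge0 (z : R[i]) : 0 <= abs2 z.
Proof. by rewrite addr_ge0 ?sqr_ge0. Qed.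

Lemma ReM (x y : R[i]) : complex.Re (x * y) =
  complex.Re x * complex.Re y - complex.Im x * complex.Im y.
Proof. by case: x => a b; case: y => u v. Qed.

Lemma ImM (x y : R[i]) : complex.Im (x * y) =
  complex.Re x * complex.Im y + complex.Im x * complex.Re y.
Proof. by case: x => a b; case: y => u v. Qed.

Lemma ReC (x : R[i]) : complex.Re (x^*%C) = complex.Re x.
Proof. by case: x. Qed.

Lemma ImC (x : R[i]) : complex.Im (x^*%C) = - complex.Im x.
Proof. by case: x. Qed.

Lemma ReB (x y : R[i]) : complex.Re (x - y) = complex.Re x - complex.Re y.
Proof. by case: x => a b; case: y => u v. Qed.

Lemma ImB (x y : R[i]) : complex.Im (x - y) = complex.Im x - complex.Im y.
Proof. by case: x => a b; case: y => u v. Qed.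

Lemma abs2M (x y : R[i]) : abs2 (x * y) = abs2 x * abs2 y.
Proof. by rewrite /abs2 ReM ImM; ring. Qed.

Lemma cmeasM f g : cmeas f -> cmeas g -> cmeas (fun x => f x * g x).
Proof.
move=> [a b] [u v]; split.
  under eq_fun do rewrite ReM.
  by apply: measurable_funB; apply: measurable_funM.
under eq_fun do rewrite ImM.
by apply: measurable_funD; apply: measurable_funM.
Qed.

Lemma cmeasB f g : cmeas f -> cmeas g -> cmeas (fun x => f x - g x).
Proof.
move=> [a b] [u v]; split.
  by under eq_fun do rewrite ReB; apply: measurable_funB.
by under eq_fun do rewrite ImB; apply: measurable_funB.
Qed.

Lemma cmeasC f : cmeas f -> cmeas (fun x => (f x)^*%C).
Proof.
move=> [a b]; split; first by under eq_fun do rewrite ReC.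
by under eq_fun do rewrite ImC; apply: measurable_funN.
Qed.

Lemma cmeas_cst (c : R[i]) : cmeas (fun=> c).
Proof. by split; exact: measurable_cst. Qed.

Lemma measurable_abs2 f : cmeas f -> measurable_fun setT (fun x => abs2 (f x)).
Proof. by move=> [a b]; apply: measurable_funD; apply: measurable_funX. Qed.

Lemma measurable_abs2E f : cmeas f -> measurable_fun setT (fun x => (abs2 (f x))%:E).
Proof. by move=> h; apply/measurable_EFinP; exact: measurable_abs2. Qed.

End ComplexMeasurability.

Lemma cmeas_comp (R : realType) d1 d2 (T1 : measurableType d1) (T2 : measurableType d2)
  (f : T2 -> R[i]) (h : T1 -> T2) : cmeas f -> measurable_fun setT h -> cmeas (fun x => f (h x)).
Proof. by move=> [a b] mh; split; [exact: (measurableT_comp a)|exact: (measurableT_comp b)]. Qed.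

(** * Translation covariance of the coefficients *)

Section Translates.
Context (R : realType) (d : nat).
Local Notation V := (d.-tuple R).
Variable lam : {measure set V -> \bar R}.
Hypothesis lamL : is_lebesgue lam.

Lemma Rintegral_translate (v : V) (h : V -> R) : measurable_fun setT h ->
  Rintegral lam setT (fun x => h (vadd x v)) = Rintegral lam setT h.
Proof.
move=> mh; rewrite /Rintegral; congr fine; rewrite integralE [RHS]integralE.
have mE : measurable_fun setT (fun x => (h x)%:E) by exact/measurable_EFinP.
congr (_ - _)%E.
  rewrite -[RHS](integral_translate lamL v (f := (fun x => (h x)%:E)^\+%E)) //; last exact: measurable_funepos.
  by apply: eq_integral => x _; rewrite !funeposE.
rewrite -[RHS](integral_translate lamL v (f := (fun x => (h x)%:E)^\-%E)) //; last exact: measurable_funeneg.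
by apply: eq_integral => x _; rewrite !funenegE.
Qed.

Variables (A : 'M[R]_d).

Lemma memL2_cmeas f : memL2 lam f -> cmeas f.
Proof. by case. Qed.

Lemma memL2_translate (y : V) f : memL2 lam f -> memL2 lam (fun t => f (vadd t y)).
Proof.
move=> hf; have [a b] := memL2_cmeas hf; case: hf => _ _ c.
have mt : measurable_fun setT (fun x : V => vadd x y) by exact: measurable_vadd.
split; [exact: (measurableT_comp a)|exact: (measurableT_comp b)|].
rewrite (integral_translate lamL y (f := fun x => (abs2 (f x))%:E)) //.
  exact: measurable_abs2E.
by move=> x; rewrite lee_fin abs2_ge0.
Qed.

Lemma l2norm2_translate (y : V) f : memL2 lam f ->
  l2norm2 lam (fun t => f (vadd t y)) = l2norm2 lam f.
Proof.
move=> /memL2_cmeas hf.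
by rewrite /l2norm2 (Rintegral_translate y (h := fun x => abs2 (f x))) //; exact: measurable_abs2.
Qed.

Lemma cmeas_qreg x j psi : cmeas psi -> cmeas (qreg A x j psi).
Proof.
move=> mp; apply: cmeasM; first exact: cmeas_cst.
apply: cmeas_comp => //; apply: measurable_mxapp; exact: measurable_vsub.
Qed.

(** Translating f by y shifts the sampling points by y. Applied to all translates, the discrete
    frame inequality therefore speaks of every shift of the sampling lattices. *)
Lemma wcoef_translate psi f y x j : cmeas psi -> cmeas f ->
  wcoef lam A psi (fun t => f (vadd t y)) x j = wcoef lam A psi f (vadd x y) j.
Proof.
move=> mp mf; rewrite /wcoef /ip.
pose h s := f s * ((qreg A (vadd x y) j psi) s)^*%C.
have [mh1 mh2] : cmeas h by apply: cmeasM => //; apply: cmeasC; exact: cmeas_qreg.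
have e t : f (vadd t y) * ((qreg A x j psi) t)^*%C = h (vadd t y).
  rewrite /h /qreg; congr (_ * (_ * _)^*%C); congr (psi (mxapp _ _)).
  by apply: vext => i; rewrite !tnth_mktuple; ring.
rewrite /cint.
under eq_Rintegral do rewrite e.
under [X in Complex _ X]eq_Rintegral do rewrite e.
rewrite (Rintegral_translate y (h := fun s => complex.Re (h s))) //.
by rewrite (Rintegral_translate y (h := fun s => complex.Im (h s))).
Qed.

End Translates.

Section Separation.
Context (R : realType) (d : nat).
Local Notation V := (d.-tuple R).

(** If s lies in both boxes, P(k - k') has coordinates smaller than [de]. Applying the inverse of P
    gives coordinates of k - k' below b / (1 + b) < 1, and these are integers. The bound [de] <= 1
    keeps the boxes inside [Qbox]. *)
Lemma lattice_separated (P : 'M[R]_d) : P \in unitmx ->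
  exists2 de : R, 0 < de <= 1 &
   forall (k k' : d.-tuple int) (s : V),
     box (cvec d 0) (cvec d de) (vsub s (mxapp P (intvec R k))) ->
     box (cvec d 0) (cvec d de) (vsub s (mxapp P (intvec R k'))) -> k = k'.
Proof.
move=> uP; pose b := mxbound (invmx P).
have b0 : 0 <= b by exact: mxbound_ge0.
have b1 : 0 < 1 + b by lra.
exists (1 + b)^-1; first by rewrite invr_gt0 b1 /= invf_le1 //; lra.
move=> k k' s h h'; apply: eq_from_tnth => i.
pose w : V := vsub (intvec R k) (intvec R k').
have Pw l : `|tnth (mxapp P w) l| < (1 + b)^-1.
  have := h l; have := h' l; rewrite mxapp_vsub !tnth_mktuple ltr_norml.
  by move=> /andP[h1 h2] /andP[h3 h4]; apply/andP; split; lra.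
have we : w = mxapp (invmx P) (mxapp P w) by rewrite -mxappM mulVmx // mxapp1.
have wb : `|tnth w i| < 1.
  rewrite we tnth_mktuple (le_lt_trans (ler_norm_sum _ _ _)) //.
  apply: (@le_lt_trans _ _ (b * (1 + b)^-1)).
    have rb : \sum_j `|invmx P i j| <= b.
      rewrite /b /mxbound [leRHS](bigD1 i) //= lerDl.
      by apply: sumr_ge0 => j _; apply: sumr_ge0.
    apply: le_trans (ler_wpM2r _ rb); last by rewrite invr_ge0 ltW.
    rewrite mulr_suml; apply: ler_sum => j _; rewrite normrM.
    by rewrite ler_wpM2l // ltW.
  by rewrite ltr_pdivrMr // mul1r; lra.
apply/eqP; rewrite -subr_eq0 -absz_eq0 -leqn0 -ltnS -ltz_nat -(ltr_int R).
by rewrite abszE intr_norm intrB; move: wb; rewrite !tnth_mktuple.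
Qed.

End Separation.

(** * The continuous frame bounds *)

Section ContinuousFrame.
Context (R : realType) (d : nat).
Local Notation V := (d.-tuple R).
Variable lam : {measure set V -> \bar R}.
Hypothesis lamL : is_lebesgue lam.
Variables (A P : 'M[R]_d) (psi : V -> R[i]) (C1 C2 : R).
Hypotheses (uA : A \in unitmx) (uP : P \in unitmx) (hB : in_Bpi lam A psi).
Hypotheses (C10 : 0 < C1) (C12 : C1 <= C2) (hD : disc_frame lam A P psi C1 C2).
Variable f : V -> R[i].
Hypothesis hf : memL2 lam f.

Let W := wcoef lam A psi f.
Let F j x := (abs2 (W x j))%:E.
Let M j := mxpowz A j *m P.
Let g j := lattice_sum (M j) (F j).
Let m j := ((`|\det (M j)|^-1)%:E * \int[lam]_x F j x)%E.

Let uM j : M j \in unitmx.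
Proof. by rewrite unitmx_mul mxpowz_unit. Qed.

Let mF j : measurable_fun setT (F j).
Proof.
have [_ /(_ f hf) [[h _] _]] := hB.
exact: (@measurable_abs2E R _ V (fun x => W x j) (h j)).
Qed.

Let F0 j x : (0 <= F j x)%E.
Proof. by rewrite lee_fin abs2_ge0. Qed.

Let g0 j x : (0 <= g j x)%E.
Proof. exact: lattice_sum_ge0. Qed.

Let mg j : measurable_fun setT (g j).
Proof. exact: measurable_lattice_sum. Qed.

Let m0 j : (0 <= m j)%E.
Proof. by rewrite mule_ge0 // ?integral_ge0 // lee_fin invr_ge0. Qed.

Let L := l2norm2 lam f.

Let L0 : 0 <= L.
Proof. by apply: Rintegral_ge0 => x _; exact: abs2_ge0. Qed.

(** The frame inequality for f(. + y): its norm is that of f, and the double sum over (j, k)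
    regroups into one shifted lattice sum per level. *)
Lemma frame_translate y :
  ((C1 * L)%:E <= \esum_(j in [set: int]) g j y <= (C2 * L)%:E)%E.
Proof.
have := hD (memL2_translate lamL y hf); rewrite (l2norm2_translate lamL y hf).
rewrite (_ : \esum_(jk in _) _ = \esum_(j in [set: int]) g j y) //.
have := @esum_esum R int (d.-tuple int) setT (fun=> setT)
  (fun j k => F j (vadd (mxapp (M j) (intvec R k)) y)) (fun j k _ _ => F0 j _).
rewrite /g /lattice_sum => ->.
have -> : setT `*`` (fun=> [set: d.-tuple int]) = [set: int * d.-tuple int].
  by apply/seteqP; split.
apply: eq_esum => -[j k] _ /=; rewrite /F; congr (abs2 _)%:E.
have mp : cmeas psi by case: hB => /memL2_cmeas.
have e x : wcoef lam A psi (fun t => f (vadd t y)) x j = wcoef lam A psi f (vadd x y) j.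
  by apply: wcoef_translate => //; exact: memL2_cmeas hf.
by rewrite e /M mxappM.
Qed.

Let C2L0 : (0 <= C2 * L).
Proof. by rewrite mulr_ge0 // (le_trans (ltW C10)). Qed.

Let fsum_ind (J : set int) (c : R) (y : V) : 
  (ind (cube c) y * \sum_(j <- finmap.enum_fset (fset_set J)) g j y = \sum_(j <- finmap.enum_fset (fset_set J)) (ind (cube c) y * g j y))%E.
Proof. by rewrite ge0_sume_distrr. Qed.

Lemma integral_ind_sum (J : set int) (c : R) :
  (\int[lam]_y (ind (cube c) y * \sum_(j <- finmap.enum_fset (fset_set J)) g j y) =
   \sum_(j <- finmap.enum_fset (fset_set J)) \int[lam]_y (ind (cube c) y * g j y))%E.
Proof.
under eq_integral do rewrite fsum_ind.
rewrite ge0_integral_sum //.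
- move=> j; apply: emeasurable_funM => //; apply: measurable_ind; exact: cube_measurable.
- by move=> j y _; rewrite mule_ge0 // ind_ge0.
Qed.

(** For finitely many levels, integrate the upper frame bound over a large cube, compare each level
    with its mean through [mxbound_lower], and divide by the volume. *)
Lemma mean_upper : (\esum_(j in [set: int]) m j <= (C2 * L)%:E)%E.
Proof.
apply: ge_ereal_sup => _ [J [fJ _] <-].
rewrite fsbig_finite //=.
(* One layer width that dominates those of all levels in J. *)
pose r := \sum_(j <- finmap.enum_fset (fset_set J)) mxbound (M j).
have r0 : 0 <= r by apply: sumr_ge0 => j _; exact: mxbound_ge0.
apply: (@lee_ratio_l R d (2 * r)); first by rewrite mulr_ge0.
  by apply: sume_ge0.
(* With this half-side the cube has side n + 1, as the limit lemma expects. *)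
move=> n; pose t : R := n.+1%:R / 2.
have t0 : 0 <= t by rewrite divr_ge0.
have t2 : 2 * t = n.+1%:R by rewrite /t mulrC divfK.
have t2r : 2 * (t + r) = n.+1%:R + 2 * r by rewrite mulrDr t2.
rewrite ge0_sume_distrr // -t2r -t2.
apply: (@le_trans _ _ (\int[lam]_y (ind (cube (t + r)) y * \sum_(j <- finmap.enum_fset (fset_set J)) g j y))%E).
  rewrite integral_ind_sum big_seq [leRHS]big_seq; apply: lee_sum => j jJ.
  rewrite muleA -EFinM; apply: (mxbound_lower lamL) => //.
  rewrite /r (big_rem j) //= lerDl; apply: sumr_ge0 => i _; exact: mxbound_ge0.
rewrite EFinM -(lam_cube lamL) ?addr_ge0 // -(integral_ind lam (@cube_measurable _ _ _)).
rewrite -ge0_integralZr //; last 2 first.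
- by apply: measurable_ind; exact: cube_measurable.
- by move=> y _; exact: ind_ge0.
apply: ge0_le_integralT => y.
  by rewrite mule_ge0 ?ind_ge0 // sume_ge0.
apply: lee_wpmul2l; first exact: ind_ge0.
have /andP[_] := frame_translate y; apply: le_trans.
apply: ereal_sup_ubound; exists J; first by split.
by rewrite fsbig_finite.
Qed.

Lemma maxfun_ge0 x j : (0 <= maxfun A W x j)%E.
Proof.
apply: (@le_trans _ _ (Num.sqrt (abs2 (W (vadd x (mxapp (mxpowz A j) (cvec d 0))) j)))%:E).
  by rewrite lee_fin sqrtr_ge0.
by apply: ereal_sup_ubound; exists (cvec d 0) => // i; rewrite tnth_cvec normr0.
Qed.

(** Around the sample point A^j P k + y put the cell y + A^j(P k + D), of measure |det A|^j [de]^d.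
    Cells of distinct k are disjoint, and throughout a cell [maxfun] is at least the modulus of W at
    its sample point. Summing over k bounds g by a constant that depends on neither j nor y. *)
Lemma lattice_sum_maxfun : exists2 c : R, 0 <= c & forall j y, (g j y <=
   c%:E * ((`|\det A| ^ (- j))%:E * \int[lam]_x (maxfun A W x j * maxfun A W x j)))%E.
Proof.
have [de /andP[de0 de1] sep] := lattice_separated uP.
exists (de ^- d); first by rewrite invr_ge0 exprn_ge0 // ltW.
move=> j y.
pose D : set V := box (cvec d 0) (cvec d de).
have mD : measurable D by exact: measurable_box.
have lamD : lam D = (de ^+ d)%:E.
  rewrite (lam_box lamL) => [|i]; last by rewrite !tnth_cvec ltW.
  congr EFin; under eq_bigr do rewrite !tnth_cvec subr0.
  by rewrite prodr_const card_ord.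
pose B := mxpowz A (- j).
have uB : B \in unitmx by exact: mxpowz_unit.
pose pt (k : d.-tuple int) : V := vadd (mxapp (M j) (intvec R k)) y.
pose chi k x := ind D (vsub (mxapp B (vsub x y)) (mxapp P (intvec R k))).
have mchi k : measurable_fun setT (chi k).
  apply: (measurableT_comp (measurable_ind mD)); apply: measurable_vsub => //.
  by apply: measurable_mxapp; apply: measurable_vsub.
have chi0 k x : (0 <= chi k x)%E by exact: ind_ge0.
have mi := measurable_ind mD.
have ichi k : (\int[lam]_x chi k x = (`|\det A| ^ j * de ^+ d)%:E)%E.
  rewrite (integral_translateB lamL y (f := fun x => ind D (vsub (mxapp B x) (mxapp P (intvec R k))))) //; last 2 first.
  - by apply: (@measurable_comp_mx _ _ (fun x => ind D (vsub x _))); exact: measurable_comp_vsub.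
  - by move=> x; exact: ind_ge0.
  rewrite (integral_linear lamL uB (f := fun x => ind D (vsub x (mxapp P (intvec R k))))) //; last 2 first.
  - exact: measurable_comp_vsub.
  - by move=> x; exact: ind_ge0.
  rewrite (integral_translateB lamL) // ?integral_ind //; last by move=> x; exact: ind_ge0.
  rewrite // lamD det_mxpowz -EFinM.
  by congr (_ * _)%:E; rewrite invr_expz opprK.
have detA0 : `|\det A| != 0 by rewrite normr_eq0; move: uA; rewrite unitmxE unitfE.
have key : ((`|\det A| ^ j * de ^+ d)%:E * g j y <= \int[lam]_x (maxfun A W x j * maxfun A W x j))%E.
  rewrite /g /lattice_sum -esumZl //; last by rewrite mulr_ge0 ?exprz_ge0 // exprn_ge0 // ltW.
  rewrite [leLHS](_ : _ = \int[lam]_x (\esum_(k in [set: d.-tuple int]) (chi k x * F j (pt k))))%E; last first.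
    rewrite integral_esum.
    - by apply: eq_esum => k _; rewrite ge0_integralZr // ichi.
    - by move=> k; apply: emeasurable_funM => //; exact: measurable_cst.
    - by move=> k x; rewrite mule_ge0.
  apply: ge0_le_integralT => x; first by apply: esum_ge0 => k _; rewrite mule_ge0.
  (* By separation at most one cell contains x, so the sum over k has at most one nonzero term. *)
  have [[k0 hk0]|no] := pselect (exists k, D (vsub (mxapp B (vsub x y)) (mxapp P (intvec R k)))); last first.
    rewrite esum1 ?mule_ge0 ?maxfun_ge0 // => k _; rewrite /chi ind0 ?mul0e // => h.
    by apply: no; exists k.
  rewrite (esum_single (k0 := k0)); last 2 first.
  - by rewrite mule_ge0.
  - move=> k kk0; rewrite /chi ind0 ?mul0e // => h; apply: kk0.
    exact: sep h hk0.
  rewrite /chi ind1 // mul1e /F.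
  rewrite -(sqr_sqrtr (abs2_ge0 _)) expr2 EFinM.
  suff h : ((Num.sqrt (abs2 (W (pt k0) j)))%:E <= maxfun A W x j)%E.
    by apply: lee_pmul => //; rewrite lee_fin sqrtr_ge0.
  apply: le_ereal_sup_tmp; eexists; last exact: lexx.
  (* This q lies in -D, hence in [Qbox], and x + A^j q is the sample point. *)
  exists (vsub (mxapp P (intvec R k0)) (mxapp B (vsub x y))).
    move=> i; have := hk0 i; rewrite !tnth_mktuple ler_norml => /andP[h1 h2].
    by apply/andP; split; lra.
  congr (Num.sqrt (abs2 (W _ j)))%:E.
  rewrite mxapp_vsub -!mxappM (mulmx1C (mxpowzN _ uA)) mxapp1 -/(M j) /pt.
  by apply: vext => i; rewrite !tnth_mktuple; ring.
have c0 : (0 <= `|\det A| ^ (- j))%R by rewrite exprz_ge0.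
apply: (@le_trans _ _ ((de ^- d)%:E * ((`|\det A| ^ (- j))%:E * ((`|\det A| ^ j * de ^+ d)%:E * g j y))))%E; last first.
  apply: lee_wpmul2l; first by rewrite lee_fin invr_ge0 exprn_ge0 // ltW.
  by apply: lee_wpmul2l.
rewrite !muleA -!EFinM [X in (X%:E * _)%E](_ : _ = 1) ?mul1e //.
have deN : de ^+ d != 0 by rewrite expf_neq0 // gt_eqF.
have X0 : `|\det A| ^ j != 0 by rewrite expfz_neq0.
rewrite -invr_expz; move: (`|\det A| ^ j) (de ^+ d) X0 deN => X Y X0 Y0.
by field; rewrite X0 Y0.
Qed.

(** Membership in B_pi makes the uniform bounds b summable, so some finite J leaves a tail of at
    most e at every y simultaneously. On J the lower frame bound then holds up to e, and averaging
    over large cubes applies as for the upper bound. *)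
Lemma mean_lower : ((C1 * L)%:E <= \esum_(j in [set: int]) m j)%E.
Proof.
have [c c0 hc] := lattice_sum_maxfun.
pose b j := (c%:E * ((`|\det A| ^ (- j))%:E * \int[lam]_x (maxfun A W x j * maxfun A W x j)))%E.
have b0 j : (0 <= b j)%E by exact: le_trans (g0 j (cvec d 0)) (hc j _).
have mm0 j : (0 <= (`|\det A| ^ (- j))%:E * \int[lam]_x (maxfun A W x j * maxfun A W x j))%E.
  rewrite mule_ge0 //; first by rewrite lee_fin exprz_ge0.
  by apply: integral_ge0 => x _; rewrite mule_ge0 ?maxfun_ge0.
have bfin : (\esum_(j in [set: int]) b j < +oo)%E.
  rewrite esumZl //; have [_ /(_ f hf) [_]] := hB; rewrite /haar_int.
  by move=> h; rewrite lte_mul_pinfty // ?lee_fin // esum_ge0.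
have S0 : (0 <= \esum_(j in [set: int]) m j)%E by exact: esum_ge0.
apply/lee_addgt0Pr => e e0.
(* A nonpositive left side is settled at once; below, C1 L - e is integrated as a nonnegative
   constant. *)
have [neg|pos] := leP (C1 * L - e) 0.
  apply: (@le_trans _ _ e%:E); first by rewrite lee_fin; lra.
  by rewrite leeDr.
have bnum : (\esum_(j in [set: int]) b j)%E \is a fin_num.
  by rewrite ge0_fin_numE // esum_ge0.
(* J nearly attains the supremum that defines the total of b. *)
have [_ [J [fJ _] <-] hJ] := ub_ereal_sup_adherent e0 bnum.
have tail : (\esum_(j in ~` J) b j <= e%:E)%E.
  have : (\esum_(j in [set: int]) b j - e%:E < \sum_(j \in J) b j)%E by exact: hJ.
  rewrite (esumID J) // !setTI esum_fset // fsbig_finite //=.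
  set s1 := (\sum_(j <- _) _)%E; set s2 := esum _ _ => h.
  have s10 : (0 <= s1)%E by exact: sume_ge0.
  have s20 : (0 <= s2)%E by exact: esum_ge0.
  have : (s1 + s2 < +oo)%E.
    move: bfin; rewrite (esumID J) // !setTI esum_fset // fsbig_finite //=.
  case: s1 s10 h => [s1||] //; case: s2 s20 => [s2||] // _ _.
  by rewrite -!EFinD lte_fin lee_fin => h _; lra.
rewrite -leeBlDr // -EFinB.
apply: (@le_trans _ _ (\sum_(j <- finmap.enum_fset (fset_set J)) m j)%E); last first.
  by apply: ereal_sup_ubound; exists J; [split|rewrite fsbig_finite].
pose r := \sum_(j <- finmap.enum_fset (fset_set J)) mxbound (M j).
have r0 : 0 <= r by apply: sumr_ge0 => j _; exact: mxbound_ge0.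
apply: (@lee_ratio_r R d (2 * r)); first by rewrite mulr_ge0.
  by apply: sume_ge0.
move=> n; pose t : R := n.+1%:R / 2.
have t0 : 0 <= t by rewrite divr_ge0.
have t2 : 2 * t = n.+1%:R by rewrite /t mulrC divfK.
have t2r : 2 * (t + r) = n.+1%:R + 2 * r by rewrite mulrDr t2.
rewrite ge0_sume_distrr // -t2r -t2.
apply: (@le_trans _ _ (\int[lam]_y (ind (cube t) y * \sum_(j <- finmap.enum_fset (fset_set J)) g j y))%E); last first.
  rewrite integral_ind_sum big_seq [leRHS]big_seq; apply: lee_sum => j jJ.
  rewrite muleA -EFinM; apply: (mxbound_upper lamL) => //.
  rewrite /r (big_rem j) //= lerDl; apply: sumr_ge0 => i _; exact: mxbound_ge0.
rewrite EFinM -(lam_cube lamL) // -(integral_ind lam (@cube_measurable _ _ _)).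
rewrite -ge0_integralZr //; last 3 first.
- by apply: measurable_ind; exact: cube_measurable.
- by move=> y _; exact: ind_ge0.
- by rewrite lee_fin ltW.
apply: ge0_le_integralT => y.
  by rewrite mule_ge0 ?ind_ge0 // lee_fin ltW.
apply: lee_wpmul2l; first exact: ind_ge0.
have /andP[+ _] := frame_translate y.
rewrite (esumID J) // !setTI esum_fset // fsbig_finite //= => h.
rewrite EFinB leeBlDr //; apply: (le_trans h); rewrite leeD2l //.
by apply: le_trans tail; apply: le_esum => j _; exact: hc.
Qed.

(** Since |det(A^j P)| = |det A|^j |det P|, the cell densities are the Haar weights up to the
    constant |det P|, which is where this factor enters the frame bounds. *)
Lemma cont_sum_mean : cont_sum lam A psi f = (`|\det P|%:E * \esum_(j in [set: int]) m j)%E.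
Proof.
have detP0 : `|\det P| != 0 by rewrite normr_eq0; move: uP; rewrite unitmxE unitfE.
rewrite -esumZl // /cont_sum; apply: eq_esum => j _.
have c0 : (0 <= `|\det A| ^ (- j))%R by rewrite exprz_ge0.
transitivity (\int[lam]_x (F j x * (`|\det A| ^ (- j))%:E))%E.
  by apply: eq_integral => x _; rewrite EFinM.
rewrite ge0_integralZr //.
rewrite /m muleA -EFinM muleC; congr (_%:E * _)%E.
by rewrite /M det_mulmx normrM det_mxpowz invfM invr_expz mulrC mulfVK.
Qed.

Lemma continuous_frame_bounds :
  ((C1 * `|\det P| * L)%:E <= cont_sum lam A psi f <= (C2 * `|\det P| * L)%:E)%E.
Proof.
rewrite cont_sum_mean ![_ * `|_|]mulrC -!mulrA !(EFinM `|\det P|).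
by rewrite !lee_wpmul2l // ?lee_fin // ?mean_lower ?mean_upper.
Qed.

End ContinuousFrame.

(** * Fourier transform of Gaussians *)

Section Gaussian.
Context (R : realType) (d : nat).
Local Notation V := (d.-tuple R).

Definition vscale (c : R) (x : V) : V := [tuple c * tnth x i | i < d].

Lemma vscale_mx c x : vscale c x = mxapp c%:M x.
Proof.
apply: vext => i; rewrite !tnth_mktuple (bigD1 i) //= mxE eqxx mulr1n big1 ?addr0 //.
by move=> j ji; rewrite mxE eq_sym (negPf ji) mulr0n mul0r.
Qed.

Lemma measurable_vscale c d1 (T : measurableType d1) (f : T -> V) :
  measurable_fun setT f -> measurable_fun setT (fun x => vscale c (f x)).
Proof. by move=> mf; under eq_fun do rewrite vscale_mx; exact: measurable_mxapp. Qed.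

Lemma dotvZl c (x y : V) : dotv (vscale c x) y = c * dotv x y.
Proof. by rewrite /dotv mulr_sumr; apply: eq_bigr => i _; rewrite tnth_mktuple mulrA. Qed.

Lemma dotvZr c (x y : V) : dotv x (vscale c y) = c * dotv x y.
Proof. by rewrite dotvC dotvZl dotvC. Qed.

Lemma measurable_cos : measurable_fun setT (@cos R).
Proof. by apply: continuous_measurable_fun; exact: continuous_cos. Qed.

Lemma measurable_sin : measurable_fun setT (@sin R).
Proof. by apply: continuous_measurable_fun; exact: continuous_sin. Qed.

Definition gauss (a : R) (x : V) : R := expR (- (a * dotv x x)).

Lemma gauss_ge0 a x : 0 <= gauss a x.
Proof. exact: expR_ge0. Qed.

Lemma gauss_le1 a x : 0 <= a -> gauss a x <= 1.
Proof. by move=> a0; rewrite -expR0 ler_expR oppr_le0 mulr_ge0 // dotv_ge0. Qed.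

Lemma measurable_gauss a d1 (T : measurableType d1) (f : T -> V) :
  measurable_fun setT f -> measurable_fun setT (fun x => gauss a (f x)).
Proof.
move=> mf; apply: (measurableT_comp (@measurable_expR R)); apply: measurable_funN.
by apply: measurable_funM => //; exact: measurable_dotv.
Qed.

Lemma gauss_scale a c x : gauss a (vscale c x) = gauss (a * c ^+ 2) x.
Proof. by rewrite /gauss dotvZl dotvZr; congr expR; ring. Qed.

Lemma gaussN a x : gauss a (vscale (-1) x) = gauss a x.
Proof. by rewrite gauss_scale sqrrN expr1n mulr1. Qed.

(* Completing the square. *)
Lemma gauss_shift a (h : R) (v x : V) :
  gauss a (vadd x (vscale h v)) =
  gauss a x * expR (- (2 * a * h * dotv v x)) * expR (- (a * h ^+ 2 * dotv v v)).
Proof.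
rewrite /gauss -!expRD; congr expR.
by rewrite !(dotvDl, dotvDr, dotvZl, dotvZr) (dotvC x v); ring.
Qed.

Lemma dotv_ge_outside (r : R) (x : V) : 0 <= r -> ~ cube r x -> r ^+ 2 <= dotv x x.
Proof.
move=> r0 hx; move: hx => /existsNP[ k]; rewrite !tnth_cvec => /negP; rewrite negb_and -ltNge -leNgt => h.
apply: (@le_trans _ _ (tnth x k ^+ 2)); last first.
  rewrite /dotv (bigD1 k) //= -expr2 lerDl; apply: sumr_ge0 => j _.
  by rewrite -expr2 sqr_ge0.
by case/orP: h => h; nra.
Qed.

Variable lam : {measure set V -> \bar R}.
Hypothesis lamL : is_lebesgue lam.

Lemma integral_vscale (c : R) (f : V -> \bar R) : c != 0 ->
  measurable_fun setT f -> (forall x, 0 <= f x)%E ->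
  (\int[lam]_x f (vscale c x) = (`|c| ^- d)%:E * \int[lam]_x f x)%E.
Proof.
move=> c0 mf f0.
under eq_integral do rewrite vscale_mx.
rewrite (integral_linear lamL) //; last first.
  by rewrite unitmxE det_scalar unitfE expf_neq0.
by rewrite det_scalar normrX.
Qed.

Lemma measurable_gaussE a : measurable_fun setT (fun x : V => (gauss a x)%:E).
Proof. by apply/measurable_EFinP; exact: measurable_gauss. Qed.

(** A self-improving estimate on dyadic cubes. Halving the variable turns I (n+1) into 2^d times the
    integral of gauss(4a) = gauss(3a) gauss(a) over the smaller cube, and gauss(3a) is small off a
    fixed cube; hence I (n+1) <= K + I n / 2. A bounded sequence and monotone convergence finish the
    proof. *)
Lemma integral_gauss_lty a : 0 < a -> (\int[lam]_x (gauss a x)%:E < +oo)%E.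
Proof.
move=> a0.
pose I n := (\int[lam]_x (ind (cube (2 ^+ n)) x * (gauss a x)%:E))%E.
(* Chosen so that 2^d / e = 1/2, the contraction factor. *)
pose e : R := 2 ^+ d.+1.
have e0 : 0 < e by rewrite exprn_gt0.
(* Outside [cube r0] the exponent 3a|x|^2 is at least e, and exp(-e) <= 1/e. *)
pose r0 := Num.sqrt (e / (3 * a)).
have r00 : 0 <= r0 by rewrite sqrtr_ge0.
have r02 : r0 ^+ 2 = e / (3 * a) by rewrite sqr_sqrtr // divr_ge0 ?mulr_ge0 // ltW.
pose K : R := 2 ^+ d * (2 * r0) ^+ d.
have K0 : 0 <= K by rewrite mulr_ge0 // exprn_ge0 // mulr_ge0.
have mc t := measurable_ind (@cube_measurable R d t).
have mg := measurable_gaussE.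
have c0 t x : (0 <= ind (@cube R d t) x)%E by exact: ind_ge0.
have g0 b x : (0 <= (gauss b x)%:E)%E by rewrite lee_fin gauss_ge0.
have outside x : ~ cube r0 x -> gauss (3 * a) x <= e^-1.
  move=> h; have := dotv_ge_outside r00 h; rewrite r02 => h'.
  rewrite /gauss expRN lef_pV2 ?posrE ?expR_gt0 //.
  apply: le_trans (ltW (expR_gt1Dx _)); last first.
    by rewrite gt_eqF // mulr_gt0 ?mulr_gt0 //; apply: lt_le_trans h'; rewrite divr_gt0 ?mulr_gt0.
  have : e <= 3 * a * dotv x x by move: h'; rewrite ler_pdivrMr ?mulr_gt0 // mulrC.
  by lra.
have step n : (I n.+1 <= K%:E + (2^-1)%:E * I n)%E.
  have -> : I n.+1 = ((2 ^+ d)%:E * \int[lam]_x (ind (cube (2 ^+ n)) x * (gauss (a * 2 ^+ 2) x)%:E))%E.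
    have two0 : (2 : R) != 0 by rewrite pnatr_eq0.
    have h2 : (\int[lam]_x (ind (cube (2 ^+ n)) x * (gauss (a * 2 ^+ 2) x)%:E) = (2 ^- d)%:E * I n.+1)%E.
      have -> : (2 ^- d : R) = `|2| ^- d by rewrite normr_nat.
      rewrite -(@integral_vscale 2 (fun x => ind (cube (2 ^+ n.+1)) x * (gauss a x)%:E)%E two0); last 2 first.
      - by apply: emeasurable_funM.
      - by move=> x; rewrite mule_ge0.
      apply: eq_integral => x _; rewrite gauss_scale; congr (_ * _)%E.
      rewrite /ind !indicE; congr ((_ : bool)%:R%:E).
      apply/idP/idP => /set_mem hx; apply/mem_set => i; have := hx i;
        rewrite !tnth_mktuple exprS; lra.
    rewrite h2 muleA -EFinM divff ?mul1e // expf_neq0 //.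
  have i0 m b : (0 <= \int[lam]_x (ind (cube m) x * (gauss b x)%:E))%E.
    by apply: integral_ge0 => x _; rewrite mule_ge0.
  apply: (@le_trans _ _ ((2 ^+ d)%:E * (\int[lam]_x (ind (cube r0) x + (e^-1)%:E * (ind (cube (2 ^+ n)) x * (gauss a x)%:E))))%E).
    apply: lee_wpmul2l; first by rewrite lee_fin exprn_ge0.
    apply: ge0_le_integralT => x; first by rewrite mule_ge0.
    have [hx|hx] := pselect (cube r0 x).
      rewrite (ind1 hx); apply: (@le_trans _ _ 1%E).
        rewrite /ind -EFinM lee_fin mulr_ile1 //; first exact: gauss_ge0.
        by apply: gauss_le1; rewrite mulr_ge0 // ltW.
      by rewrite leeDl // mule_ge0 ?mule_ge0 // lee_fin invr_ge0 ltW.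
    rewrite (ind0 hx) add0e muleCA; apply: lee_wpmul2l => //.
    rewrite -EFinM lee_fin.
    have -> : gauss (a * 2 ^+ 2) x = gauss (3 * a) x * gauss a x.
      by rewrite /gauss -expRD; congr expR; ring.
    by rewrite ler_wpM2r ?gauss_ge0 // outside.
  rewrite ge0_integralD //; last 2 first.
  - by move=> x _; rewrite mule_ge0 ?mule_ge0 // lee_fin invr_ge0 ltW.
  - by apply: measurable_funeM; apply: emeasurable_funM.
  rewrite integral_ind; last exact: cube_measurable.
  rewrite (lam_cube lamL) // ge0_integralZl //; last 3 first.
  - by apply: emeasurable_funM.
  - by move=> x _; rewrite mule_ge0.
  - by rewrite lee_fin invr_ge0 ltW.
  have ei0 : 0 <= e^-1 by rewrite invr_ge0 ltW.
  rewrite ge0_muleDr ?mule_ge0 ?lee_fin ?exprn_ge0 ?mulr_ge0 // -EFinM -/K.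
  rewrite muleA -EFinM (_ : 2 ^+ d * e^-1 = 2^-1) //.
  by rewrite /e exprS invfM mulrCA divff ?mulr1 // expf_neq0 // pnatr_eq0.
(* Any bound of at least 2K is preserved by the recursion; 2^d covers I 0, an integral over a cube
   of side 2. *)
pose B := (2 * K + 2 ^+ d)%R.
have bd n : (I n <= B%:E)%E.
  elim: n => [|n IH].
    apply: (@le_trans _ _ (lam (@cube R d 1))).
      rewrite -integral_ind; last exact: cube_measurable.
      apply: ge0_le_integralT => x; first by rewrite mule_ge0.
      rewrite expr0 -[leRHS]mule1; apply: lee_wpmul2l => //.
      by rewrite lee_fin gauss_le1 // ltW.
    rewrite (lam_cube lamL) // lee_fin mulr1 /B lerDr; lra.
  apply: (le_trans (step n)).
  apply: (@le_trans _ _ (K%:E + (2^-1)%:E * B%:E)%E).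
    by rewrite leeD2l // lee_wpmul2l // lee_fin.
  rewrite -EFinM -EFinD lee_fin /B; have : 0 <= (2 ^+ d : R) by rewrite exprn_ge0.
  by lra.
apply: le_lt_trans (ltry B).
have -> : (\int[lam]_x (gauss a x)%:E = limn I)%E.
  have := @monotone_convergence _ V R lam setT measurableT (fun n x => ind (cube (2 ^+ n)) x * (gauss a x)%:E)%E.
  rewrite -/I => <-.
  - apply: eq_integral => x _; apply/esym/cvg_lim => //.
    apply: cvg_near_cst.
    have [m hm] := box_cover x; exists m => // n /= mn.
    rewrite ind1 ?mul1e // => i; have := hm i; rewrite !tnth_cvec.
    have h : (m%:R : R) <= 2 ^+ n.
      apply: (@le_trans _ _ n%:R); first by rewrite ler_nat.
      by rewrite -natrX ler_nat ltnW // ltn_expl.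
    by move=> /andP[h1 h2]; rewrite (lt_le_trans h2 h) andbT; lra.
  - by move=> n; apply: emeasurable_funM.
  - by move=> n x _; rewrite mule_ge0.
  - move=> x _ m n mn; apply: lee_wpmul2r => //.
    have [hx|hx] := pselect (cube (2 ^+ m) x); last by rewrite (ind0 hx).
    rewrite !ind1 // => i; have := hx i; rewrite !tnth_cvec.
    have h : (2 ^+ m : R) <= 2 ^+ n by rewrite ler_weXn2l // ler1n.
    by move=> /andP[h1 h2]; rewrite (lt_le_trans h2 h) andbT; lra.
apply: lime_le; last by apply: nearW.
apply: ereal_nondecreasing_is_cvgn => m n mn.
apply: ge0_le_integralT => x; first by rewrite mule_ge0.
apply: lee_wpmul2r => //.
have [hx|hx] := pselect (cube (2 ^+ m) x); last by rewrite (ind0 hx).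
rewrite !ind1 // => i; have := hx i; rewrite !tnth_cvec.
have h : (2 ^+ m : R) <= 2 ^+ n by rewrite ler_weXn2l // ler1n.
by move=> /andP[h1 h2]; rewrite (lt_le_trans h2 h) andbT; lra.
Qed.

End Gaussian.

Section DeriveHelpers.
Context (R : realType).

Lemma is_derive_mulr (c x : R) : is_derive x 1 (fun y : R => y * c) c.
Proof.
have -> : (fun y : R => y * c) = (c \*: (@id R)) by apply/funext => y /=; rewrite mulrC.
by apply: is_derive_eq; rewrite /GRing.scale /= mulr1.
Qed.

Lemma is_derive_affine (c e x : R) : is_derive x 1 (fun y : R => e + y * c) c.
Proof.
have h := is_derive_mulr c x.
have -> : (fun y : R => e + y * c) = (cst e + (fun y : R => y * c)) by [].
by apply: is_derive_eq; rewrite add0r.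
Qed.

Lemma is_derive_cos_affine (c e x : R) :
  is_derive x 1 (fun y : R => cos (e + y * c)) (- sin (e + x * c) * c).
Proof.
exact: (@is_derive1_comp R cos (fun y => e + y * c) x _ _ (is_derive_cos _) (is_derive_affine c e x)).
Qed.

Lemma is_derive_sin_affine (c e x : R) :
  is_derive x 1 (fun y : R => sin (e + y * c)) (cos (e + x * c) * c).
Proof.
exact: (@is_derive1_comp R sin (fun y => e + y * c) x _ _ (is_derive_sin _) (is_derive_affine c e x)).
Qed.

Lemma is_derive_expR_affine (c e x : R) :
  is_derive x 1 (fun y : R => expR (e + y * c)) (expR (e + x * c) * c).
Proof.
exact: (@is_derive1_comp R expR (fun y => e + y * c) x _ _ (is_derive_expR _) (is_derive_affine c e x)).
Qed.

Lemma is_derive_expR_sqr (c x : R) :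
  is_derive x 1 (fun y : R => expR (c * y ^+ 2)) (expR (c * x ^+ 2) * (2 * c * x)).
Proof.
apply: (@is_derive1_comp R expR (fun y => c * y ^+ 2) x _ _ (is_derive_expR _)).
have -> : (fun y : R => c * y ^+ 2) = (c \*: (@id R ^+ 2)) by [].
by apply: is_derive_eq; rewrite /GRing.scale /= ?mulr1 expr1; ring.
Qed.

Lemma is_derive_mul (f g : R -> R) (x a b : R) :
  is_derive x 1 f a -> is_derive x 1 g b ->
  is_derive x 1 (fun y => f y * g y) (f x * b + g x * a).
Proof. by move=> hf hg; have := @is_deriveM _ _ f g x 1 a b hf hg. Qed.

Context d (Y : measurableType d) (mu : {measure set Y -> \bar R}).

Lemma is_derive_Rintegral (f df : R -> Y -> R) (G : Y -> R) (a : R) :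
  (forall x, a - 1 < x < a + 1 -> mu.-integrable setT (EFin \o f x)) ->
  (forall (x : R) y, is_derive x (1 : R) (f ^~ y) (df x y)) ->
  mu.-integrable setT (EFin \o G) ->
  (forall x y, a - 1 < x < a + 1 -> `|df x y| <= G y) ->
  is_derive a 1 (fun x => Rintegral mu setT (f x)) (Rintegral mu setT (df a)).
Proof.
move=> h1 h2 h3 h4.
have Ia' : a - 1 < a < a + 1 by apply/andP; split; lra.
have Ia : (`]a - 1, a + 1[%classic : set R) a by rewrite /= in_itv.
have h1' x : (`]a - 1, a + 1[%classic : set R) x -> mu.-integrable setT (EFin \o f x).
  by rewrite /= in_itv /=; exact: h1.
have dE x y : partial1of2 f x y = df x y.
  by rewrite partial1of2E; have [_ ->] := h2 x y.
have G0 y : 0 <= G y by apply: le_trans (h4 a y Ia').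
have der x y : (`]a - 1, a + 1[%classic : set R) x -> [set: Y] y -> derivable (f ^~ y) x 1.
  by move=> _ _; have [] := h2 x y.
have bd x y : (`]a - 1, a + 1[%classic : set R) x -> [set: Y] y -> `|partial1of2 f x y| <= G y.
  by rewrite /= in_itv /= => hx _; rewrite dE; exact: h4.
split.
  exact: (@derivable_under_integral _ _ _ mu f setT measurableT a (a - 1) (a + 1) Ia h1' der G G0 h3 bd).
rewrite -derive1E (@differentiation_under_integral _ _ _ mu f setT measurableT a (a - 1) (a + 1) Ia h1' der G G0 h3 bd).
by apply: eq_Rintegral => y _; exact: dE.
Qed.

End DeriveHelpers.

Section GaussianFourier.
Context (R : realType) (d : nat).
Local Notation V := (d.-tuple R).
Variable lam : {measure set V -> \bar R}.
Hypothesis lamL : is_lebesgue lam.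

Lemma integrable_ge0 (f : V -> R) : measurable_fun setT f -> (forall x, 0 <= f x) ->
  (\int[lam]_x (f x)%:E < +oo)%E -> lam.-integrable setT (EFin \o f).
Proof.
move=> mf f0 h; apply/integrableP; split; first exact/measurable_EFinP.
rewrite (_ : (\int[lam]_x _)%E = (\int[lam]_x (f x)%:E)%E) //.
by apply: eq_integral => x _ /=; rewrite ger0_norm.
Qed.

Lemma integrable_le (f g : V -> R) : measurable_fun setT f ->
  lam.-integrable setT (EFin \o g) -> (forall x, `|f x| <= g x) ->
  lam.-integrable setT (EFin \o f).
Proof.
move=> mf ig fg; apply: le_integrable ig => //; first exact/measurable_EFinP.
by move=> x _ /=; rewrite lee_fin; apply: le_trans (fg x) (ler_norm _).
Qed.

Lemma integrableRZl (k : R) (g : V -> R) : lam.-integrable setT (EFin \o g) ->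
  lam.-integrable setT (EFin \o (fun x => k * g x)).
Proof.
move=> ig; rewrite (_ : EFin \o _ = (fun x => k%:E * (EFin \o g) x)%E).
  exact: integrableZl.
by apply/funext => x /=; rewrite EFinM.
Qed.

Lemma Rintegral_opp (h : V -> R) : measurable_fun setT h ->
  Rintegral lam setT (fun x => h (vscale (-1) x)) = Rintegral lam setT h.
Proof.
move=> mh; rewrite /Rintegral; congr fine; rewrite integralE [RHS]integralE.
have mE : measurable_fun setT (fun x => (h x)%:E) by exact/measurable_EFinP.
have n0 : (-1 : R) != 0 by rewrite oppr_eq0 oner_eq0.
have n1 : (`|-1| ^- d : R) = 1 by rewrite normrN1 expr1n invr1.
congr (_ - _)%E.
  have := integral_vscale lamL n0 (measurable_funepos mE) (fun x => funepos_ge0 _ x).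
  rewrite n1 mul1e => <-.
  by apply: eq_integral => x _; rewrite !funeposE.
have := integral_vscale lamL n0 (measurable_funeneg mE) (fun x => funeneg_ge0 _ x).
rewrite n1 mul1e => <-.
by apply: eq_integral => x _; rewrite !funenegE.
Qed.

(** Removes the sine integrals against a Gaussian and the cross term in the Plancherel identity. *)
Lemma Rintegral_odd (h : V -> R) : lam.-integrable setT (EFin \o h) ->
  (forall x, h (vscale (-1) x) = - h x) -> Rintegral lam setT h = 0.
Proof.
move=> ih odd.
have mh : measurable_fun setT h by apply/measurable_EFinP; exact: measurable_int ih.
have := Rintegral_opp mh.
under eq_Rintegral do rewrite odd -mulN1r.
rewrite RintegralZl // mulN1r => e.
by move: e; move: (Rintegral _ _ _) => z; lra.
Qed.

Variables (b : R) (v : V).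
Hypothesis b0 : 0 < b.
Let q := dotv v v.
Let u (x : V) := dotv v x.
Let G := @gauss R d b.

Let mu_ : measurable_fun setT u.
Proof. exact: measurable_dotv. Qed.

Let mG : measurable_fun setT G.
Proof. exact: (@measurable_gauss R d b _ V id). Qed.

Let G0 x : 0 <= G x.
Proof. exact: gauss_ge0. Qed.

Let mexp c : measurable_fun setT (fun x : V => expR (c * u x)).
Proof. by apply: (measurableT_comp (@measurable_expR R)); apply: measurable_funM. Qed.

Lemma integrable_gauss : lam.-integrable setT (EFin \o G).
Proof. by apply: integrable_ge0 => //; exact: integral_gauss_lty. Qed.

Lemma integrable_gauss_expR c : lam.-integrable setT (EFin \o (fun x => G x * expR (c * u x))).
Proof.
apply: integrable_ge0.
- exact: measurable_funM.
- by move=> x; rewrite mulr_ge0 ?expR_ge0.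
(* The shift for which completing the square absorbs the linear exponent c u(x). *)
pose h := - c / (2 * b).
have e x : G x * expR (c * u x) = gauss b (vadd x (vscale h v)) * expR (b * h ^+ 2 * q).
  rewrite gauss_shift -mulrA -expRD addNr expR0 mulr1; congr (_ * expR _).
  by rewrite /h /u; field; rewrite gt_eqF.
under eq_integral do rewrite e EFinM.
rewrite ge0_integralZr //; last 2 first.
- by apply/measurable_EFinP; apply: measurable_gauss; exact: measurable_vadd.
- by move=> x _; rewrite lee_fin gauss_ge0.
rewrite lte_mul_pinfty ?ltry //.
- by apply: integral_ge0 => x _; rewrite lee_fin gauss_ge0.
- rewrite ge0_fin_numE.
    rewrite (integral_translate lamL _ (f := fun x => (gauss b x)%:E)).
    + exact: integral_gauss_lty.
    + exact: measurable_gaussE.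
    + by move=> x; rewrite lee_fin gauss_ge0.
  by apply: integral_ge0 => x _; rewrite lee_fin gauss_ge0.
Qed.

(** An integrable majorant of K G(x) exp(c |u x|), free of absolute values so that each summand is a
    shifted Gaussian. *)
Let dom K c x := K * (G x * expR (c * u x) + G x * expR (- c * u x)).

Let idom K c : lam.-integrable setT (EFin \o dom K c).
Proof.
rewrite (_ : EFin \o dom K c = (fun x => K%:E * ((G x * expR (c * u x))%:E + (G x * expR (- c * u x))%:E))%E).
  by apply: integrableZl => //; apply: integrableD => //; exact: integrable_gauss_expR.
by apply/funext => x /=; rewrite /dom EFinM EFinD.
Qed.

Let ndom c x (t : R) : `|t| <= expR (c * `|u x|) -> G x * `|t| <= G x * expR (c * u x) + G x * expR (- c * u x).
Proof.
move=> h; rewrite -mulrDr ler_wpM2l // (le_trans h) //.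
have [u0|u0] := leP 0 (u x).
  by rewrite ger0_norm // lerDl expR_ge0.
by rewrite ltr0_norm // mulrN -mulNr lerDr expR_ge0.
Qed.

Let le_exp (x : R) : x <= expR x.
Proof. by apply: le_trans (expR_ge1Dx x); rewrite lerDr. Qed.

Let mcos s : measurable_fun setT (fun x => cos (s * u x)).
Proof. by apply: (measurableT_comp (@measurable_cos R)); apply: measurable_funM. Qed.

Let msin s e : measurable_fun setT (fun x => sin (s * u x + e)).
Proof. by apply: (measurableT_comp (@measurable_sin R)); apply: measurable_funD => //; apply: measurable_funM. Qed.

Let norm_cos (x : R) : `|cos x| <= 1.
Proof. by rewrite ler_norml cos_geN1 cos_le1. Qed.

Let norm_sin (x : R) : `|sin x| <= 1.
Proof. by rewrite ler_norml sin_geN1 sin_le1. Qed.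

Let phi s := Rintegral lam setT (fun x => G x * cos (s * u x)).
Let J s := Rintegral lam setT (fun x => G x * (u x * sin (s * u x))).

Let i_sin s : lam.-integrable setT (EFin \o (fun x => G x * sin (s * u x))).
Proof.
apply: (integrable_le _ integrable_gauss).
  by apply: measurable_funM => //; under eq_fun do rewrite -[s * _]addr0; exact: msin.
by move=> x; rewrite normrM ger0_norm // ler_piMr.
Qed.

Let i_cos s : lam.-integrable setT (EFin \o (fun x => G x * cos (s * u x))).
Proof.
apply: (integrable_le _ integrable_gauss); first exact: measurable_funM.
by move=> x; rewrite normrM ger0_norm // ler_piMr.
Qed.

Let i_usin s : lam.-integrable setT (EFin \o (fun x => G x * (u x * sin (s * u x)))).
Proof.
apply: (integrable_le _ (idom 1 1)).
  apply: measurable_funM => //; apply: measurable_funM => //.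
  by under eq_fun do rewrite -[s * _]addr0; exact: msin.
move=> x; rewrite normrM ger0_norm // /dom mul1r; apply: ndom.
rewrite normrM mul1r; apply: le_trans (le_exp _).
by rewrite ler_piMr.
Qed.

Let dphi (s : R) : is_derive s (1 : R) phi (- J s).
Proof.
have -> : - J s = Rintegral lam setT (fun x => G x * (- sin (s * u x) * u x)).
  rewrite -mulN1r -RintegralZl //.
  by apply: eq_Rintegral => x _; ring.
apply: (@is_derive_Rintegral _ _ _ lam (fun s x => G x * cos (s * u x))
   (fun s x => G x * (- sin (s * u x) * u x)) (dom 1 1)) => //.
- move=> t x; have := is_derive_mul (is_derive_cst (G x) t 1) (is_derive_cos_affine (u x) 0 t).
  rewrite mulr0 addr0 add0r.
  by under eq_fun do rewrite /= add0r.
- move=> t x _; rewrite normrM ger0_norm // /dom mul1r; apply: ndom.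
  rewrite normrM normrN mul1r; apply: le_trans (le_exp _).
  by rewrite ler_piMl.
Qed.

(* Differentiating the translation-invariant integral of G(x) sin(s v.x) along v. *)
Let Jphi s : 2 * b * J s = s * q * phi s.
Proof.
(* This is G sin(s u) evaluated at x + h v, with the factor exp(-b h^2 q), which does not depend on
   x, divided out. *)
pose f h x := G x * (expR (0 + h * (- (2 * b * u x))) * sin (s * u x + h * (s * q))).
pose df h x := G x * (expR (0 + h * (- (2 * b * u x))) * (cos (s * u x + h * (s * q)) * (s * q))
   + sin (s * u x + h * (s * q)) * (expR (0 + h * (- (2 * b * u x))) * (- (2 * b * u x)))).
have mf h : measurable_fun setT (f h).
  apply: measurable_funM => //; apply: measurable_funM; last exact: msin.
  apply: (measurableT_comp (@measurable_expR R)); apply: measurable_funD => //.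
  apply: measurable_funM => //; apply: measurable_funN; exact: measurable_funM.
have bexp h x : 0 - 1 < h < 0 + 1 -> expR (0 + h * (- (2 * b * u x))) <= expR (2 * b * `|u x|).
  move=> /andP[h1 h2]; rewrite ler_expR add0r.
  apply: le_trans (ler_norm _) _; rewrite normrM normrN !normrM (ger0_norm (ltW b0)) normr_nat.
  by rewrite ler_piMl ?mulr_ge0 // ?(ltW b0) // ler_norml; apply/andP; split; lra.
have intf h : 0 - 1 < h < 0 + 1 -> lam.-integrable setT (EFin \o f h).
  move=> hh; apply: (integrable_le _ (idom 1 (2 * b))) => // x.
  rewrite normrM ger0_norm // /dom mul1r; apply: ndom.
  rewrite normrM (ger0_norm (expR_ge0 _)); apply: le_trans (bexp h x hh).
  by rewrite ler_piMr ?expR_ge0.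
(* Translation invariance reduces to h = 0, where the integrand is odd. *)
have f0 h : 0 - 1 < h < 0 + 1 -> Rintegral lam setT (f h) = 0.
  move=> hh.
  have e x : f h x * expR (- (b * h ^+ 2 * q)) =
    (fun x => G x * sin (s * u x)) (vadd x (vscale h v)).
    rewrite /f /G gauss_shift add0r /u !dotvDr !dotvZr -/q.
    rewrite (_ : - (2 * b * h * dotv v x) = h * - (2 * b * dotv v x)); last by ring.
    rewrite (_ : s * (dotv v x + h * q) = s * dotv v x + h * (s * q)); last by ring.
    by rewrite /u; ring.
  have : Rintegral lam setT (fun x => f h x * expR (- (b * h ^+ 2 * q))) = 0.
    under eq_Rintegral do rewrite e.
    rewrite (Rintegral_translate lamL (vscale h v) (h := fun x => G x * sin (s * u x))); last first.
      by apply: measurable_funM => //; under eq_fun do rewrite -[s * _]addr0; exact: msin.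
    apply: Rintegral_odd => // x.
    by rewrite /G gaussN /u dotvZr !mulN1r mulrN sinN mulrN.
  rewrite RintegralZr //; last exact: intf.
  move=> /eqP; rewrite mulf_eq0 (gt_eqF (expR_gt0 _)) orbF => /eqP; exact.
(* Differentiation brings down a factor of at most |s q| + 2b|u|, below (2b + |s q|) exp|u|; the
   exponential already present is at most exp(2b|u|) for |h| < 1. *)
have D := @is_derive_Rintegral _ _ _ lam f df (dom (2 * b + `|s * q|) (2 * b + 1)) 0 intf.
have {}D : is_derive (0 : R) 1 (fun h => Rintegral lam setT (f h)) (Rintegral lam setT (df 0)).
  apply: D => //.
    move=> h x.
    have := is_derive_mul (is_derive_cst (G x) h 1)
      (is_derive_mul (is_derive_expR_affine (- (2 * b * u x)) 0 h) (is_derive_sin_affine (s * q) (s * u x) h)).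
    by rewrite mulr0 addr0.
  move=> h x hh; rewrite /df normrM ger0_norm // /dom.
  set E := expR _; have E0 : 0 <= E by exact: expR_ge0.
  set C := cos _; set S := sin _.
  have hC : `|C| <= 1 by exact: norm_cos.
  have hS : `|S| <= 1 by exact: norm_sin.
  apply: (@le_trans _ _ (G x * ((2 * b + `|s * q|) * `|expR ((2 * b + 1) * `|u x|)|))).
    rewrite ler_wpM2l // (ger0_norm (expR_ge0 ((2 * b + 1) * `|u x|))).
    have -> : expR ((2 * b + 1) * `|u x|) = expR (2 * b * `|u x|) * expR `|u x|.
      by rewrite -expRD; congr expR; ring.
    have hE := bexp h x hh; rewrite -/E in hE.
    have e1 : 1 <= expR `|u x| by rewrite -expR0 ler_expR.
    have e2 := le_exp `|u x|.
    have -> : E * (C * (s * q)) + S * (E * - (2 * b * u x)) = E * (C * (s * q) - S * (2 * b * u x)) by ring.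
    rewrite normrM (ger0_norm E0) [leRHS]mulrCA; apply: ler_pM => //.
    apply: le_trans (ler_normB _ _) _.
    rewrite [leRHS]mulrDl [leRHS]addrC lerD //; rewrite !normrM.
      apply: (@le_trans _ _ (`|s| * `|q|)); first by rewrite ler_piMl ?mulr_ge0 //.
      by rewrite ler_peMr ?mulr_ge0 //.
    rewrite (ger0_norm (ltW b0)) normr_nat.
    apply: (@le_trans _ _ (2 * b * `|u x|)).
      by rewrite ler_piMl ?mulr_ge0 // ltW.
    by rewrite ler_wpM2l ?mulr_ge0 // ltW.
  have K0 : 0 <= 2 * b + `|s * q| by rewrite addr_ge0 // mulr_ge0 // ltW.
  rewrite mulrCA ler_wpM2l //.
  by apply: ndom; rewrite ger0_norm ?expR_ge0.
have D0 : Rintegral lam setT (df 0) = 0.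
  have [_ <-] := D.
  have : is_derive (0 : R) 1 (cst 0 : R -> R) 0 by exact: is_derive_cst.
  move=> [_ d0]; rewrite -[RHS]d0; apply: near_eq_derive.
  near=> h; rewrite f0 //; near: h.
  have : (`]-1, 1[%classic : set R) 0 by rewrite /= in_itv /=; apply/andP; split; lra.
  by move=> /near_in_itvoo; apply: filterS => z; rewrite /= in_itv /= sub0r add0r.
move: D0; rewrite /df.
have -> : Rintegral lam setT (df 0) = s * q * phi s - 2 * b * J s.
  rewrite /phi /J -!RintegralZl // -RintegralB //.
  - apply: eq_Rintegral => x _; rewrite /df !mul0r !addr0 expR0; ring.
  - exact: integrableRZl.
  - exact: integrableRZl.
by move=> /eqP; rewrite subr_eq0 => /eqP.
Unshelve. all: by end_near. Qed.

(** By [dphi] and [Jphi], phi' = -(s q / 2b) phi, so phi(s) exp(q s^2 / 4b) is constant; compare s =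
    0 with s = 1. The sine part vanishes by symmetry, so this is the full Fourier transform of G. *)
Lemma gauss_fourier_cos : Rintegral lam setT (fun x => G x * cos (u x)) =
  Rintegral lam setT G * expR (- (q / (4 * b))).
Proof.
pose c := q / (4 * b).
have D (s : R) : is_derive s (1 : R) (fun s => phi s * expR (c * s ^+ 2)) 0.
  have := is_derive_mul (dphi s) (is_derive_expR_sqr c s).
  rewrite (_ : _ + _ = 0) //.
  have -> : J s = s * q * phi s / (2 * b) by rewrite -Jphi mulrAC divff ?mul1r // mulf_neq0 // gt_eqF.
  by rewrite /c; field; rewrite gt_eqF.
have := is_derive_0_is_cst 1 0 D.
rewrite expr0n mulr0 expR0 mulr1 expr1n mulr1 => e.
have p0 : phi 0 = Rintegral lam setT G.
  by apply: eq_Rintegral => x _; rewrite mul0r cos0 mulr1.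
have p1 : phi 1 = Rintegral lam setT (fun x => G x * cos (u x)).
  by apply: eq_Rintegral => x _; rewrite mul1r.
by rewrite -p0 -p1 -e -mulrA -expRD subrr expR0 mulr1.
Qed.

End GaussianFourier.

(** * Fubini for real integrals, and weighted quadratic forms *)

Section RealFubini.
Context (R : realType) (d : nat).
Local Notation V := (d.-tuple R).
Variable lam : {measure set V -> \bar R}.
Hypothesis lamL : is_lebesgue lam.
Local Notation integrable f := (lam.-integrable setT (EFin \o f)).

Lemma RintegralK (f : V -> R) : integrable f ->
  ((Rintegral lam setT f)%:E = \int[lam]_x (f x)%:E)%E.
Proof. by move=> h; rewrite /Rintegral fineK //; exact: (integrable_fin_num measurableT h). Qed.

Lemma integrable_norm (f : V -> R) : integrable f -> integrable (fun x => `|f x|).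
Proof.
move=> h; apply: (@integrable_ge0 R d lam) => //.
  by apply: measurableT_comp => //; apply/measurable_EFinP; exact: measurable_int h.
by case/integrableP: h.
Qed.

Lemma integrable_measurable (f : V -> R) : integrable f -> measurable_fun setT f.
Proof. by move=> h; apply/measurable_EFinP; exact: measurable_int h. Qed.

Lemma measurable_Rintegral_r d1 (T : measurableType d1) (f : T * V -> R) :
  measurable_fun setT f -> measurable_fun setT (fun x => Rintegral lam setT (fun y => f (x, y))).
Proof.
move=> mf; rewrite /Rintegral.
apply: (measurableT_comp (@fine_measurable R setT measurableT)).
have mE : measurable_fun setT (EFin \o f) by exact/measurable_EFinP.
under eq_fun do rewrite integralE.
apply: emeasurable_funB.
  have -> : (fun x => \int[lam]_y ((fun y => (f (x, y))%:E)^\+ y))%E =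
     (fun x => \int[lam]_y (((EFin \o f)^\+) (x, y)))%E.
    by apply/funext => x; apply: eq_integral => y _; rewrite !funeposE.
  by apply: (measurable_int_r lamL); [exact: measurable_funepos|move=> p; exact: funepos_ge0].
have -> : (fun x => \int[lam]_y ((fun y => (f (x, y))%:E)^\- y))%E =
   (fun x => \int[lam]_y (((EFin \o f)^\-) (x, y)))%E.
  by apply/funext => x; apply: eq_integral => y _; rewrite !funenegE.
by apply: (measurable_int_r lamL); [exact: measurable_funeneg|move=> p; exact: funeneg_ge0].
Qed.

(** The majorant W of the inner integrals of |f| gives integrability on the product. *)
Lemma fubiniR (f : V * V -> R) (W : V -> R) : measurable_fun setT f ->
  (forall x, integrable (fun y => f (x, y))) -> integrable W ->
  (forall y, (\int[lam]_x (`|f (x, y)|)%:E <= (W y)%:E)%E) ->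
  [/\ integrable (fun x => Rintegral lam setT (fun y => f (x, y))),
      forall y, integrable (fun x => f (x, y)) &
   Rintegral lam setT (fun x => Rintegral lam setT (fun y => f (x, y))) =
   Rintegral lam setT (fun y => Rintegral lam setT (fun x => f (x, y)))].
Proof.
move=> mf i1 iW hW.
have mE : measurable_fun setT (EFin \o f) by exact/measurable_EFinP.
have W0 y : 0 <= W y.
  rewrite -lee_fin; apply: le_trans (hW y); apply: integral_ge0 => x _.
  by rewrite lee_fin.
have i2 y : integrable (fun x => f (x, y)).
  apply/integrableP; split.
    apply/measurable_EFinP; apply: (measurableT_comp mf).
    exact: measurable_fun_pair.
  by apply: le_lt_trans (hW y) _; rewrite ltry.
have ip : ((lamS lamL) \x (lamS lamL))%E.-integrable setT (EFin \o f).
  apply/(integrable21ltyP _ _ mE) => /=.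
  apply: (@le_lt_trans _ _ (\int[lam]_y (W y)%:E)%E).
    apply: ge0_le_integralT => y; first by apply: integral_ge0 => x _; rewrite lee_fin.
    exact: hW.
  have /integrableP[_] := iW.
  apply: le_lt_trans; apply: ge0_le_integralT => y; first by rewrite lee_fin.
  by rewrite /= lee_fin ler_norm.
have e1 : (EFin \o (fun x => Rintegral lam setT (fun y => f (x, y)))) =
   fubini_F (lamS lamL) (EFin \o f).
  by apply/funext => x /=; rewrite RintegralK.
split => //.
  by rewrite e1; exact: (integrable_fubini_F ip).
have := Fubini ip.
rewrite [X in X = _](_ : _ = (\int[lam]_x (Rintegral lam setT (fun y => f (x, y)))%:E)%E); last first.
  by apply: eq_integral => x _; rewrite RintegralK.
rewrite [X in _ = X](_ : _ = (\int[lam]_y (Rintegral lam setT (fun x => f (x, y)))%:E)%E); last first.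
  by apply: eq_integral => y _; rewrite RintegralK.
by rewrite /Rintegral => ->.
Qed.

(* [k1] and [k2] are the real and imaginary parts of a kernel. *)
Section QuadraticForm.
Variables (rho : V -> R) (k1 k2 : V -> V -> R) (C : R) (w : V -> R).
Hypotheses (mrho : measurable_fun setT rho) (rho0 : forall x, 0 <= rho x).
Hypotheses (mk1 : measurable_fun setT (fun p : V * V => k1 p.1 p.2))
  (mk2 : measurable_fun setT (fun p : V * V => k2 p.1 p.2)).
Hypotheses (k1le : forall x s, `|k1 x s| <= 1) (k2le : forall x s, `|k2 x s| <= 1).
Hypothesis kC : forall s, (\int[lam]_x (rho x * (`|k1 x s| + `|k2 x s|))%:E <= C%:E)%E.
Hypothesis iw : integrable w.

Let N := Rintegral lam setT (fun x => `|w x|).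
Let T1 x := Rintegral lam setT (fun s => k1 x s * w s).
Let T2 x := Rintegral lam setT (fun s => k2 x s * w s).

Let mw : measurable_fun setT w. Proof. exact: integrable_measurable. Qed.

Let m_at (k : V -> V -> R) x : measurable_fun setT (fun p : V * V => k p.1 p.2) ->
  measurable_fun setT (k x).
Proof.
move=> mk.
have h : measurable_fun setT (fun s : V => (x, s)) by exact: measurable_fun_pair.
exact: (measurableT_comp mk h).
Qed.

Let m_at2 (k : V -> V -> R) s : measurable_fun setT (fun p : V * V => k p.1 p.2) ->
  measurable_fun setT (k^~ s).
Proof.
move=> mk.
have h : measurable_fun setT (fun x : V => (x, s)) by exact: measurable_fun_pair.
exact: (measurableT_comp mk h).
Qed.

Let i_at (k : V -> V -> R) x : measurable_fun setT (fun p : V * V => k p.1 p.2) ->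
  (forall x s, `|k x s| <= 1) -> integrable (fun s => k x s * w s).
Proof.
move=> mk kle; apply: (integrable_le _ (integrable_norm iw)).
  by apply: measurable_funM => //; exact: m_at.
by move=> s; rewrite normrM ler_piMl.
Qed.

Let T_le (k : V -> V -> R) x : measurable_fun setT (fun p : V * V => k p.1 p.2) ->
  (forall x s, `|k x s| <= 1) -> `|Rintegral lam setT (fun s => k x s * w s)| <= N.
Proof.
move=> mk kle; apply: le_trans (le_normr_Rintegral measurableT (i_at x mk kle)) _.
apply: le_Rintegral => //.
- exact: (integrable_norm (i_at x mk kle)).
- exact: integrable_norm.
- by move=> s _; rewrite normrM ler_piMl.
Qed.

Let mT (k : V -> V -> R) : measurable_fun setT (fun p : V * V => k p.1 p.2) ->
  measurable_fun setT (fun x => Rintegral lam setT (fun s => k x s * w s)).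
Proof.
move=> mk; apply: (@measurable_Rintegral_r _ _ (fun p => k p.1 p.2 * w p.2)).
by apply: measurable_funM => //; exact: measurableT_comp.
Qed.

Let N0 : 0 <= N. Proof. by apply: Rintegral_ge0. Qed.

Let C0 : 0 <= C.
Proof.
rewrite -lee_fin; apply: le_trans (kC (cvec d 0)); apply: integral_ge0 => x _.
by rewrite lee_fin mulr_ge0 // addr_ge0.
Qed.

Let K s t := Rintegral lam setT (fun x => rho x * (k1 x s * k1 x t + k2 x s * k2 x t)).

Let iZl := @integrableRZl R d lam.

Let inner s : Rintegral lam setT (fun x => rho x * (k1 x s * T1 x + k2 x s * T2 x)) =
  Rintegral lam setT (fun t => w t * K s t) /\
  integrable (fun x => rho x * (k1 x s * T1 x + k2 x s * T2 x)).
Proof.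
pose f (p : V * V) := rho p.1 * (k1 p.1 s * k1 p.1 p.2 + k2 p.1 s * k2 p.1 p.2) * w p.2.
have mf : measurable_fun setT f.
  apply: measurable_funM; last exact: measurableT_comp.
  apply: measurable_funM; first exact: measurableT_comp.
  by apply: measurable_funD; apply: measurable_funM => //; apply: (measurableT_comp (m_at2 s _)).
have fE x t : f (x, t) = rho x * k1 x s * (k1 x t * w t) + rho x * k2 x s * (k2 x t * w t).
  by rewrite /f /=; ring.
have j1 x := i_at x mk1 k1le.
have j2 x := i_at x mk2 k2le.
have iD (u1 u2 : V -> R) : integrable u1 -> integrable u2 -> integrable (fun x => u1 x + u2 x).
  by move=> h1 h2; exact: (integrableD measurableT h1 h2).
have [] := @fubiniR f (fun t => C * `|w t|) mf.
- move=> x; under eq_fun do rewrite /= fE.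
  by apply: iD; apply: iZl.
- by apply: iZl; exact: integrable_norm.
- move=> t.
  apply: (@le_trans _ _ (\int[lam]_x ((rho x * (`|k1 x s| + `|k2 x s|))%:E * (`|w t|)%:E))%E).
    apply: ge0_le_integralT => x; first by rewrite lee_fin.
    rewrite -EFinM lee_fin /f /= normrM ler_wpM2r // normrM ger0_norm //.
    rewrite ler_wpM2l // (le_trans (ler_normD _ _)) // !normrM.
    by rewrite lerD // ler_piMr.
  rewrite ge0_integralZr //; last 2 first.
  + apply/measurable_EFinP; apply: measurable_funM => //.
    by apply: measurable_funD; apply: measurableT_comp => //; exact: m_at2.
  + by move=> x _; rewrite lee_fin mulr_ge0 // addr_ge0.
  by rewrite EFinM lee_wpmul2r // lee_fin.
have e1 : (fun x => Rintegral lam setT (fun y => f (x, y))) =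
   (fun x => rho x * (k1 x s * T1 x + k2 x s * T2 x)).
  apply/funext => x; under eq_Rintegral do rewrite fE.
  rewrite RintegralD //; [|exact: iZl|exact: iZl].
  by rewrite !RintegralZl // -/(T1 x) -/(T2 x); ring.
rewrite e1 => h1 h2 ->; split => //.
apply: eq_Rintegral => t _; rewrite /f /=.
(* Fubini yields integrability of the integrand multiplied by w t; recovering the kernel alone takes
   a division by w t. *)
have [->|w0] := eqVneq (w t) 0.
  by rewrite mul0r; under eq_Rintegral do rewrite mulr0; rewrite Rintegral_cst // mul0r.
rewrite RintegralZr //; first by rewrite mulrC.
have := h2 t; rewrite /f /= => hh.
have := iZl (w t)^-1 hh.
rewrite (_ : (fun x => _) = (fun x => rho x * (k1 x s * k1 x t + k2 x s * k2 x t))) //.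
by apply/funext => x; rewrite mulrC mulfK.
Qed.

(** Expand the square of the transform of w and exchange integrals twice, first in t for fixed s
    ([inner]), then in s. Both sides of Plancherel are instances, and they agree as soon as their
    kernels K do. *)
Lemma quadratic_form :
  integrable (fun x => rho x * (T1 x ^+ 2 + T2 x ^+ 2)) /\
  Rintegral lam setT (fun x => rho x * (T1 x ^+ 2 + T2 x ^+ 2)) =
  Rintegral lam setT (fun s => w s * Rintegral lam setT (fun t => w t * K s t)).
Proof.
pose f (p : V * V) := rho p.1 * (k1 p.1 p.2 * T1 p.1 + k2 p.1 p.2 * T2 p.1) * w p.2.
have mf : measurable_fun setT f.
  apply: measurable_funM; last exact: measurableT_comp.
  apply: measurable_funM; first exact: measurableT_comp.
  by apply: measurable_funD; apply: measurable_funM => //; apply: (measurableT_comp (mT _)).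
have fE x t : f (x, t) = rho x * T1 x * (k1 x t * w t) + rho x * T2 x * (k2 x t * w t).
  by rewrite /f /=; ring.
have j1 x := i_at x mk1 k1le.
have j2 x := i_at x mk2 k2le.
have iD (u1 u2 : V -> R) : integrable u1 -> integrable u2 -> integrable (fun x => u1 x + u2 x).
  by move=> h1 h2; exact: (integrableD measurableT h1 h2).
have t1 x : `|T1 x| <= N := T_le x mk1 k1le.
have t2 x : `|T2 x| <= N := T_le x mk2 k2le.
have [] := @fubiniR f (fun t => C * N * `|w t|) mf.
- move=> x; under eq_fun do rewrite /= fE.
  by apply: iD; apply: iZl.
- by apply: iZl; exact: integrable_norm.
- move=> t.
  apply: (@le_trans _ _ (\int[lam]_x ((rho x * (`|k1 x t| + `|k2 x t|))%:E * (N * `|w t|)%:E))%E).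
    apply: ge0_le_integralT => x; first by rewrite lee_fin.
    rewrite -EFinM lee_fin /f /= normrM mulrA ler_wpM2r // normrM ger0_norm //.
    rewrite -mulrA ler_wpM2l // (le_trans (ler_normD _ _)) // !normrM mulrDl.
    by rewrite lerD // ler_wpM2l.
  rewrite ge0_integralZr //; last 3 first.
  + apply/measurable_EFinP; apply: measurable_funM => //.
    by apply: measurable_funD; apply: measurableT_comp => //; exact: m_at2.
  + by move=> x _; rewrite lee_fin mulr_ge0 // addr_ge0.
  + by rewrite lee_fin mulr_ge0.
  rewrite [leRHS](_ : _ = C%:E * (N * `|w t|)%:E)%E; last by rewrite -EFinM mulrA.
  by apply: lee_wpmul2r => //; rewrite lee_fin mulr_ge0.
have e1 : (fun x => Rintegral lam setT (fun y => f (x, y))) =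
   (fun x => rho x * (T1 x ^+ 2 + T2 x ^+ 2)).
  apply/funext => x; under eq_Rintegral do rewrite fE.
  rewrite RintegralD //; [|exact: iZl|exact: iZl].
  by rewrite !RintegralZl // -/(T1 x) -/(T2 x); ring.
rewrite e1 => h1 h2 ->; split => //.
apply: eq_Rintegral => s _; rewrite /f /=.
have [e i] := inner s.
by rewrite RintegralZr // e mulrC.
Qed.

End QuadraticForm.
End RealFubini.

Lemma ler_norm_cross (R : realDomainType) (p q r s : R) :
  `|2 * (p * q - r * s)| <= p ^+ 2 + s ^+ 2 + (r ^+ 2 + q ^+ 2).
Proof.
have h1 : 0 <= (p - q) ^+ 2 + (r + s) ^+ 2 by rewrite addr_ge0 ?sqr_ge0.
have h2 : 0 <= (p + q) ^+ 2 + (r - s) ^+ 2 by rewrite addr_ge0 ?sqr_ge0.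
by rewrite ler_norml; apply/andP; split; lra.
Qed.

(** * Plancherel against Gaussian windows *)

Section GaussianPlancherel.
Context (R : realType) (d : nat).
Local Notation V := (d.-tuple R).
Variable lam : {measure set V -> \bar R}.
Hypothesis lamL : is_lebesgue lam.
Local Notation integrable f := (lam.-integrable setT (EFin \o f)).

Definition gauss_mass (a : R) : R := Rintegral lam setT (@gauss R d a).

Lemma gauss_mass_gt0 a : 0 < a -> 0 < gauss_mass a.
Proof.
move=> a0; have ig := integrable_gauss lamL a0.
(* A lower bound for the Gaussian on [cube 1], where |x|^2 <= d. *)
pose c := expR (- (a * d%:R)).
have c0 : 0 < c by exact: expR_gt0.
rewrite -lte_fin /gauss_mass RintegralK //.
apply: (@lt_le_trans _ _ (\int[lam]_x (c%:E * ind (cube 1) x))%E).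
  rewrite ge0_integralZl //; last 3 first.
  - by apply: measurable_ind; exact: cube_measurable.
  - by move=> x _; exact: ind_ge0.
  - by rewrite lee_fin ltW.
  rewrite integral_ind; last exact: cube_measurable.
  by rewrite (lam_cube lamL) // -EFinM lte_fin mulr_gt0 // exprn_gt0 // mulr1.
apply: ge0_le_integralT => x; first by rewrite mule_ge0 ?ind_ge0 // lee_fin ltW.
have [hx|hx] := pselect (cube 1 x); last by rewrite (ind0 hx) mule0 lee_fin gauss_ge0.
rewrite (ind1 hx) mule1 lee_fin /c /gauss ler_expR lerN2 ler_pM2l //.
rewrite /dotv -[leRHS]mulr1 -[d in leRHS]card_ord -sum1_card natr_sum mulr_suml.
apply: ler_sum => i _; have := hx i; rewrite !tnth_cvec => /andP[h1 h2].
by rewrite mul1r -expr2 -real_normK ?num_real // expr_le1 // ler_norml h1 ltW.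
Qed.

(** By the parallelogram identity the product is a Gaussian of width 2a centred at -(s + t)/2, times
    a Gaussian in s - t. *)
Lemma gauss_autocorrelation a (s t : V) : 0 < a ->
  Rintegral lam setT (fun x => gauss a (vadd x s) * gauss a (vadd x t)) =
  gauss_mass (2 * a) * expR (- (a / 2 * dotv (vsub s t) (vsub s t))).
Proof.
move=> a0; have e x : gauss a (vadd x s) * gauss a (vadd x t) =
  expR (- (a / 2 * dotv (vsub s t) (vsub s t))) * gauss (2 * a) (vadd x (vscale (2^-1) (vadd s t))).
  rewrite /gauss -!expRD; congr expR.
  rewrite !(dotvDl, dotvDr, dotvZl, dotvZr, dotvBl, dotvBr).
  by rewrite (dotvC s x) (dotvC t x) (dotvC t s); field.
pose h (x : V) := expR (- (a / 2 * dotv (vsub s t) (vsub s t))) * gauss (2 * a) x.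
have mg : measurable_fun setT (@gauss R d (2 * a)) by exact: (measurable_gauss _ (f := id)).
have mh : measurable_fun setT h by exact: measurable_funM.
under eq_Rintegral do rewrite e.
rewrite (Rintegral_translate lamL (vscale (2^-1) (vadd s t)) mh) /h.
rewrite RintegralZl //; first by rewrite mulrC.
by apply: (integrable_gauss lamL); rewrite mulr_gt0.
Qed.

Variables (a : R) (th : V -> V).
Hypotheses (a0 : 0 < a) (mth : measurable_fun setT th).

(* [dual_gauss] is chosen so that its Fourier transform is the autocorrelation of [gauss a]. *)
Definition dual_width : R := 2 * pi ^+ 2 / a.
Definition dual_gauss (eta : V) : R :=
  gauss_mass (2 * a) / gauss_mass dual_width * gauss dual_width eta.
Local Notation b := dual_width.
Local Notation h0 := dual_gauss.

Lemma dual_width_gt0 : 0 < b.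
Proof. by rewrite divr_gt0 // mulr_gt0 // exprn_gt0 // pi_gt0. Qed.

Let b0 := dual_width_gt0.

Let a20 : 0 < 2 * a. Proof. by rewrite mulr_gt0. Qed.

Lemma dual_gauss_ge0 eta : 0 <= h0 eta.
Proof. by rewrite mulr_ge0 ?gauss_ge0 // divr_ge0 // ltW // gauss_mass_gt0. Qed.

Lemma measurable_dual_gauss : measurable_fun setT h0.
Proof. by apply: measurable_funM => //; exact: (measurable_gauss _ (f := id)). Qed.

Lemma integrable_dual_gauss : integrable h0.
Proof. by apply: integrableRZl; exact: (integrable_gauss lamL b0). Qed.

(** For b = 2 pi^2 / a, the transform of [gauss b] at 2 pi u has exponent -4 pi^2 |u|^2 / (4b) = -a
    |u|^2 / 2, that of the autocorrelation. The prefactor of [dual_gauss] adjusts the mass. *)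
Lemma dual_gauss_fourier (u : V) :
  Rintegral lam setT (fun eta => h0 eta * cos (2 * pi * dotv u eta)) =
  gauss_mass (2 * a) * expR (- (a / 2 * dotv u u)).
Proof.
have hb := integrable_gauss lamL b0.
have mg : measurable_fun setT (@gauss R d b) by exact: (measurable_gauss _ (f := id)).
under eq_Rintegral do rewrite /dual_gauss -mulrA.
have ic : integrable (fun x => gauss b x * cos (2 * pi * dotv u x)).
  apply: (integrable_le _ hb).
    apply: measurable_funM => //; apply: (measurableT_comp (@measurable_cos R)).
    by apply: measurable_funM => //; exact: measurable_dotv.
  by move=> x; rewrite normrM ger0_norm ?gauss_ge0 // ler_piMr ?gauss_ge0 // ler_norml cos_geN1 cos_le1.
rewrite RintegralZl //.
have := gauss_fourier_cos lamL (vscale (2 * pi) u) b0.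
under eq_Rintegral do rewrite dotvZl.
move=> ->; rewrite -/(gauss_mass b) mulrA divfK; last by rewrite gt_eqF // gauss_mass_gt0.
congr (_ * expR (- _)); rewrite dotvZl dotvZr /dual_width.
have := pi_gt0 R; move: (pi) => p p0; field.
by rewrite !gt_eqF.
Qed.

Definition gauss_conv (u : V -> R) (x : V) : R :=
  Rintegral lam setT (fun s => gauss a (vadd x (th s)) * u s).
Definition cos_trans (u : V -> R) (eta : V) : R :=
  Rintegral lam setT (fun s => cos (2 * pi * dotv (th s) eta) * u s).
Definition sin_trans (u : V -> R) (eta : V) : R :=
  Rintegral lam setT (fun s => sin (2 * pi * dotv (th s) eta) * u s).

Let Kf (s t : V) := gauss_mass (2 * a) * expR (- (a / 2 * dotv (vsub (th s) (th t)) (vsub (th s) (th t)))).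

Let mphase : measurable_fun setT (fun p : V * V => 2 * pi * dotv (th p.2) p.1).
Proof.
apply: measurable_funM => //; apply: measurable_dotv => //.
exact: measurableT_comp.
Qed.

(** The quadratic form with weight 1 and a real Gaussian kernel; its K is the autocorrelation. *)
Lemma gauss_conv_sqr u : integrable u -> integrable (fun x => gauss_conv u x ^+ 2) /\
  Rintegral lam setT (fun x => gauss_conv u x ^+ 2) =
  Rintegral lam setT (fun s => u s * Rintegral lam setT (fun t => u t * Kf s t)).
Proof.
move=> iu.
have mk1 : measurable_fun setT (fun p : V * V => gauss a (vadd p.1 (th p.2))).
  by apply: measurable_gauss; apply: measurable_vadd => //; exact: measurableT_comp.
have k1 (x s : V) : `|gauss a (vadd x (th s))| <= 1 by rewrite ger0_norm ?gauss_ge0 // gauss_le1 // ltW.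
have k2 (x s : V) : `|(0 : R)| <= 1 by rewrite normr0.
have [] := @quadratic_form R d lam lamL (fun=> 1) (fun x s => gauss a (vadd x (th s))) (fun _ _ => 0) (gauss_mass a) u (measurable_cst _) (fun=> ler01) mk1 (measurable_cst _) k1 k2 _ iu.
  move=> s; rewrite RintegralK; last exact: integrable_gauss.
  rewrite -(integral_translate lamL (th s) (f := fun x => (gauss a x)%:E)); last 2 first.
  + exact: measurable_gaussE.
  + by move=> x; rewrite lee_fin gauss_ge0.
  by apply: ge0_le_integralT => x; rewrite normr0 addr0 mul1r ger0_norm ?gauss_ge0 // lee_fin ?gauss_ge0.
have z : Rintegral lam setT (fun s => 0 * u s) = 0.
  by under eq_Rintegral do rewrite mul0r; rewrite Rintegral_cst // mul0r.
rewrite (_ : (fun x => 1 * _) = (fun x => gauss_conv u x ^+ 2)); last first.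
  by apply/funext => x; rewrite mul1r z expr0n addr0.
move=> h ->; split; first exact: h.
apply: eq_Rintegral => s _; congr (_ * _); apply: eq_Rintegral => t _; congr (_ * _).
rewrite /Kf -gauss_autocorrelation //; apply: eq_Rintegral => x _.
by rewrite mul1r mul0r addr0.
Qed.

Lemma integrable_sin u eta : integrable u ->
  integrable (fun s => sin (2 * pi * dotv (th s) eta) * u s).
Proof.
move=> iu; apply: (integrable_le _ (integrable_norm iu)).
  apply: measurable_funM; last exact: (integrable_measurable iu).
  apply: (measurableT_comp (@measurable_sin R)); apply: measurable_funM; first exact: measurable_cst.
  exact: measurable_dotv.
by move=> s; rewrite normrM ler_piMl // ler_norml sin_geN1 sin_le1.
Qed.

Lemma integrable_cos u eta : integrable u ->
  integrable (fun s => cos (2 * pi * dotv (th s) eta) * u s).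
Proof.
move=> iu; apply: (integrable_le _ (integrable_norm iu)).
  apply: measurable_funM; last exact: (integrable_measurable iu).
  apply: (measurableT_comp (@measurable_cos R)); apply: measurable_funM; first exact: measurable_cst.
  exact: measurable_dotv.
by move=> s; rewrite normrM ler_piMl // ler_norml cos_geN1 cos_le1.
Qed.

(** The quadratic form with weight [dual_gauss] and kernel cos, sin; the addition formula gives
    cos(2 pi (th s - th t).eta), whose weighted integral is the same kernel [Kf]. *)
Lemma trans_sqr u : integrable u ->
  integrable (fun x => h0 x * (cos_trans u x ^+ 2 + sin_trans u x ^+ 2)) /\
  Rintegral lam setT (fun x => h0 x * (cos_trans u x ^+ 2 + sin_trans u x ^+ 2)) =
  Rintegral lam setT (fun s => u s * Rintegral lam setT (fun t => u t * Kf s t)).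
Proof.
move=> iu.
have mk1 : measurable_fun setT (fun p : V * V => cos (2 * pi * dotv (th p.2) p.1)).
  exact: (measurableT_comp (@measurable_cos R) mphase).
have mk2 : measurable_fun setT (fun p : V * V => sin (2 * pi * dotv (th p.2) p.1)).
  exact: (measurableT_comp (@measurable_sin R) mphase).
have c1 (x s : V) : `|cos (2 * pi * dotv (th s) x)| <= 1 by rewrite ler_norml cos_geN1 cos_le1.
have s1 (x s : V) : `|sin (2 * pi * dotv (th s) x)| <= 1 by rewrite ler_norml sin_geN1 sin_le1.
have [] := @quadratic_form R d lam lamL h0 (fun x s => cos (2 * pi * dotv (th s) x))
  (fun x s => sin (2 * pi * dotv (th s) x)) (Rintegral lam setT (fun x => 2 * h0 x)) u
  measurable_dual_gauss dual_gauss_ge0 mk1 mk2 c1 s1 _ iu.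
  move=> s; rewrite RintegralK; last by apply: integrableRZl; exact: integrable_dual_gauss.
  apply: ge0_le_integralT => x; rewrite lee_fin.
    by rewrite mulr_ge0 ?dual_gauss_ge0 // addr_ge0.
  rewrite mulrC ler_wpM2r ?dual_gauss_ge0 //.
  by have := c1 x s; have := s1 x s; lra.
move=> h e; split; first exact: h.
rewrite [LHS]e.
apply: eq_Rintegral => s _; congr (_ * _); apply: eq_Rintegral => t _; congr (_ * _).
rewrite /Kf -dual_gauss_fourier; apply: eq_Rintegral => x _.
by rewrite -cosB dotvBl mulrBr.
Qed.

Lemma integrableRD (f g : V -> R) : integrable f -> integrable g -> integrable (fun x => f x + g x).
Proof. by move=> h1 h2; exact: (integrableD measurableT h1 h2). Qed.

(** For u1 + i u2 the square on the Fourier side contains a cross term mixing cosine and sine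
    transforms. It is odd in eta and the weight is even, so it integrates to 0; what remains is the
    sum of the two real identities. *)
Lemma plancherel_gauss u1 u2 : integrable u1 -> integrable u2 ->
  (\int[lam]_x (gauss_conv u1 x ^+ 2 + gauss_conv u2 x ^+ 2)%:E =
   \int[lam]_x (h0 x * ((cos_trans u1 x + sin_trans u2 x) ^+ 2 +
       (cos_trans u2 x - sin_trans u1 x) ^+ 2))%:E)%E.
Proof.
move=> i1 i2.
have [c1 e1] := gauss_conv_sqr i1; have [c2 e2] := gauss_conv_sqr i2.
have [t1 f1] := trans_sqr i1; have [t2 f2] := trans_sqr i2.
pose o x := h0 x * (2 * (cos_trans u1 x * sin_trans u2 x - cos_trans u2 x * sin_trans u1 x)).
pose S x := h0 x * (cos_trans u1 x ^+ 2 + sin_trans u1 x ^+ 2) + h0 x * (cos_trans u2 x ^+ 2 + sin_trans u2 x ^+ 2).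
have iS : integrable S by exact: integrableRD.
have mt (k : R -> R) u : measurable_fun setT k -> integrable u ->
   measurable_fun setT (fun eta => Rintegral lam setT (fun s => k (2 * pi * dotv (th s) eta) * u s)).
  move=> mk iu; apply: (@measurable_Rintegral_r _ _ _ lamL _ _ (fun p => k (2 * pi * dotv (th p.2) p.1) * u p.2)).
  apply: measurable_funM; first exact: (measurableT_comp mk mphase).
  by apply: measurableT_comp => //; exact: integrable_measurable iu.
have mc u : integrable u -> measurable_fun setT (cos_trans u) by apply: mt; exact: measurable_cos.
have ms u : integrable u -> measurable_fun setT (sin_trans u) by apply: mt; exact: measurable_sin.
have io : integrable o.
  apply: (integrable_le _ iS).
    apply: measurable_funM; first exact: measurable_dual_gauss.
    apply: measurable_funM; first exact: measurable_cst.
    apply: measurable_funB; first exact: measurable_funM (mc _ i1) (ms _ i2).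
    exact: measurable_funM (mc _ i2) (ms _ i1).
  move=> x; rewrite /o /S normrM (ger0_norm (dual_gauss_ge0 x)) -mulrDr ler_wpM2l ?dual_gauss_ge0 //.
  exact: ler_norm_cross.
have o0 : Rintegral lam setT o = 0.
  apply: Rintegral_odd => // x.
  have hE : h0 (vscale (-1) x) = h0 x by rewrite /dual_gauss gaussN.
  have cE u : cos_trans u (vscale (-1) x) = cos_trans u x.
    by apply: eq_Rintegral => s _; rewrite dotvZr mulN1r mulrN cosN.
  have sE u : integrable u -> sin_trans u (vscale (-1) x) = - sin_trans u x.
    move=> iu; rewrite -[RHS]mulN1r -RintegralZl; [|exact: measurableT|exact: integrable_sin].
    by apply: eq_Rintegral => s _; rewrite dotvZr mulN1r mulrN sinN mulN1r mulNr.
  by rewrite /o hE !cE !sE //; ring.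
transitivity (\int[lam]_x (S x + o x)%:E)%E; last first.
  by apply: eq_integral => x _; rewrite /S /o; congr EFin; ring.
rewrite -!RintegralK; [|exact: integrableRD|exact: integrableRD].
by rewrite !RintegralD // o0 addr0 f1 f2 e1 e2.
Qed.

End GaussianPlancherel.

(** Valid even for an indeterminate difference: a positive c fixes both infinities, so both sides
    take the same default value. *)
Lemma muleBrp (R : realType) (c : R) (x y : \bar R) : 0 < c ->
  (c%:E * (x - y) = c%:E * x - c%:E * y)%E.
Proof.
move=> c0.
have hy : (c%:E * +oo = +oo)%E by rewrite gt0_muley // lte_fin.
have hN : (c%:E * -oo = -oo)%E by rewrite gt0_muleNy // lte_fin.
case: x => [x||]; case: y => [y||]; rewrite ?hy ?hN //.
by rewrite -EFinB -!EFinM -EFinB mulrBr.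
Qed.

Lemma ler_normM_sqr (R : realDomainType) (p q : R) : `|p * q| <= p ^+ 2 + q ^+ 2.
Proof.
have h1 : 0 <= (p - q) ^+ 2 by exact: sqr_ge0.
have h2 : 0 <= (p + q) ^+ 2 by exact: sqr_ge0.
have h3 : 0 <= p ^+ 2 by exact: sqr_ge0.
have h4 : 0 <= q ^+ 2 by exact: sqr_ge0.
by rewrite ler_norml; apply/andP; split; lra.
Qed.

Section GaussianWindow.
Context (R : realType) (d : nat).
Local Notation V := (d.-tuple R).
Variable lam : {measure set V -> \bar R}.
Hypothesis lamL : is_lebesgue lam.
Local Notation integrable f := (lam.-integrable setT (EFin \o f)).

Lemma Rintegral_linear (M : 'M[R]_d) (h : V -> R) : M \in unitmx -> measurable_fun setT h ->
  Rintegral lam setT (fun x => h (mxapp M x)) = `|\det M|^-1 * Rintegral lam setT h.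
Proof.
move=> uM mh.
have mE : measurable_fun setT (fun x => (h x)%:E) by exact/measurable_EFinP.
have D0 : 0 < `|\det M|^-1 by rewrite invr_gt0 normr_gt0 -unitfE -unitmxE.
have e1 : (\int[lam]_x (h (mxapp M x))%:E = (`|\det M|^-1)%:E * \int[lam]_x (h x)%:E)%E.
  rewrite integralE [in RHS]integralE.
  have hp := integral_linear lamL uM (measurable_funepos mE) (fun x => funepos_ge0 _ x).
  have hn := integral_linear lamL uM (measurable_funeneg mE) (fun x => funeneg_ge0 _ x).
  rewrite muleBrp //.
  rewrite -hp -hn; congr (_ - _)%E.
    by apply: eq_integral => x _; rewrite !funeposE.
  by apply: eq_integral => x _; rewrite !funenegE.
rewrite /Rintegral e1.
case: (integral _ _ _) => [r||]; first by rewrite -EFinM.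
  by rewrite gt0_muley ?lte_fin // /= mulr0.
by rewrite gt0_muleNy ?lte_fin // /= mulr0.
Qed.

Variables (A : 'M[R]_d) (psi : V -> R[i]) (a : R) (omega : V) (j : int).
Hypotheses (uA : A \in unitmx) (hpsi : memL2 lam psi) (a0 : 0 < a).

Definition gabor (t : V) : R[i] :=
  (gauss a t)%:C%C * cexp (2 * pi * dotv t omega).

Definition dilate (s : V) : V := mxapp (mxpowz A j) s.
Local Notation th := dilate.

(* [demod_re] and [demod_im] are the real and imaginary parts of
   psi(s) exp(- 2 pi i (A^j s).omega). *)
Definition phase (s : V) : R := 2 * pi * dotv (th s) omega.
Definition demod_re (s : V) : R :=
  cos (phase s) * complex.Re (psi s) + sin (phase s) * complex.Im (psi s).
Definition demod_im (s : V) : R :=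
  cos (phase s) * complex.Im (psi s) - sin (phase s) * complex.Re (psi s).

Lemma measurable_dilate : measurable_fun setT th.
Proof. exact: measurable_mxapp. Qed.

Lemma measurable_phase : measurable_fun setT phase.
Proof.
apply: measurable_funM; first exact: measurable_cst.
by apply: measurable_dotv => //; exact: measurable_dilate.
Qed.

Lemma measurable_demod_re : measurable_fun setT demod_re.
Proof.
have [h1 h2 _] := hpsi.
apply: measurable_funD; apply: measurable_funM => //.
  exact: (measurableT_comp (@measurable_cos R) measurable_phase).
exact: (measurableT_comp (@measurable_sin R) measurable_phase).
Qed.

Lemma measurable_demod_im : measurable_fun setT demod_im.
Proof.
have [h1 h2 _] := hpsi.
apply: measurable_funB; apply: measurable_funM => //.
  exact: (measurableT_comp (@measurable_cos R) measurable_phase).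
exact: (measurableT_comp (@measurable_sin R) measurable_phase).
Qed.

Lemma demod_abs2 s : demod_re s ^+ 2 + demod_im s ^+ 2 = abs2 (psi s).
Proof.
rewrite /abs2; transitivity ((cos (phase s) ^+ 2 + sin (phase s) ^+ 2) * (complex.Re (psi s) ^+ 2 + complex.Im (psi s) ^+ 2)).
  by rewrite /demod_re /demod_im; ring.
by rewrite cos2Dsin2 mul1r.
Qed.

Lemma gabor_abs2 t : abs2 (gabor t) = gauss (2 * a) t.
Proof.
rewrite abs2M /abs2 /= expr0n addr0 cos2Dsin2 mulr1 -expRM_natl /gauss; congr expR.
by rewrite -mulr_natl; ring.
Qed.

Lemma gabor_memL2 : memL2 lam gabor.
Proof.
have mp : measurable_fun setT (fun t : V => 2 * pi * dotv t omega).
  by apply: measurable_funM; [exact: measurable_cst|exact: measurable_dotv].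
have mg : measurable_fun setT (@gauss R d a) by exact: (measurable_gauss _ (f := id)).
have [m1 m2] : cmeas gabor.
  apply: cmeasM; first by split => //=; exact: measurable_cst.
  split => /=; first exact: (measurableT_comp (@measurable_cos R) mp).
  exact: (measurableT_comp (@measurable_sin R) mp).
split => //.
under eq_integral do rewrite gabor_abs2.
by apply: integral_gauss_lty => //; rewrite mulr_gt0.
Qed.

Lemma gabor_l2norm2 : l2norm2 lam gabor = gauss_mass lam (2 * a).
Proof. by apply: eq_Rintegral => t _; rewrite gabor_abs2. Qed.

(** From |p q| <= p^2 + q^2: the square of a Gaussian is again an integrable Gaussian. *)
Lemma integrable_gauss_L2 (w : V -> R) (x : V) : measurable_fun setT w ->
  (forall s, w s ^+ 2 <= abs2 (psi s)) -> integrable (fun s => gauss a (vadd x (th s)) * w s).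
Proof.
move=> mw hw.
have mt : measurable_fun setT (fun s : V => vadd (th s) x).
  by apply: measurable_vadd => //; exact: measurable_dilate.
have i1 : integrable (fun s => gauss (2 * a) (vadd (th s) x)).
  apply: integrable_ge0 => [|s|]; [exact: measurable_gauss|exact: gauss_ge0|].
  have mg := @measurable_gaussE R d (2 * a).
  rewrite (integral_linear lamL (mxpowz_unit j uA) (f := fun s => (gauss (2 * a) (vadd s x))%:E)); last 2 first.
  - exact: (measurable_comp_vadd (f := fun s => (gauss (2 * a) s)%:E)).
  - by move=> s; rewrite lee_fin gauss_ge0.
  rewrite (integral_translate lamL x (f := fun s => (gauss (2 * a) s)%:E)) //; last first.
    by move=> s; rewrite lee_fin gauss_ge0.
  rewrite -RintegralK; last by apply: (integrable_gauss lamL); rewrite mulr_gt0.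
  by rewrite -EFinM ltry.
have i2 : integrable (fun s => abs2 (psi s)).
  apply: integrable_ge0; [exact: measurable_abs2 (memL2_cmeas hpsi)|by move=> s; exact: abs2_ge0|].
  by case: hpsi.
apply: (integrable_le _ (integrableRD i1 i2)).
  by apply: measurable_funM => //; apply: measurable_gauss; under eq_fun do rewrite vaddC.
move=> s; have e : gauss a (vadd x (th s)) ^+ 2 = gauss (2 * a) (vadd (th s) x).
  by rewrite -expRM_natl /gauss vaddC; congr expR; rewrite -mulr_natl; ring.
rewrite -e; apply: le_trans (lerD (lexx _) (hw s)).
exact: ler_normM_sqr.
Qed.

Let G u x := gauss_conv lam a th u x.

Lemma demod_re_le s : demod_re s ^+ 2 <= abs2 (psi s).
Proof. by rewrite -demod_abs2 lerDl sqr_ge0. Qed.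

Lemma demod_im_le s : demod_im s ^+ 2 <= abs2 (psi s).
Proof. by rewrite -demod_abs2 lerDr sqr_ge0. Qed.

Let detA0 : 0 < `|\det A|. Proof. by rewrite normr_gt0 -unitfE -unitmxE. Qed.

(** Substituting t = A^j s + x turns the coefficient into a Gaussian convolution of the demodulated
    psi. The Jacobian squared, the normalisation squared and the Haar weight multiply to 1. *)
Lemma wcoef_gabor x :
  abs2 (wcoef lam A psi gabor x j) * `|\det A| ^ (- j) = G demod_re x ^+ 2 + G demod_im x ^+ 2.
Proof.
set c := (Num.sqrt `|\det A|) ^ (- j).
set M := mxpowz A j.
have uM : M \in unitmx by exact: mxpowz_unit.
pose h t := gabor t * (qreg A x j psi t)^*%C.
have [mh1 mh2] : cmeas h.
  apply: cmeasM; first exact: memL2_cmeas gabor_memL2.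
  by apply: cmeasC; apply: cmeas_qreg; exact: memL2_cmeas hpsi.
(* The part of the modulation independent of s. It enters as the unimodular factor exp(i p0) and
   drops out of the squared modulus. *)
pose p0 := 2 * pi * dotv x omega.
have eh s : h (vadd (mxapp M s) x) =
   Complex (c * (cos p0 * (gauss a (vadd x (th s)) * demod_re s) + sin p0 * (gauss a (vadd x (th s)) * demod_im s)))
     (c * (sin p0 * (gauss a (vadd x (th s)) * demod_re s) - cos p0 * (gauss a (vadd x (th s)) * demod_im s))).
  rewrite /h /qreg vaddK -mxappM mxpowzN // mxapp1 /gabor dotvDl mulrDr -/(phase s) -/p0 vaddC -/(th s) -/c.
  rewrite /demod_re /demod_im /cexp addrC cosD sinD.
  case: (psi s) => u v /=.
  congr Complex; ring.
have change (k : V -> R) : measurable_fun setT k ->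
    Rintegral lam setT k = `|\det A| ^ j * Rintegral lam setT (fun s => k (vadd (mxapp M s) x)).
  move=> mk; rewrite -(Rintegral_translate lamL x mk).
  rewrite (Rintegral_linear (h := fun s => k (vadd s x)) uM).
    by rewrite det_mxpowz mulVKf // expfz_neq0 // gt_eqF.
  by apply: (measurableT_comp mk); exact: measurable_vadd.
have ir := integrable_gauss_L2 x measurable_demod_re demod_re_le.
have ii := integrable_gauss_L2 x measurable_demod_im demod_im_le.
have iZ := @integrableRZl R d lam.
have eR : Rintegral lam setT (fun t => complex.Re (h t)) =
    `|\det A| ^ j * (c * (cos p0 * G demod_re x + sin p0 * G demod_im x)).
  rewrite change //; congr (_ * _); under eq_Rintegral do rewrite eh /=.
  rewrite RintegralZl //; last by apply: integrableRD; exact: iZ.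
  rewrite RintegralD //; [|exact: iZ|exact: iZ].
  by rewrite !RintegralZl.
have eI : Rintegral lam setT (fun t => complex.Im (h t)) =
    `|\det A| ^ j * (c * (sin p0 * G demod_re x - cos p0 * G demod_im x)).
  rewrite change //; congr (_ * _); under eq_Rintegral do rewrite eh /= -mulNr.
  rewrite RintegralZl //; last by apply: integrableRD; exact: iZ.
  rewrite RintegralD //; [|exact: iZ|exact: iZ].
  by rewrite !RintegralZl // mulNr.
rewrite /wcoef /ip /cint -/h /abs2 eR eI.
have c2 : c ^+ 2 = `|\det A| ^ (- j).
  by rewrite /c expr2 -exprzMl ?unitfE ?gt_eqF ?sqrtr_gt0 // -expr2 sqr_sqrtr.
have dj : `|\det A| ^ j * `|\det A| ^ (- j) = 1.
  by rewrite -expfzDr ?subrr // gt_eqF.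
set D := `|\det A| ^ j in dj *.
have := cos2Dsin2 p0; rewrite /=; move: (cos p0) (sin p0) (G _ _) (G _ _) => C S u v hCS.
transitivity ((D * `|\det A| ^ (- j)) * (D * c ^+ 2) * (C ^+ 2 + S ^+ 2) * (u ^+ 2 + v ^+ 2)).
  by ring.
by rewrite c2 dj hCS !mul1r addrC.
Qed.

End GaussianWindow.

(** Stands in for the triangle inequality of a norm when only squared norms are at hand: the
    relative error eps is fixed first, then n is taken so large that (1 + 1/eps) e n is
    negligible. *)
Lemma lee_eps_chain (R : realType) (a b : \bar R) (x e : nat -> \bar R) :
  (0 <= b < +oo)%E -> (forall n, 0 <= e n)%E -> e @ \oo --> 0%E ->
  (forall eps n, 0 < eps -> (a <= (1 + eps)%:E * x n + (1 + eps^-1)%:E * e n)%E) ->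
  (forall eps n, 0 < eps -> (x n <= (1 + eps)%:E * b + (1 + eps^-1)%:E * e n)%E) ->
  (a <= b)%E.
Proof.
case: b => [b||] // /andP[b0 //] _ e0 ecvg h1 h2.
rewrite lee_fin in b0.
apply/lee_addgt0Pr => delta delta0.
pose eps := Num.min 1 (delta / (8 * (b + 1))).
have b1 : 0 < b + 1 by lra.
have eps0 : 0 < eps by rewrite lt_min ltr01 divr_gt0 // mulr_gt0.
have eps1 : eps <= 1 by rewrite ge_min lexx.
have epsb : eps * (b + 1) <= delta / 8.
  have : eps <= delta / (8 * (b + 1)) by rewrite ge_min lexx orbT.
  rewrite -(ler_pM2r b1) => /le_trans; apply; rewrite le_eqVlt; apply/orP; left; apply/eqP; field.
  by rewrite gt_eqF.
pose k := 1 + eps^-1.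
have k0 : 0 < k by rewrite addr_gt0 // invr_gt0.
pose eta := delta / (8 * k).
have eta0 : 0 < eta by rewrite divr_gt0 // mulr_gt0.
have [n hn] : exists n, (e n <= eta%:E)%E.
  have /fine_cvgP[fe ce] := ecvg.
  have /cvgrPdist_le/(_ _ eta0) ce' := ce.
  near \oo => n; exists n.
  have h : `|0 - fine (e n)| <= eta by near: n.
  have f : e n \is a fin_num by near: n.
  by rewrite -(fineK f) lee_fin; apply: le_trans h; rewrite sub0r normrN ler_norm.
have keta : k * eta = delta / 8 by rewrite /eta; field; rewrite gt_eqF.
have hx : (x n <= ((1 + eps) * b + delta / 8)%:E)%E.
  apply: le_trans (h2 eps n eps0) _; rewrite [leRHS]EFinD; apply: leeD; first by rewrite EFinM.
  by rewrite -keta EFinM lee_wpmul2l // lee_fin ltW.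
apply: le_trans (h1 eps n eps0) _.
apply: (@le_trans _ _ (((1 + eps) * ((1 + eps) * b + delta / 8))%:E + (delta / 8)%:E)%E).
  apply: leeD; first by rewrite EFinM lee_wpmul2l // lee_fin; lra.
  by rewrite -keta EFinM lee_wpmul2l // lee_fin ltW.
rewrite -!EFinD lee_fin.
have : eps * eps <= eps by rewrite ler_piMr // ltW.
have : 0 <= (1 - eps) * eps * b by rewrite !mulr_ge0 ?subr_ge0 // ltW.
have : eps * delta <= delta by rewrite ler_piMl // ltW.
clear -epsb b0 delta0 eps0; move: (delta) (eps) (b) epsb b0 delta0 eps0 => D E B *; lra.
Unshelve. all: by end_near. Qed.

(** The difference of the two sides is the square eps (y - (x - y)/eps)^2. *)
Lemma ler_sqrD_eps (R : realFieldType) (eps x y : R) : 0 < eps ->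
  x ^+ 2 <= (1 + eps) * y ^+ 2 + (1 + eps^-1) * (x - y) ^+ 2.
Proof.
move=> e0.
have h : 0 <= eps * (y - eps^-1 * (x - y)) ^+ 2 by rewrite mulr_ge0 ?sqr_ge0 // ltW.
rewrite -subr_ge0; apply: le_trans h _; rewrite le_eqVlt; apply/orP; left; apply/eqP; field.
by rewrite gt_eqF.
Qed.

(** * Passing an isometry to weighted L2 limits *)

Section L2Limit.
Context (R : realType) (d : nat).
Local Notation T := (d.-tuple R).
Variable mu : {measure set T -> \bar R}.

Definition wnorm2 (rho u v : T -> R) : \bar R :=
  (\int[mu]_x (rho x * (u x ^+ 2 + v x ^+ 2))%:E)%E.

Lemma wnorm2_ge0 (rho u v : T -> R) : (forall x, 0 <= rho x) -> (0 <= wnorm2 rho u v)%E.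
Proof.
by move=> r0; apply: integral_ge0 => x _; rewrite lee_fin mulr_ge0 // addr_ge0 // sqr_ge0.
Qed.

Lemma measurable_wnorm2 (rho u v : T -> R) : measurable_fun setT rho ->
  measurable_fun setT u -> measurable_fun setT v ->
  measurable_fun setT (fun x => (rho x * (u x ^+ 2 + v x ^+ 2))%:E).
Proof.
move=> mr mu' mv; apply/measurable_EFinP; apply: measurable_funM => //.
by apply: measurable_funD; apply: measurable_funX.
Qed.

Lemma wnorm2_le_eps (rho u v u' v' : T -> R) (eps : R) : (forall x, 0 <= rho x) -> 0 < eps ->
  measurable_fun setT rho -> measurable_fun setT u -> measurable_fun setT v ->
  measurable_fun setT u' -> measurable_fun setT v' ->
  (wnorm2 rho u v <= (1 + eps)%:E * wnorm2 rho u' v' +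
    (1 + eps^-1)%:E * wnorm2 rho (fun x => (u x - u' x)%R) (fun x => (v x - v' x)%R))%E.
Proof.
move=> r0 e0 mr mu1 mv1 mu2 mv2.
have e1 : 0 <= 1 + eps by rewrite addr_ge0 // ltW.
have e2 : 0 <= 1 + eps^-1 by rewrite addr_ge0 // invr_ge0 ltW.
have m1 := measurable_wnorm2 mr mu2 mv2.
have m2 := measurable_wnorm2 mr (measurable_funB mu1 mu2) (measurable_funB mv1 mv2).
have p1 (f g : T -> R) x : (0 <= (rho x * (f x ^+ 2 + g x ^+ 2))%:E)%E.
  by rewrite lee_fin mulr_ge0 // addr_ge0 // sqr_ge0.
have Z (f : T -> \bar R) (c : R) : measurable_fun setT f -> (forall x, 0 <= f x)%E -> 0 <= c ->
    (c%:E * \int[mu]_x f x = \int[mu]_x (c%:E * f x))%E.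
  by move=> mf f0 c0; rewrite ge0_integralZl.
rewrite /wnorm2 (Z _ _ m1 (p1 _ _) e1) (Z _ _ m2 (p1 _ _) e2).
rewrite -ge0_integralD //; last 4 first.
- by move=> x _; apply: mule_ge0 => //; rewrite lee_fin.
- exact: measurable_funeM.
- by move=> x _; apply: mule_ge0 => //; rewrite lee_fin.
- exact: measurable_funeM.
apply: ge0_le_integralT => x; first exact: p1.
rewrite -!EFinM -EFinD lee_fin /= [leRHS](_ : _ = rho x * (((1 + eps) * u' x ^+ 2 + (1 + eps^-1) * (u x - u' x) ^+ 2) + ((1 + eps) * v' x ^+ 2 + (1 + eps^-1) * (v x - v' x) ^+ 2))); last by ring.
by rewrite ler_wpM2l // lerD // ler_sqrD_eps.
Qed.

Lemma fatou_le (f : nat -> T -> \bar R) (g : T -> \bar R) (c : \bar R) :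
  (forall n, measurable_fun setT (f n)) -> (forall n x, 0 <= f n x)%E ->
  (forall x, f ^~ x @ \oo --> g x) ->
  (exists N, forall n, (N <= n)%N -> (\int[mu]_x f n x <= c)%E) ->
  (\int[mu]_x g x <= c)%E.
Proof.
move=> mf f0 fg [N hN].
have := fatou mu measurableT mf (fun n x _ => f0 n x).
rewrite [X in (X <= _)%E](_ : _ = (\int[mu]_x g x)%E); last first.
  by apply: eq_integral => x _; have [] := cvg_limn_einf_sup (fg x).
move=> /le_trans; apply; rewrite limn_einf_lim.
apply: lime_le; first exact: is_cvg_einfs.
near=> n; apply: ge_ereal_inf; exists (\int[mu]_x f n x)%E; last by apply: hN; near: n; exists N.
by exists n => //=.
Unshelve. all: by end_near. Qed.

Variables (rho rho' : T -> R) (p q r s : nat -> T -> R) (p0 q0 r0 s0 : T -> R).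
Hypotheses (mrho : measurable_fun setT rho) (mrho' : measurable_fun setT rho').
Hypotheses (rho0 : forall x, 0 <= rho x) (rho'0 : forall x, 0 <= rho' x).
Hypotheses (mp : forall n, measurable_fun setT (p n)) (mq : forall n, measurable_fun setT (q n)).
Hypotheses (mr : forall n, measurable_fun setT (r n)) (ms : forall n, measurable_fun setT (s n)).
Hypotheses (mp0 : measurable_fun setT p0) (mq0 : measurable_fun setT q0).
Hypotheses (mr0 : measurable_fun setT r0) (ms0 : measurable_fun setT s0).
Hypotheses (cp : forall x, p ^~ x @ \oo --> p0 x) (cq : forall x, q ^~ x @ \oo --> q0 x).
Hypothesis iso : forall n, wnorm2 rho (p n) (q n) = wnorm2 rho' (r n) (s n).
Hypothesis isoB : forall m n,
  wnorm2 rho (fun x => (p m x - p n x)%R) (fun x => (q m x - q n x)%R) =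
  wnorm2 rho' (fun x => (r m x - r n x)%R) (fun x => (s m x - s n x)%R).
Local Notation e n := (wnorm2 rho' (fun x => (r0 x - r n x)%R) (fun x => (s0 x - s n x)%R)).
Hypothesis e0 : (fun n => e n) @ \oo --> (0 : \bar R).
Hypothesis fin : (wnorm2 rho' r0 s0 < +oo)%E.

Let wnorm2C ro u v u' v' : wnorm2 ro (fun x => (u x - u' x)%R) (fun x => (v x - v' x)%R) =
  wnorm2 ro (fun x => (u' x - u x)%R) (fun x => (v' x - v x)%R).
Proof. by apply: eq_integral => x _; congr EFin; ring. Qed.

Let small (eta : R) : 0 < eta -> exists N, forall n, (N <= n)%N -> (e n <= eta%:E)%E.
Proof.
move=> eta0.
have /fine_cvgP[fe ce] := e0.
have /cvgrPdist_le/(_ _ eta0) ce' := ce.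
have [N _ hN] : \forall n \near \oo, (e n <= eta%:E)%E.
  near=> n.
  have h : `|0 - fine (e n)| <= eta by near: n.
  have f : e n \is a fin_num by near: n.
  by rewrite -(fineK f) lee_fin; apply: le_trans h; rewrite sub0r normrN ler_norm.
by exists N.
Unshelve. all: by end_near. Qed.

(** On the left only pointwise convergence is given. The isometry makes the left sequence Cauchy in
    squared norm, and Fatou in m turns this into a distance to the pointwise limit. *)
Lemma wnorm2_tail n :
  (wnorm2 rho (fun x => (p0 x - p n x)%R) (fun x => (q0 x - q n x)%R) <= 4%:E * e n)%E.
Proof.
apply/lee_addgt0Pr => delta delta0.
have [N hN] := @small (delta / 4) ltac:(by rewrite divr_gt0).
apply: (@fatou_le (fun m x => (rho x * ((p m x - p n x) ^+ 2 + (q m x - q n x) ^+ 2))%:E)).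
- by move=> m; apply: measurable_wnorm2 => //; exact: measurable_funB.
- by move=> m x; rewrite lee_fin mulr_ge0 // addr_ge0 // sqr_ge0.
- move=> x; apply: cvg_EFin; first exact: nearW.
  apply: cvgM; first exact: cvg_cst.
  by apply: cvgD; apply: cvgM; apply: cvgB => //; exact: cvg_cst.
exists N => m hm.
rewrite -/(wnorm2 rho (fun x => (p m x - p n x)%R) (fun x => (q m x - q n x)%R)) isoB.
(* With eps = 1 the squared distance between terms m and n is at most 2 e n + 2 e m; the second
   summand is absorbed by delta for large m. *)
have h := @wnorm2_le_eps rho' (fun x => (r m x - r n x)%R) (fun x => (s m x - s n x)%R)
  (fun x => (r0 x - r n x)%R) (fun x => (s0 x - s n x)%R) 1 rho'0 ltr01 mrho'
  (measurable_funB (mr m) (mr n)) (measurable_funB (ms m) (ms n))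
  (measurable_funB mr0 (mr n)) (measurable_funB ms0 (ms n)).
apply: le_trans h _; rewrite invr1 (_ : 1 + 1 = 2) //.
apply: leeD.
  by apply: lee_wpmul2r; [exact: wnorm2_ge0|rewrite lee_fin; lra].
rewrite (_ : wnorm2 _ _ _ = e m).
  apply: (@le_trans _ _ (2%:E * (delta / 4)%:E)%E); first by rewrite lee_wpmul2l // ?lee_fin // hN.
  by rewrite -EFinM lee_fin; lra.
by apply: eq_integral => x _; congr EFin; ring.
Qed.

(** Each inequality compares both limits with the n-th terms, where the isometry holds. The first
    one also supplies the finiteness needed for the second. *)
Lemma wnorm2_limit : wnorm2 rho p0 q0 = wnorm2 rho' r0 s0.
Proof.
pose e4 n := (4%:E * e n)%E.
have e4_ge0 n : (0 <= e4 n)%E by rewrite mule_ge0 ?wnorm2_ge0.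
have e4_0 : e4 @ \oo --> 0%E.
  by rewrite -(mule0 4%:E); apply: cvgeZl.
have le4 n : (e n <= e4 n)%E.
  by rewrite -[leLHS]mul1e; apply: lee_wpmul2r; [exact: wnorm2_ge0|rewrite lee_fin; lra].
have k0 (eps : R) : 0 < eps -> (0 <= (1 + eps^-1)%:E)%E.
  by move=> h; rewrite lee_fin addr_ge0 // invr_ge0 ltW.
have A1 eps n : 0 < eps -> (wnorm2 rho p0 q0 <= (1 + eps)%:E * wnorm2 rho (p n) (q n) + (1 + eps^-1)%:E * e4 n)%E.
  move=> h; apply: le_trans (wnorm2_le_eps rho0 h mrho mp0 mq0 (mp n) (mq n)) _.
  by apply: leeD => //; apply: lee_wpmul2l; [exact: k0|exact: wnorm2_tail].
have A2 eps n : 0 < eps -> (wnorm2 rho (p n) (q n) <= (1 + eps)%:E * wnorm2 rho p0 q0 + (1 + eps^-1)%:E * e4 n)%E.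
  move=> h; apply: le_trans (wnorm2_le_eps rho0 h mrho (mp n) (mq n) mp0 mq0) _.
  by apply: leeD => //; apply: lee_wpmul2l; [exact: k0|rewrite wnorm2C; exact: wnorm2_tail].
have B1 eps n : 0 < eps -> (wnorm2 rho (p n) (q n) <= (1 + eps)%:E * wnorm2 rho' r0 s0 + (1 + eps^-1)%:E * e4 n)%E.
  move=> h; rewrite iso; apply: le_trans (wnorm2_le_eps rho'0 h mrho' (mr n) (ms n) mr0 ms0) _.
  by apply: leeD => //; apply: lee_wpmul2l; [exact: k0|rewrite wnorm2C; exact: le4].
have B2 eps n : 0 < eps -> (wnorm2 rho' r0 s0 <= (1 + eps)%:E * wnorm2 rho (p n) (q n) + (1 + eps^-1)%:E * e4 n)%E.
  move=> h; rewrite iso; apply: le_trans (wnorm2_le_eps rho'0 h mrho' mr0 ms0 (mr n) (ms n)) _.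
  by apply: leeD => //; apply: lee_wpmul2l; [exact: k0|exact: le4].
have le1 : (wnorm2 rho p0 q0 <= wnorm2 rho' r0 s0)%E.
  apply: (lee_eps_chain _ e4_ge0 e4_0 A1 B1).
  by rewrite wnorm2_ge0.
apply/eqP; rewrite eq_le le1 /=.
apply: (lee_eps_chain _ e4_ge0 e4_0 B2 A2).
by rewrite wnorm2_ge0 //= (le_lt_trans le1).
Qed.

End L2Limit.

(** * Truncated Fourier transforms and the Gabor coefficients *)

Section TruncatedFourier.
Context (R : realType) (d : nat).
Local Notation V := (d.-tuple R).
Variable lam : {measure set V -> \bar R}.
Hypothesis lamL : is_lebesgue lam.
Local Notation integrable f := (lam.-integrable setT (EFin \o f)).

Definition ball_inf (N : nat) : set V := [set x | forall i, `|tnth x i| <= N%:R].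

Lemma measurable_ball_inf N : measurable (ball_inf N).
Proof.
rewrite (_ : ball_inf N = \bigcap_(i in [set: 'I_d]) [set x : V | `[- N%:R, N%:R]%classic (tnth x i)]).
  by apply: fin_bigcap_measurable => // i _; exact: measurable_slab.
apply/seteqP; split => [x h i _|x h i]; first by rewrite /= in_itv /= -ler_norml.
by have := h i I; rewrite /= in_itv /= -ler_norml.
Qed.

Lemma lam_ball_inf N : (lam (ball_inf N) < +oo)%E.
Proof.
apply: (@le_lt_trans _ _ (lam (cube N.+1%:R))); last by rewrite (lam_cube lamL) // ltry.
apply: le_measure; [apply/mem_set; exact: measurable_ball_inf|apply/mem_set; exact: cube_measurable|].
move=> x h i; have := h i; rewrite !tnth_cvec ler_norml => /andP[h1 h2].
have h3 : (N%:R : R) < N.+1%:R by rewrite ltr_nat.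
by rewrite (le_lt_trans h2 h3) andbT (le_trans _ h1) // lerN2 ltW.
Qed.

(** Cuts to the domain of integration of [fourier_trunc], where square-integrable functions are
    integrable. *)
Definition trunc (N : nat) (u : V -> R) (s : V) : R := \1_(ball_inf N) s * u s.

Lemma trunc_norm_le N u s : `|trunc N u s| <= `|u s|.
Proof.
rewrite /trunc indicE; case: (_ \in _); first by rewrite mul1r.
by rewrite mul0r normr0.
Qed.

Lemma measurable_trunc N u : measurable_fun setT u -> measurable_fun setT (trunc N u).
Proof.
by move=> mu; apply: measurable_funM => //; apply: measurable_indic; exact: measurable_ball_inf.
Qed.

Lemma Rintegral_indicM (D : set V) (u : V -> R) :
  Rintegral lam D u = Rintegral lam setT (fun s => \1_D s * u s).
Proof.
rewrite Rintegral_mkcond; apply: eq_Rintegral => s _.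
by rewrite /patch indicE; case: (_ \in _); rewrite ?mul1r ?mul0r.
Qed.

Lemma trunc_cvg (u : V -> R) s : trunc ^~ u ^~ s @ \oo --> u s.
Proof.
have [k hk] := @box_cover R d s.
have e : \forall n \near \oo, u s = trunc n u s.
  exists k => // n /= kn; rewrite /trunc indicE mem_set ?mul1r //.
  move=> i; have := hk i; rewrite !tnth_cvec => /andP[h1 h2].
  apply: (@le_trans _ _ k%:R); last by rewrite ler_nat.
  by rewrite ler_norml h1 ltW.
by apply: cvg_trans (near_eq_cvg e) _; exact: cvg_cst.
Qed.

Lemma integrable_trunc N (u v : V -> R) : measurable_fun setT u -> integrable v ->
  (forall s, u s ^+ 2 <= v s) -> integrable (trunc N u).
Proof.
move=> mu iv uv.
have i1 : integrable (\1_(ball_inf N)).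
  apply: integrable_ge0; first by apply: measurable_indic; exact: measurable_ball_inf.
    by move=> x; rewrite indicE.
  by rewrite (integral_ind _ (measurable_ball_inf N)); exact: lam_ball_inf.
apply: (integrable_le _ (integrableRD i1 iv)); first exact: measurable_trunc.
move=> s; rewrite /trunc; apply: le_trans (ler_normM_sqr _ _) _; apply: lerD => //.
by rewrite indicE; case: (_ \in _); rewrite ?expr1n ?expr0n.
Qed.

Variables (A : 'M[R]_d) (psi F : V -> R[i]) (a : R) (omega : V) (j : int).
Hypotheses (uA : A \in unitmx) (hpsi : memL2 lam psi) (a0 : 0 < a).
Hypothesis hF : is_fourierL2 lam psi F.

Local Notation th := (dilate A j).
Local Notation wr := (demod_re A psi omega j).
Local Notation wi := (demod_im A psi omega j).
Local Notation h0 := (dual_gauss lam a).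
Local Notation B := (mxpowz A^T j).
Local Notation pt eta := (mxapp (mxpowz A^T j) (vadd eta omega)).

Let mth : measurable_fun setT th. Proof. exact: measurable_dilate. Qed.
Let uB : B \in unitmx. Proof. by rewrite mxpowz_unit // unitmx_tr. Qed.

Let ipsi : integrable (fun s => abs2 (psi s)).
Proof.
apply: integrable_ge0; [exact: measurable_abs2 (memL2_cmeas hpsi)|by move=> s; exact: abs2_ge0|].
by case: hpsi.
Qed.

Let itr N : integrable (trunc N wr).
Proof.
apply: (integrable_trunc _ _ ipsi); first exact: (measurable_demod_re A omega j hpsi).
by move=> s; exact: demod_re_le.
Qed.

Let iti N : integrable (trunc N wi).
Proof.
apply: (integrable_trunc _ _ ipsi); first exact: (measurable_demod_im A omega j hpsi).
by move=> s; exact: demod_im_le.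
Qed.

(** Moving A^j across the scalar product: dilation in space becomes the transposed dilation in
    frequency. *)
Lemma dotv_pt s eta : dotv s (pt eta) = dotv (th s) (vadd eta omega).
Proof. by rewrite /dilate mxpowz_tr mxapp_tr. Qed.

Lemma fourier_trunc_pt N eta : fourier_trunc lam psi N (pt eta) =
  Complex (cos_trans lam th (trunc N wr) eta + sin_trans lam th (trunc N wi) eta)
          (cos_trans lam th (trunc N wi) eta - sin_trans lam th (trunc N wr) eta).
Proof.
have e s : psi s * cexp (- (2 * pi * dotv s (pt eta))) =
  Complex (cos (2 * pi * dotv (th s) eta) * wr s + sin (2 * pi * dotv (th s) eta) * wi s)
    (cos (2 * pi * dotv (th s) eta) * wi s - sin (2 * pi * dotv (th s) eta) * wr s).
  rewrite dotv_pt dotvDr mulrDr -/(phase A omega j s) /demod_re /demod_im /cexp cosN sinN cosD sinD.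
  by case: (psi s) => u v /=; congr Complex; ring.
rewrite /fourier_trunc /cint -/(ball_inf N); congr Complex.
  rewrite Rintegral_indicM /cos_trans /sin_trans -RintegralD //; [|exact: integrable_cos|exact: integrable_sin].
  by apply: eq_Rintegral => s _; rewrite e /trunc /=; ring.
rewrite Rintegral_indicM /cos_trans /sin_trans -RintegralB //; [|exact: integrable_cos|exact: integrable_sin].
by apply: eq_Rintegral => s _; rewrite e /trunc /=; ring.
Qed.

Lemma cmeas_fourier_trunc N : cmeas (fourier_trunc lam psi N).
Proof.
have mp := memL2_cmeas hpsi.
have m1 : measurable_fun setT (fun p : V * V => - (2 * pi * dotv p.2 p.1)).
  by apply: measurable_funN; apply: measurable_funM; [exact: measurable_cst|exact: measurable_dotv].
have [mk1 mk2] : cmeas (fun p : V * V => psi p.2 * cexp (- (2 * pi * dotv p.2 p.1))).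
  apply: cmeasM; first exact: (cmeas_comp mp).
  split => /=; first exact: (measurableT_comp (@measurable_cos R) m1).
  exact: (measurableT_comp (@measurable_sin R) m1).
have mi : measurable_fun setT (fun p : V * V => \1_(ball_inf N) p.2 : R).
  by apply: (measurableT_comp _ measurable_snd); apply: measurable_indic; exact: measurable_ball_inf.
split.
  rewrite /fourier_trunc /cint /= -/(ball_inf N).
  under eq_fun do rewrite Rintegral_indicM.
  exact: (measurable_Rintegral_r lamL (measurable_funM mi mk1)).
rewrite /fourier_trunc /cint /= -/(ball_inf N).
under eq_fun do rewrite Rintegral_indicM.
exact: (measurable_Rintegral_r lamL (measurable_funM mi mk2)).
Qed.

Let K := gauss_mass lam (2 * a) / gauss_mass lam (dual_width a).

(** The weight is bounded by K, so L2 convergence of the truncated transforms survives the weight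
    and the affine change of variable eta -> [pt eta]. *)
Lemma dual_gauss_affine_le (H : V -> R[i]) : cmeas H ->
  (\int[lam]_eta (h0 eta * abs2 (H (pt eta)))%:E <=
   (K * `|\det B|^-1)%:E * \int[lam]_xi (abs2 (H xi))%:E)%E.
Proof.
move=> mH; have mE := measurable_abs2E mH.
have aE0 xi : (0 <= (abs2 (H xi))%:E)%E by rewrite lee_fin abs2_ge0.
have b0 := dual_width_gt0 a0.
have K0 : 0 <= K by rewrite divr_ge0 // ltW // gauss_mass_gt0 // mulr_gt0.
rewrite EFinM -muleA -(integral_linear lamL uB mE aE0).
rewrite -(integral_translate lamL omega (f := fun x => (abs2 (H (mxapp B x)))%:E)) //; last exact: (measurable_comp_mx B mE).
rewrite -ge0_integralZl //; last first.
  by apply: (measurable_comp_vadd (f := fun x => (abs2 (H (mxapp B x)))%:E)); exact: (measurable_comp_mx B mE).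
apply: ge0_le_integralT => x.
  by rewrite lee_fin mulr_ge0 ?abs2_ge0 //; exact: dual_gauss_ge0.
rewrite -EFinM lee_fin ler_wpM2r ?abs2_ge0 // /dual_gauss -/K ler_piMr //.
by apply: gauss_le1; exact: ltW.
Qed.

Let G u x := gauss_conv lam a th u x.

Let mgk : measurable_fun setT (fun p : V * V => gauss a (vadd p.1 (th p.2))).
Proof. by apply: measurable_gauss; apply: measurable_vadd => //; exact: measurableT_comp. Qed.

Lemma measurable_gauss_conv (u : V -> R) : measurable_fun setT u -> measurable_fun setT (G u).
Proof.
move=> mu; apply: (measurable_Rintegral_r lamL (f := fun p => gauss a (vadd p.1 (th p.2)) * u p.2)).
by apply: measurable_funM => //; exact: measurableT_comp.
Qed.

Lemma gauss_convB (u v : V -> R) x : integrable u -> integrable v ->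
  G (fun s => u s - v s) x = G u x - G v x.
Proof.
have h w : integrable w -> integrable (fun s => gauss a (vadd x (th s)) * w s).
  move=> iw; apply: (integrable_le _ (integrable_norm iw)).
    apply: measurable_funM; last exact: (integrable_measurable iw).
    by apply: measurable_gauss; exact: measurable_vadd.
  by move=> s; rewrite normrM ler_piMl // ger0_norm ?gauss_ge0 // gauss_le1 // ltW.
move=> iu iv; rewrite /G /gauss_conv -RintegralB //; [|exact: h|exact: h].
by apply: eq_Rintegral => s _; rewrite mulrBr.
Qed.

Lemma gauss_conv_cvg (u : V -> R) x : measurable_fun setT u ->
  (forall s, u s ^+ 2 <= abs2 (psi s)) -> (fun n => G (trunc n u) x) @ \oo --> G u x.
Proof.
move=> mu uv.
have iu := integrable_gauss_L2 lamL j uA hpsi a0 x mu uv.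
have mgx : measurable_fun setT (fun s => gauss a (vadd x (th s))).
  by apply: measurable_gauss; exact: measurable_vadd.
have mt n : measurable_fun setT (fun s => gauss a (vadd x (th s)) * trunc n u s).
  by apply: measurable_funM => //; exact: measurable_trunc.
have h : (\int[lam]_s (gauss a (vadd x (th s)) * trunc n u s)%:E @[n --> \oo] -->
    \int[lam]_s (gauss a (vadd x (th s)) * u s)%:E)%E.
  apply: (@dominated_cvg _ _ _ lam setT measurableT
    (fun n s => (gauss a (vadd x (th s)) * trunc n u s)%:E)
    (fun s => (gauss a (vadd x (th s)) * u s)%:E)
    (fun s => (`|gauss a (vadd x (th s)) * u s|)%:E)).
  - by move=> n; apply/measurable_EFinP; exact: mt.
  - move=> s _; apply: cvg_EFin; first exact: nearW.
    by apply: cvgM; [exact: cvg_cst|exact: trunc_cvg].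
  - by [].
  - exact: (integrable_norm iu).
  - move=> n s _; rewrite /= lee_fin !normrM; apply: ler_wpM2l; first exact: normr_ge0.
    by rewrite -normrM; exact: (trunc_norm_le n u s).
rewrite /G /gauss_conv /Rintegral; apply: fine_cvg; rewrite fineK //.
exact: (integrable_fin_num measurableT iu).
Qed.

Lemma wnorm2_dual (H : V -> R[i]) :
  wnorm2 lam h0 (fun eta => complex.Re (H (pt eta))) (fun eta => complex.Im (H (pt eta))) =
  (\int[lam]_eta (h0 eta * abs2 (H (pt eta)))%:E)%E.
Proof. by []. Qed.

Lemma wnorm2_cst1 (u v : V -> R) :
  wnorm2 lam (cst 1) u v = (\int[lam]_x (u x ^+ 2 + v x ^+ 2)%:E)%E.
Proof. by apply: eq_integral => x _; rewrite mul1r. Qed.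

(** The integrable case applies to truncations of psi and to their differences. As N grows, the
    convolutions converge pointwise and the truncated transforms converge to F in L2, exactly the
    situation of [wnorm2_limit]. *)
Lemma plancherel_gabor :
  (\int[lam]_x (abs2 (wcoef lam A psi (gabor a omega) x j) * `|\det A| ^ (- j))%:E =
   \int[lam]_eta (h0 eta * abs2 (F (pt eta)))%:E)%E.
Proof.
have [mF cF] := hF; have mF' := memL2_cmeas mF.
have mpt : measurable_fun setT (fun eta : V => pt eta).
  by apply: measurable_mxapp; exact: measurable_vadd.
have mwr := measurable_demod_re A omega j hpsi.
have mwi := measurable_demod_im A omega j hpsi.
have FE N eta := fourier_trunc_pt N eta.
transitivity (wnorm2 lam (cst 1) (G wr) (G wi)).
  by rewrite wnorm2_cst1; apply: eq_integral => x _; rewrite wcoef_gabor.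
rewrite -wnorm2_dual.
have [mFr mFi] := cmeas_comp mF' mpt.
have mN N : cmeas (fun eta : V => fourier_trunc lam psi N (pt eta)).
  exact: cmeas_comp (cmeas_fourier_trunc N) mpt.
have iB (u v : V -> R) : integrable u -> integrable v -> integrable (fun s => u s - v s).
  by move=> h1 h2; exact: (integrableB measurableT h1 h2).
have h00 := @dual_gauss_ge0 _ _ _ lamL a a0.
have transB (k : R -> R) u v eta :
    integrable (fun s => k (2 * pi * dotv (th s) eta) * u s) ->
    integrable (fun s => k (2 * pi * dotv (th s) eta) * v s) ->
    Rintegral lam setT (fun s => k (2 * pi * dotv (th s) eta) * (u s - v s)) =
    Rintegral lam setT (fun s => k (2 * pi * dotv (th s) eta) * u s) -
    Rintegral lam setT (fun s => k (2 * pi * dotv (th s) eta) * v s).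
  move=> h1 h2; rewrite -RintegralB //.
  by apply: eq_Rintegral => s _; rewrite mulrBr.
apply: (@wnorm2_limit R d lam (cst 1) h0
  (fun n => G (trunc n wr)) (fun n => G (trunc n wi))
  (fun n eta => complex.Re (fourier_trunc lam psi n (pt eta)))
  (fun n eta => complex.Im (fourier_trunc lam psi n (pt eta)))
  (G wr) (G wi) _ _ (measurable_cst _) (measurable_dual_gauss lam a) (fun=> ler01) h00).
- by move=> n; apply: measurable_gauss_conv; exact: measurable_trunc.
- by move=> n; apply: measurable_gauss_conv; exact: measurable_trunc.
- by move=> n; case: (mN n).
- by move=> n; case: (mN n).
- exact: measurable_gauss_conv.
- exact: measurable_gauss_conv.
- exact: mFr.
- exact: mFi.
- by move=> x; apply: gauss_conv_cvg => // s; exact: demod_re_le.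
- by move=> x; apply: gauss_conv_cvg => // s; exact: demod_im_le.
- move=> n; rewrite wnorm2_cst1 (plancherel_gauss lamL a0 mth (itr n) (iti n)).
  by apply: eq_integral => eta _; rewrite FE.
- move=> m n; rewrite wnorm2_cst1.
  transitivity (\int[lam]_x (gauss_conv lam a th (fun s => trunc m wr s - trunc n wr s)%R x ^+ 2 +
     gauss_conv lam a th (fun s => trunc m wi s - trunc n wi s)%R x ^+ 2)%:E)%E.
    by apply: eq_integral => x _; rewrite -!gauss_convB.
  rewrite (plancherel_gauss lamL a0 mth (iB _ _ (itr m) (itr n)) (iB _ _ (iti m) (iti n))).
  apply: eq_integral => eta _; rewrite !FE /=.
  rewrite /cos_trans /sin_trans !transB; try by [exact: integrable_cos|exact: integrable_sin].
  by congr EFin; congr (_ * _); ring.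
- have le n : (wnorm2 lam h0 (fun eta => complex.Re (F (pt eta)) - complex.Re (fourier_trunc lam psi n (pt eta)))%R
      (fun eta => complex.Im (F (pt eta)) - complex.Im (fourier_trunc lam psi n (pt eta)))%R <=
      (K * `|\det B|^-1)%:E * \int[lam]_xi (abs2 (F xi - fourier_trunc lam psi n xi))%:E)%E.
    apply: le_trans (dual_gauss_affine_le (cmeasB mF' (cmeas_fourier_trunc n))).
    rewrite le_eqVlt; apply/orP; left; apply/eqP; apply: eq_integral => eta _.
    by rewrite /abs2 ReB ImB.
  apply: (@squeeze_cvge _ _ _ _ (cst 0%E) _ (fun n => (K * `|\det B|^-1)%:E * \int[lam]_xi (abs2 (F xi - fourier_trunc lam psi n xi))%:E)%E).
  + by apply: nearW => n; rewrite wnorm2_ge0 //= le.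
  + exact: cvg_cst.
  + by rewrite -(mule0 (K * `|\det B|^-1)%:E); apply: cvgeZl.
- rewrite wnorm2_dual; apply: le_lt_trans (dual_gauss_affine_le mF') _.
  have [_ _ fF] := mF.
  have fin : (\int[lam]_xi (abs2 (F xi))%:E)%E \is a fin_num.
    by rewrite ge0_fin_numE // integral_ge0 // => x _; rewrite lee_fin abs2_ge0.
  by rewrite -(fineK fin) -EFinM ltry.
Qed.

End TruncatedFourier.

(** * Gaussian approximate identity *)

Section Regularity.
Context (R : realType) (d : nat).
Local Notation V := (d.-tuple R).

Definition nbox (x : V) (r : R) : set V := [set y | forall i, `|tnth y i - tnth x i| < r].
(** Openness for the sup norm; closed sets appear as complements of such sets. *)
Definition copen (U : set V) := forall x, U x -> exists2 r, 0 < r & nbox x r `<=` U.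

Lemma copen_bigcup (U : nat -> set V) : (forall n, copen (U n)) -> copen (\bigcup_n U n).
Proof.
move=> oU x [n _ /oU[r r0 h]]; exists r => // y /h Uy; exists n => //.
Qed.

Lemma copen_bigcap (U : nat -> set V) m : (forall n, copen (U n)) -> copen (\bigcap_(n in `I_m) U n).
Proof.
move=> oU x; elim: m => [|m IH] hx.
  by exists 1 => // y _ n.
have [|r r0 h] := IH; first by move=> n nm; apply: hx; exact: leqW.
have [r' r'0 h'] := oU m x (hx m (ltnSn m)).
exists (Num.min r r'); first by rewrite lt_min r0.
move=> y hy n; rewrite /= ltnS leq_eqVlt => /orP[/eqP ->|nm].
  by apply: h' => i; have := hy i; rewrite lt_min => /andP[].
by apply: h => // i; have := hy i; rewrite lt_min => /andP[].
Qed.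

Variable mu : {measure set V -> \bar R}.
Hypothesis mu_fin : (mu setT < +oo)%E.

Definition sandwiched (E : set V) := forall eps : R, 0 < eps -> exists U K,
  [/\ measurable U, measurable K, copen U, copen (~` K) &
   [/\ K `<=` E, E `<=` U & (mu (U `\` K) <= eps%:E)%E]].

Let mu_lty E : measurable E -> (mu E < +oo)%E.
Proof.
by move=> mE; apply: le_lt_trans mu_fin; apply: le_measure => //; apply/mem_set.
Qed.

Let small_tail (F : nat -> set V) (eps : R) : (forall n, measurable (F n)) ->
  nonincreasing_seq F -> (mu (\bigcap_n F n) < eps%:E)%E -> exists n, (mu (F n) <= eps%:E)%E.
Proof.
move=> mF dF hF.
have mI : measurable (\bigcap_n F n) by exact: bigcapT_measurable.
have cv := nonincreasing_cvg_mu (mu_lty (mF 0%N)) mF mI dF.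
apply: contrapT => /forallNP h.
have : (eps%:E <= mu (\bigcap_n F n))%E.
  rewrite -(cvg_lim _ cv) //; apply: lime_ge; first by apply/cvg_ex; eexists; exact: cv.
  by apply: nearW => n; have /negP := h n; rewrite -ltNge => /ltW.
by rewrite leNgt hF.
Qed.

(** The half-space is closed and serves as K; the open half-spaces beyond c - 1/(n+1) decrease to
    it, and the measure is finite. *)
Lemma sandwiched_halfspace i (c : R) : sandwiched [set x | c <= tnth x i].
Proof.
move=> eps eps0.
have mh (B : set R) : measurable B -> measurable [set x : V | B (tnth x i)] by exact: measurable_slab.
pose H := [set x : V | c <= tnth x i].
have mH : measurable H.
  have := mh `[c, +oo[%classic (measurable_itv _).
  by rewrite (_ : [set x : V | _] = H) //; apply/seteqP; split => x /=; rewrite in_itv /= andbT.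
pose U n := [set x : V | c - n.+1%:R^-1 < tnth x i].
have mU n : measurable (U n).
  have := mh `]c - n.+1%:R^-1, +oo[%classic (measurable_itv _).
  by rewrite (_ : [set x : V | _] = U n) //; apply/seteqP; split => x /=; rewrite in_itv /= andbT.
have [n hn] : exists n, (mu (U n `\` H) <= eps%:E)%E.
  apply: (@small_tail (fun n => U n `\` H)).
  - by move=> n; exact: measurableD.
  - move=> m n mn; apply/subsetPset => x [hx nx]; split => //; apply: le_lt_trans hx.
    by rewrite lerD2l lerN2 lef_pV2 ?posrE ?ltr0n // ler_nat ltnS.
  rewrite (_ : \bigcap_n _ = set0) ?measure0 ?lte_fin //.
  rewrite -subset0 => x hx.
  have [_ /negP] := hx 0%N I; rewrite -ltNge => xc.
  have x0 : 0 < c - tnth x i by rewrite subr_gt0.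
  have [ h _] := hx (Num.bound (c - tnth x i)^-1) I.
  move: h; rewrite /U /= ltrBlDl -ltrBlDr => h.
  have := archi_boundP (ltW (_ : 0 < (c - tnth x i)^-1)); rewrite invr_gt0 => /(_ x0) h2.
  have : (Num.bound (c - tnth x i)^-1).+1%:R^-1 < c - tnth x i.
    rewrite invf_plt ?posrE ?ltr0n //; apply: lt_trans h2 _; by rewrite ltr_nat.
  by move=> h3; have := lt_trans h h3; rewrite ltxx.
exists (U n), H; split => //; last by split => // x /= hx; rewrite /U /= (lt_le_trans _ hx) // ltrBlDr ltrDl invr_gt0 ltr0n.
- move=> x hx; exists (tnth x i - (c - n.+1%:R^-1)); first by rewrite subr_gt0.
  move=> y /(_ i); rewrite ltr_norml => /andP[h _]; move: h; rewrite /U /=.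
  by move: (n.+1%:R^-1) (tnth y i) (tnth x i) => q u v; lra.
- move=> x /negP; rewrite -ltNge => hx; exists (c - tnth x i); first by rewrite subr_gt0.
  move=> y /(_ i); rewrite ltr_norml => /andP[_ h]; apply/negP; rewrite -ltNge; lra.
Qed.

Lemma sandwiched_sigma_algebra : sigma_algebra setT sandwiched.
Proof.
split.
- move=> eps e0; exists set0, set0; split => //; first by rewrite setC0 => x _; exists 1.
  by split => //; rewrite set0D measure0 lee_fin ltW.
- move=> E hE eps e0; have [U [K [mU mK oU oK [KE EU h]]]] := hE eps e0.
  exists (~` K), (~` U); split => //; try exact: measurableC; first by rewrite setCK.
  split; first by rewrite setTD; exact: subsetC.
    by rewrite setTD; exact: subsetC.
  by rewrite setDE setCK setIC -setDE.
move=> F hF eps e0.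
pose e n := eps / 2 / (2 ^ n.+1)%:R.
have e_gt0 n : 0 < e n by rewrite divr_gt0 ?divr_gt0 // ltr0n expn_gt0.
have /choice[U hU] : forall n, exists U, exists K, [/\ measurable U, measurable K, copen U, copen (~` K) &
   [/\ K `<=` F n, F n `<=` U & (mu (U `\` K) <= (e n)%:E)%E]].
  by move=> n; exact: (hF n).
have /choice[K hK] := hU.
have mU n : measurable (U n) by case: (hK n).
have mK n : measurable (K n) by case: (hK n).
have mUU : measurable (\bigcup_n U n) by exact: bigcupT_measurable.
(* The full union of the K n need not be closed, so it is cut at a finite stage m. Half of eps pays
   for the cut, the other half for the sets U n minus K n. *)
pose KK m := \bigcup_(n in `I_m) K n.
have mKK m : measurable (KK m) by apply: bigcup_measurable.
have hI : (mu (\bigcap_m (\bigcup_n U n `\` KK m)) <= (eps / 2)%:E)%E.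
  apply: (@le_trans _ _ (\sum_(n <oo) mu (U n `\` K n))%E).
    apply: measure_sigma_subadditive.
    - by move=> n; exact: measurableD.
    - by apply: bigcapT_measurable => m; exact: measurableD.
    move=> x hx; have [[n _ Unx] _] := hx 0%N I.
    exists n => //; split => // Kx; have [_] := hx n.+1 I; apply; exists n => //=.
  apply: le_trans (epsilon_trick0 xpredT (_ : 0 <= eps / 2)); last by rewrite divr_ge0 // ltW.
  by apply: lee_nneseries => n _ //; case: (hK n) => _ _ _ _ [].
have [m hm] : exists m, (mu (\bigcup_n U n `\` KK m) <= eps%:E)%E.
  apply: (@small_tail (fun m => \bigcup_n U n `\` KK m)).
  - by move=> n; exact: measurableD.
  - move=> m n mn; apply/subsetPset => x [hx nx]; split => // -[k km Kk].
    by apply: nx; exists k => //=; exact: leq_trans km mn.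
  by apply: le_lt_trans hI _; rewrite lte_fin; lra.
exists (\bigcup_n U n), (KK m); split => //.
- by apply: copen_bigcup => n; case: (hK n).
- by rewrite setC_bigcup; apply: copen_bigcap => n; case: (hK n).
split => //.
- by move=> x [n _ Knx]; exists n => //; case: (hK n) => _ _ _ _ [h _ _]; exact: h.
- by move=> x [n _ Fnx]; exists n => //; case: (hK n) => _ _ _ _ [_ h _]; exact: h.
Qed.

Lemma outer_regularity E (eps : R) : measurable E -> 0 < eps ->
  exists U, [/\ measurable U, copen U, E `<=` U & (mu (U `\` E) <= eps%:E)%E].
Proof.
move=> mE e0.
have [U [K [mU mK oU _ [KE EU h]]]] := halfspaces_generate sandwiched_sigma_algebra sandwiched_halfspace mE eps e0.
exists U; split => //; apply: le_trans h; apply: le_measure.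
- by apply/mem_set; exact: measurableD.
- by apply/mem_set; exact: measurableD.
- by move=> x [Ux nEx]; split => // /KE.
Qed.

End Regularity.

Section GaussianDomination.
Context (R : realType) (d : nat).
Local Notation V := (d.-tuple R).
Variable lam : {measure set V -> \bar R}.
Hypothesis lamL : is_lebesgue lam.
Local Notation integrable f := (lam.-integrable setT (EFin \o f)).

Lemma gauss_mass_vscale (b k : R) : k != 0 -> 0 < b ->
  gauss_mass lam (b * k ^+ 2) = `|k| ^- d * gauss_mass lam b.
Proof.
move=> k0 b0; apply: EFin_inj; rewrite EFinM.
have b1 : 0 < b * k ^+ 2 by rewrite mulr_gt0 // exprn_even_gt0.
rewrite /gauss_mass !RintegralK; [|exact: integrable_gauss|exact: integrable_gauss].
rewrite -(integral_vscale lamL k0 (f := fun x => (gauss b x)%:E)); last 2 first.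
- exact: measurable_gaussE.
- by move=> x; rewrite lee_fin gauss_ge0.
by apply: eq_integral => x _; rewrite gauss_scale.
Qed.

Lemma measurable_nbox (x : V) r : measurable (nbox x r).
Proof.
rewrite (_ : nbox x r = \bigcap_(i in [set: 'I_d]) [set y : V | `]tnth x i - r, tnth x i + r[%classic (tnth y i)]).
  by apply: fin_bigcap_measurable => // i _; exact: measurable_slab.
apply/seteqP; split => [y h i _|y h i].
  by rewrite /= in_itv /= -ltr_distl; exact: h.
by have := h i I; rewrite /= in_itv /= -ltr_distl.
Qed.

Lemma copen_nbox (x : V) r : 0 < r -> copen (nbox x r).
Proof.
move=> r0 y hy.
exists (\big[Num.min/r]_(i < d) (r - `|tnth y i - tnth x i|)).
  by apply: lt_bigmin => // i _; rewrite subr_gt0.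
move=> z hz i.
have h : `|tnth z i - tnth y i| < r - `|tnth y i - tnth x i|.
  by apply: lt_le_trans (hz i) _; exact: bigmin_le_cond.
rewrite -(subrKA (tnth y i)); apply: le_lt_trans (ler_normD _ _) _.
by rewrite -ltrBrDr.
Qed.

Lemma lam_nbox (r : R) : 0 <= r -> (lam (nbox (cvec d 0) r) < +oo)%E.
Proof.
move=> r0; apply: (@le_lt_trans _ _ (lam (cube r))); last by rewrite (lam_cube lamL) // ltry.
apply: le_measure; [apply/mem_set; exact: measurable_nbox|apply/mem_set; exact: cube_measurable|].
by move=> x h i; have := h i; rewrite !tnth_cvec subr0 ltr_norml => /andP[/ltW -> ->].
Qed.

Lemma copen_setI (U W : set V) : copen U -> copen W -> copen (U `&` W).
Proof.
move=> oU oW x [/oU[r r0 hr] /oW[r' r'0 hr']].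
exists (Num.min r r'); first by rewrite lt_min r0.
by move=> y hy; split; [apply: hr|apply: hr'] => i; have := hy i; rewrite lt_min => /andP[].
Qed.

Variables (T : V -> R) (C : R).
Hypotheses (mT : measurable_fun setT T) (T0 : forall x, 0 <= T x) (C0 : 0 <= C).
Hypothesis avgT : forall (b : R) (omega : V), 0 < b ->
  (\int[lam]_xi (gauss b xi * T (vadd xi omega))%:E <= (C * gauss_mass lam b)%:E)%E.

Local Notation M := (gauss_mass lam 1).

Let M0 : 0 < M. Proof. exact: gauss_mass_gt0. Qed.

Lemma gauss_average_le (k : R) (omega : V) : k != 0 ->
  (\int[lam]_z (gauss 1 z * T (vadd omega (vscale k z)))%:E <= (C * M)%:E)%E.
Proof.
move=> k0; pose b := k ^- 2.
have b0 : 0 < b by rewrite invr_gt0 exprn_even_gt0.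
have bk : b * k ^+ 2 = 1 by rewrite /b mulVf // expf_neq0.
pose f (y : V) := (gauss b y * T (vadd y omega))%:E.
have mf : measurable_fun setT f.
  apply/measurable_EFinP; apply: measurable_funM; first exact: (measurable_gauss _ (f := id)).
  by apply: (measurableT_comp mT); exact: measurable_vadd.
have f0 y : (0 <= f y)%E by rewrite lee_fin mulr_ge0 ?gauss_ge0.
rewrite (_ : (\int[lam]_z _)%E = (\int[lam]_z f (vscale k z))%E); last first.
  by apply: eq_integral => z _; rewrite /f gauss_scale bk vaddC.
rewrite (integral_vscale lamL k0 mf f0) -bk (gauss_mass_vscale k0 b0).
rewrite mulrCA EFinM; apply: lee_wpmul2l; first by rewrite lee_fin invr_ge0 exprn_ge0.
exact: avgT.
Qed.

(** The Gaussian mollification of the indicator of U at scale c, times the mass of [gauss 1].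
    Integrating over a fixed Gaussian with scaled argument keeps the majorant independent of c. *)
Definition smooth_ind (U : set V) (c : R) (xi : V) : R :=
  Rintegral lam setT (fun z => gauss 1 z * \1_U (vadd xi (vscale c z))).

Section OpenSet.
Variable U : set V.
Hypotheses (mU : measurable U) (oU : copen U).

Let m1U : measurable_fun setT (\1_U : V -> R). Proof. exact: measurable_indic. Qed.

Let mk (c : R) : measurable_fun setT (fun p : V * V => gauss 1 p.2 * \1_U (vadd p.1 (vscale c p.2))).
Proof.
apply: measurable_funM; first exact: measurable_gauss.
apply: (measurableT_comp m1U); apply: measurable_vadd => //; exact: measurable_vscale.
Qed.

Let mkx (c : R) xi : measurable_fun setT (fun z : V => gauss 1 z * \1_U (vadd xi (vscale c z))).
Proof.
apply: measurable_funM; first exact: (measurable_gauss _ (f := id)).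
by apply: (measurableT_comp m1U); apply: measurable_vadd => //; exact: measurable_vscale.
Qed.

Lemma indic_le1 (x : V) : 0 <= (\1_U x : R) <= 1.
Proof. by rewrite indicE; case: (_ \in _); rewrite ?lexx ler01. Qed.

Let ik (c : R) xi : integrable (fun z => gauss 1 z * \1_U (vadd xi (vscale c z))).
Proof.
apply: (integrable_le _ (integrable_gauss lamL ltr01)); first exact: mkx.
move=> z; have /andP[h1 h2] := indic_le1 (vadd xi (vscale c z)).
by rewrite ger0_norm ?mulr_ge0 ?gauss_ge0 // ler_piMr // gauss_ge0.
Qed.

Lemma smooth_ind_cvg xi : U xi ->
  (fun n : nat => smooth_ind U (- n.+1%:R^-1) xi) @ \oo --> M.
Proof.
move=> Uxi; have [r r0 hr] := oU Uxi.
have h : (\int[lam]_z (gauss 1 z * \1_U (vadd xi (vscale (- n.+1%:R^-1) z)))%:E @[n --> \oo] -->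
    \int[lam]_z (gauss 1 z)%:E)%E.
  apply: (@dominated_cvg _ _ _ lam setT measurableT
    (fun n z => (gauss 1 z * \1_U (vadd xi (vscale (- n.+1%:R^-1) z)))%:E)
    (fun z => (gauss 1 z)%:E) (fun z => (gauss 1 z)%:E)).
  - by move=> n; apply/measurable_EFinP; exact: mkx.
  - move=> z _; have [k hk] := @box_cover R d z.
    have e : \forall n \near \oo, (gauss 1 z)%:E = (gauss 1 z * \1_U (vadd xi (vscale (- n.+1%:R^-1) z)))%:E.
      exists (Num.bound (k%:R / r)) => // n /= kn; rewrite indicE mem_set ?mulr1 //.
      apply: hr => i; rewrite !tnth_mktuple addrAC subrr add0r normrM normrN normfV (ger0_norm (ler0n R _)).
      have := hk i; rewrite !tnth_cvec => /andP[h1 h2].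
      have zk : `|tnth z i| <= k%:R by rewrite ler_norml h1 ltW.
      rewrite mulrC ltr_pdivrMr ?ltr0n //; apply: le_lt_trans zk _.
      rewrite mulrC -ltr_pdivrMr //.
      apply: lt_trans (archi_boundP _) _; first by rewrite divr_ge0 // ltW.
      by rewrite ltr_nat ltnS.
    by apply: cvg_trans (near_eq_cvg e) _; exact: cvg_cst.
  - by [].
  - exact: (integrable_gauss lamL ltr01).
  - move=> n z _; rewrite /= lee_fin; have /andP[h1 h2] := indic_le1 (vadd xi (vscale (- n.+1%:R^-1) z)).
    by rewrite ger0_norm ?mulr_ge0 ?gauss_ge0 // ler_piMr // gauss_ge0.
rewrite /smooth_ind /gauss_mass /Rintegral; apply: fine_cvg; rewrite fineK //.
exact: (integrable_fin_num measurableT (integrable_gauss lamL ltr01)).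
Qed.

(** Tonelli and a translation by c z move the mollifier from the indicator to T, whose Gaussian
    averages are at most C M at every point; integrate over U. *)
Lemma smooth_ind_mean (c : R) : c != 0 ->
  (\int[lam]_xi (T xi * smooth_ind U c xi)%:E <= (C * M)%:E * lam U)%E.
Proof.
move=> c0.
pose F (p : V * V) := (T p.1 * (gauss 1 p.2 * \1_U (vadd p.1 (vscale c p.2))))%:E.
have F0 p : (0 <= F p)%E.
  have /andP[h1 _] := indic_le1 (vadd p.1 (vscale c p.2)).
  by rewrite lee_fin !mulr_ge0 ?gauss_ge0.
have mF : measurable_fun setT F.
  by apply/measurable_EFinP; apply: measurable_funM; [exact: measurableT_comp|exact: mk].
rewrite (_ : (\int[lam]_xi _)%E = (\int[lam]_xi \int[lam]_z F (xi, z))%E); last first.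
  apply: eq_integral => xi _; rewrite /F /=.
  under [RHS]eq_integral do rewrite EFinM.
  rewrite ge0_integralZl //; last 3 first.
  - by apply/measurable_EFinP; exact: mkx.
  - by move=> z _; have /andP[h1 _] := indic_le1 (vadd xi (vscale c z)); rewrite lee_fin mulr_ge0 ?gauss_ge0.
  - by rewrite lee_fin.
  by rewrite EFinM /smooth_ind RintegralK.
rewrite (lam_tonelli lamL (f := F)) //.
pose F' (p : V * V) := (\1_U p.1 * (gauss 1 p.2 * T (vadd p.1 (vscale (- c) p.2))))%:E.
have F'0 p : (0 <= F' p)%E.
  have /andP[h1 _] := indic_le1 p.1.
  by rewrite lee_fin !mulr_ge0 ?gauss_ge0.
have mTc : measurable_fun setT (fun p : V * V => gauss 1 p.2 * T (vadd p.1 (vscale (- c) p.2))).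
  apply: measurable_funM; first exact: measurable_gauss.
  by apply: (measurableT_comp mT); apply: measurable_vadd => //; exact: measurable_vscale.
have mF' : measurable_fun setT F'.
  by apply/measurable_EFinP; apply: measurable_funM => //; exact: measurableT_comp.
rewrite (_ : (\int[lam]_z _)%E = (\int[lam]_z \int[lam]_xi F' (xi, z))%E); last first.
  apply: eq_integral => z _.
  have mz : measurable_fun setT (fun xi : V => F' (xi, z)).
    by apply: (measurableT_comp mF'); exact: measurable_fun_pair.
  rewrite -(integral_translate lamL (vscale c z) mz); last by move=> x; exact: F'0.
  apply: eq_integral => xi _; rewrite /F /F' /=.
  have -> : vadd (vadd xi (vscale c z)) (vscale (- c) z) = xi.
    by apply: vext => i; rewrite !tnth_mktuple; ring.
  by congr EFin; ring.
rewrite -(lam_tonelli lamL (f := F')) //.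
apply: (@le_trans _ _ (\int[lam]_xi ((C * M)%:E * ind U xi))%E).
  apply: ge0_le_integralT => xi; first by apply: integral_ge0.
  rewrite /F' /=; under eq_integral do rewrite EFinM.
  have /andP[h1 _] := indic_le1 xi.
  rewrite ge0_integralZl //; last 2 first.
  - apply/measurable_EFinP; apply: measurable_funM; first exact: (measurable_gauss _ (f := id)).
    apply: (measurableT_comp mT); apply: measurable_vadd; first exact: measurable_cst.
    exact: (measurable_vscale _ (f := id)).
  - by move=> z _; rewrite lee_fin mulr_ge0 ?gauss_ge0.
  rewrite muleC; apply: lee_wpmul2r; first exact: ind_ge0.
  by apply: gauss_average_le; rewrite oppr_eq0.
have CM : 0 <= C * M by rewrite mulr_ge0 // ltW.
rewrite ge0_integralZl //; last 2 first.
- exact: measurable_ind.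
- by move=> x _; exact: ind_ge0.
by rewrite integral_ind.
Qed.

(** At points of an open U the mollified indicator tends to the full mass M, so Fatou passes the
    bound to the limit c -> 0. *)
Lemma integral_copen_le : (\int[lam]_xi (\1_U xi * T xi)%:E <= C%:E * lam U)%E.
Proof.
have h : (\int[lam]_xi (M * (\1_U xi * T xi))%:E <= (C * M)%:E * lam U)%E.
  apply: (@fatou_le R d lam (fun n xi => (smooth_ind U (- n.+1%:R^-1) xi * (\1_U xi * T xi))%:E)).
  - move=> n; apply/measurable_EFinP; apply: measurable_funM.
      exact: (measurable_Rintegral_r lamL (mk _)).
    exact: measurable_funM.
  - move=> n xi; have /andP[h1 _] := indic_le1 xi.
    rewrite lee_fin !mulr_ge0 // Rintegral_ge0 // => z _.
    by have /andP[h2 _] := indic_le1 (vadd xi (vscale (- n.+1%:R^-1) z)); rewrite mulr_ge0 ?gauss_ge0.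
  - move=> xi; apply: cvg_EFin; first exact: nearW.
    have [Ux|nU] := pselect (U xi).
      by apply: cvgM; [exact: smooth_ind_cvg|exact: cvg_cst].
    rewrite indicE memNset // mul0r mulr0; under eq_fun do rewrite mulr0.
    exact: cvg_cst.
  exists 0%N => n _.
  apply: le_trans (smooth_ind_mean (c := - n.+1%:R^-1) _); last first.
    by rewrite oppr_eq0 invr_eq0 pnatr_eq0.
  apply: ge0_le_integralT => xi; have /andP[h1 h2] := indic_le1 xi.
    rewrite lee_fin !mulr_ge0 // Rintegral_ge0 // => z _.
    by have /andP[h3 _] := indic_le1 (vadd xi (vscale (- n.+1%:R^-1) z)); rewrite mulr_ge0 ?gauss_ge0.
  rewrite lee_fin mulrC ler_wpM2r //; last by rewrite ler_piMl.
  apply: Rintegral_ge0 => // z _.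
  by have /andP[h3 _] := indic_le1 (vadd xi (vscale (- n.+1%:R^-1) z)); rewrite mulr_ge0 ?gauss_ge0.
rewrite -(@lee_pmul2l _ M%:E) // muleA -EFinM (mulrC M C); apply: le_trans h.
rewrite -ge0_integralZl //; last 3 first.
- by apply/measurable_EFinP; exact: measurable_funM.
- by move=> xi _; have /andP[h1 _] := indic_le1 xi; rewrite lee_fin mulr_ge0.
- by rewrite lee_fin ltW.
Qed.

End OpenSet.

(** On E n = {T >= C + 1/(n+1)}, cut to a bounded box, take open U above E n of nearly equal
    measure. Then (C + 1/(n+1)) lam(E n) <= C lam(U), close to C lam(E n), so E n is null. *)
Lemma gauss_domination : {ae lam, forall xi, T xi <= C}.
Proof.
pose O (n : nat) : set V := nbox (cvec d 0) n.+1%:R.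
have mO n : measurable (O n) by exact: measurable_nbox.
have fO n : (lam (O n) < +oo)%E by exact: lam_nbox.
pose E n := [set xi | C + n.+1%:R^-1 <= T xi] `&` O n.
have mE n : measurable (E n).
  apply: measurableI => //.
  have mI : measurable (`[C + n.+1%:R^-1, +oo[%classic : set R) by exact: measurable_itv.
  have mp : measurable (setT `&` T @^-1` `[C + n.+1%:R^-1, +oo[) by exact: mT.
  rewrite (_ : [set xi | _] = setT `&` T @^-1` `[C + n.+1%:R^-1, +oo[) //.
  by rewrite setTI; apply/seteqP; split => x /=; rewrite in_itv /= andbT.
have fE n : (lam (E n) < +oo)%E.
  by apply: le_lt_trans (fO n); apply: le_measure; [apply/mem_set|apply/mem_set|move=> x []].
have E0 n : lam (E n) = 0%E.
  have k0 : 0 < (n.+1%:R^-1 : R) by rewrite invr_gt0 ltr0n.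
  have e1 : (((C + n.+1%:R^-1)%:E * lam (E n)) <= C%:E * lam (E n))%E.
    have fm : lam (E n) \is a fin_num by rewrite ge0_fin_numE.
    have fC : (C%:E * lam (E n))%E \is a fin_num by rewrite fin_numM.
    apply/lee_addgt0Pr => delta delta0.
    (* After multiplication by C this excess is at most delta; C + 1 allows C = 0. *)
    have ep : 0 < delta / (C + 1) by rewrite divr_gt0 // ltr_wpDl.
    (* Regularity is available for finite measures, hence the restriction to [O n]. *)
    have rfin : (mrestr lam (mO n) setT < +oo)%E by rewrite /mrestr setTI.
    have [U [mU oU EU hU]] := outer_regularity rfin (mE n) ep.
    have mUO : measurable (U `&` O n) by exact: measurableI.
    have oUO : copen (U `&` O n) by apply: copen_setI => //; exact: copen_nbox.
    have lU : (lam (U `&` O n) <= lam (E n) + (delta / (C + 1))%:E)%E.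
      apply: (@le_trans _ _ (lam (E n `|` ((U `\` E n) `&` O n)))).
        apply: le_measure; [exact/mem_set| |].
          by apply/mem_set; apply: measurableU => //; apply: measurableI => //; exact: measurableD.
        move=> x [Ux Ox]; have [Ex|nEx] := pselect (E n x); first by left.
        by right.
      apply: le_trans (measureU2 _ (mE n) _) _; first by apply: measurableI => //; exact: measurableD.
      by apply: leeD => //; exact: hU.
    apply: (@le_trans _ _ (C%:E * lam (U `&` O n))%E); last first.
      apply: le_trans (lee_wpmul2l _ lU) _; first by rewrite lee_fin.
      rewrite muleDr //; last exact: fin_num_adde_defl.
      apply: leeD => //; rewrite -EFinM lee_fin mulrCA ler_piMr //; first exact: ltW.
      by rewrite ler_pdivrMr ?ltr_wpDl // mul1r lerDl.
    apply: le_trans (integral_copen_le mUO oUO).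
    have Ck : 0 <= C + n.+1%:R^-1 by rewrite addr_ge0 // ltW.
    rewrite -(integral_ind _ (mE n)) -ge0_integralZl //; last 2 first.
    - exact: measurable_ind.
    - by move=> x _; exact: ind_ge0.
    apply: ge0_le_integralT => x; first by rewrite mule_ge0 ?ind_ge0.
    have [Ex|nEx] := pselect (E n x); last first.
      have /andP[h1 _] := indic_le1 (U `&` O n) x.
      by rewrite (ind0 nEx) mule0 lee_fin mulr_ge0.
    rewrite (ind1 Ex) mule1 lee_fin indicE mem_set ?mul1r; first by case: Ex.
    by split; [exact: EU|case: Ex].
  have fm : lam (E n) \is a fin_num by rewrite ge0_fin_numE.
  have r0 : 0 <= fine (lam (E n)) by apply: fine_ge0.
  move: e1; rewrite -(fineK fm) -!EFinM !lee_fin mulrDl gerDl => h.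
  by apply/eqP; rewrite eqe eq_le r0 andbT -(ler_pM2l k0) mulr0.
apply: (@negligibleS _ _ _ lam (\bigcup_n E n)); last first.
  exists (\bigcup_n E n); split => //; first exact: bigcupT_measurable.
  apply/eqP; rewrite eq_le measure_ge0 andbT.
  apply: le_trans (measure_sigma_subadditive _ mE _ (fun _ h => h)) _; first exact: bigcupT_measurable.
  by rewrite eseries0 // => n _ _; exact: E0.
move=> xi /negP; rewrite -ltNge => hxi.
have [k hk] := @box_cover R d xi.
have x0 : 0 < T xi - C by rewrite subr_gt0.
pose n := maxn k (Num.bound (T xi - C)^-1).
exists n => //; split.
  rewrite /= addrC -lerBrDr -[leRHS]invrK lef_pV2 ?posrE ?invr_gt0 ?ltr0n //.
  apply: ltW; apply: lt_trans (archi_boundP _) _; first by rewrite invr_ge0 ltW.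
  by rewrite ltr_nat ltnS leq_maxr.
move=> i; have := hk i; rewrite !tnth_cvec subr0 => /andP[h1 h2].
apply: (@le_lt_trans _ _ k%:R); first by rewrite ler_norml h1 ltW.
by rewrite ltr_nat ltnS leq_maxl.
Qed.

End GaussianDomination.

(** * The Calderon sum *)

Section Calderon.
Context (R : realType) (d : nat).
Local Notation V := (d.-tuple R).
Variable lam : {measure set V -> \bar R}.
Hypothesis lamL : is_lebesgue lam.
Variables (A P : 'M[R]_d) (psi : V -> R[i]) (C1 C2 : R) (F : V -> R[i]).
Hypotheses (uA : A \in unitmx) (uP : P \in unitmx) (hB : in_Bpi lam A psi).
Hypotheses (C10 : 0 < C1) (C12 : C1 <= C2) (hD : disc_frame lam A P psi C1 C2).
Hypothesis hF : is_fourierL2 lam psi F.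

Definition calderon_sum (xi : V) : \bar R :=
  \esum_(j in [set: int]) (abs2 (F (mxapp (mxpowz A^T j) xi)))%:E.
Local Notation S := calderon_sum.
Local Notation D := `|\det P|.

Let D0 : 0 < D. Proof. by rewrite normr_gt0 -unitfE -unitmxE. Qed.
Let mF : cmeas F. Proof. by case: hF => /memL2_cmeas. Qed.

Lemma calderon_sum_ge0 xi : (0 <= S xi)%E.
Proof. by apply: esum_ge0 => j _; rewrite lee_fin abs2_ge0. Qed.

Let m1 j : measurable_fun setT (fun xi : V => (abs2 (F (mxapp (mxpowz A^T j) xi)))%:E).
Proof. exact: (measurable_comp_mx _ (measurable_abs2E mF)). Qed.

Lemma measurable_calderon_sum : measurable_fun setT S.
Proof. by apply: measurable_esum => // j xi; rewrite lee_fin abs2_ge0. Qed.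

Let mS omega : measurable_fun setT (fun xi : V => S (vadd xi omega)).
Proof. exact: (measurable_comp_vadd omega measurable_calderon_sum). Qed.

Lemma cont_sum_gabor a omega : 0 < a ->
  (cont_sum lam A psi (gabor a omega) =
   \int[lam]_eta ((dual_gauss lam a eta)%:E * S (vadd eta omega)))%E.
Proof.
move=> a0; have [hpsi _] := hB.
have h0 eta := dual_gauss_ge0 lamL a0 eta.
have f0 (j : int) xi : (0 <= (abs2 (F (mxapp (mxpowz A^T j) xi)))%:E)%E by rewrite lee_fin abs2_ge0.
transitivity (\int[lam]_eta \esum_(j in [set: int])
    ((dual_gauss lam a eta)%:E * (abs2 (F (mxapp (mxpowz A^T j) (vadd eta omega))))%:E))%E; last first.
  by apply: eq_integral => eta _; rewrite esumZl.
rewrite integral_esum.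
- apply: eq_esum => j _; rewrite (plancherel_gabor lamL omega j uA hpsi a0 hF).
  by apply: eq_integral => eta _; rewrite EFinM.
- move=> j; apply: emeasurable_funM.
    by apply/measurable_EFinP; exact: measurable_dual_gauss.
  exact: (measurable_comp_vadd omega (m1 j)).
- by move=> j eta; apply: mule_ge0 => //; rewrite lee_fin.
Qed.

(** The map a -> 2 pi^2 / a is an involution, so every width b is the dual of some a. The squared
    norm of the test function and the prefactor of [dual_gauss] cancel to leave the mass of
    [gauss b]. *)
Lemma calderon_gauss_mean b omega : 0 < b ->
  ((C1 * D * gauss_mass lam b)%:E <=
    \int[lam]_eta ((gauss b eta)%:E * S (vadd eta omega)) <=
   (C2 * D * gauss_mass lam b)%:E)%E.
Proof.
move=> b0; pose a := 2 * pi ^+ 2 / b.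
have p0 := pi_gt0 R.
have a0 : 0 < a by rewrite divr_gt0 // mulr_gt0 // exprn_gt0.
have hb : dual_width a = b.
  rewrite /dual_width /a; move: (pi) p0 => p p0; field.
  by rewrite !gt_eqF.
have Mb := gauss_mass_gt0 lamL b0.
have Ma : 0 < gauss_mass lam (2 * a) by apply: gauss_mass_gt0 => //; rewrite mulr_gt0.
pose k := gauss_mass lam (2 * a) / gauss_mass lam b.
have k0 : 0 < k by rewrite divr_gt0.
set I := (\int[lam]_eta _)%E.
have eI : cont_sum lam A psi (gabor a omega) = (k%:E * I)%E.
  rewrite cont_sum_gabor // /I -ge0_integralZl //; last 3 first.
  - apply: emeasurable_funM; last exact: mS.
    exact: measurable_gaussE.
  - by move=> x _; apply: mule_ge0; [rewrite lee_fin gauss_ge0|exact: calderon_sum_ge0].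
  - by rewrite lee_fin ltW.
  by apply: eq_integral => eta _; rewrite muleA -EFinM /dual_gauss hb.
have := continuous_frame_bounds lamL uA uP hB C10 C12 hD (gabor_memL2 lamL omega a0).
rewrite gabor_l2norm2 eI.
have kM C : C * D * gauss_mass lam (2 * a) = k * (C * D * gauss_mass lam b).
  by rewrite /k; field; rewrite gt_eqF.
by rewrite !kM !(EFinM k) !lee_pmul2l.
Qed.

(** The sum S may be infinite, whereas the domination lemma takes real-valued functions. *)
Let cut (K : R) (xi : V) : R := fine (mine (S xi) K%:E).

Let cutE K xi : 0 <= K -> (cut K xi)%:E = mine (S xi) K%:E.
Proof.
move=> K0; rewrite /cut fineK // ge0_fin_numE; first by rewrite gt_min ltry orbT.
by rewrite le_min calderon_sum_ge0 lee_fin.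
Qed.

Let cut_ge0 K xi : 0 <= K -> 0 <= cut K xi.
Proof. by move=> K0; rewrite -lee_fin cutE // le_min calderon_sum_ge0 lee_fin. Qed.

Let cut_le K xi : 0 <= K -> cut K xi <= K.
Proof. by move=> K0; rewrite -lee_fin cutE // ge_min lexx orbT. Qed.

Let measurable_cut K : measurable_fun setT (cut K).
Proof.
apply: (measurableT_comp (@fine_measurable R setT measurableT)).
by apply: measurable_mine => //; exact: measurable_calderon_sum.
Qed.

Let K2 := C2 * D.
Let K20 : 0 <= K2. Proof. by rewrite mulr_ge0 // ltW // (lt_le_trans C10). Qed.
Let K1 := C1 * D.

Lemma calderon_sum_le : {ae lam, forall xi, (S xi <= K2%:E)%E}.
Proof.
(* Cutting strictly above K2 ensures that a cut value of at most K2 is the value of S itself. *)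
have K30 : 0 <= K2 + 1 by rewrite addr_ge0.
have h : {ae lam, forall xi, cut (K2 + 1) xi <= K2}.
  apply: (gauss_domination lamL) => //.
  - by move=> xi; exact: cut_ge0.
  - move=> b omega b0; have /andP[_] := calderon_gauss_mean omega b0.
    apply: le_trans; apply: ge0_le_integralT => xi.
      by rewrite lee_fin mulr_ge0 ?gauss_ge0 // cut_ge0.
    rewrite EFinM cutE //; apply: lee_wpmul2l; first by rewrite lee_fin gauss_ge0.
    by rewrite ge_min lexx.
apply: filterS h => xi; rewrite -lee_fin cutE // ge_min => /orP[//|].
by rewrite lee_fin gerDl ler10.
Qed.

(** Domination is applied to the nonnegative function K2 - min(S, K2). The upper bound just proved
    shows that the cut changes S on a null set only, so its Gaussian averages are at most K2 -
    K1. *)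
Lemma calderon_sum_ge : {ae lam, forall xi, (K1%:E <= S xi)%E}.
Proof.
have h : {ae lam, forall xi, K2 - cut K2 xi <= K2 - K1}.
  apply: (gauss_domination lamL).
  - by apply: measurable_funB => //; exact: measurable_cst.
  - by move=> xi; rewrite subr_ge0 cut_le.
  - by rewrite subr_ge0 ler_wpM2r // ltW.
  move=> b omega b0; have /andP[lo _] := calderon_gauss_mean omega b0.
  have ig := integrable_gauss lamL b0.
  have mg : measurable_fun setT (@gauss R d b) by exact: (measurable_gauss _ (f := id)).
  have mcut : measurable_fun setT (fun xi : V => cut K2 (vadd xi omega)).
    by apply: (measurableT_comp (measurable_cut K2)); exact: measurable_vadd.
  have igc : lam.-integrable setT (EFin \o (fun xi => gauss b xi * cut K2 (vadd xi omega))).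
    apply: (integrable_le _ (integrableRZl K2 ig)); first exact: measurable_funM.
    move=> xi; rewrite ger0_norm ?mulr_ge0 ?gauss_ge0 ?cut_ge0 // mulrC.
    by apply: ler_wpM2r; [exact: gauss_ge0|exact: cut_le].
  have eS : (\int[lam]_eta ((gauss b eta)%:E * S (vadd eta omega)) =
      \int[lam]_eta (gauss b eta * cut K2 (vadd eta omega))%:E)%E.
    have mgs : measurable_fun setT (fun eta : V => (gauss b (vsub eta omega))%:E).
      exact: (measurable_comp_vsub (f := fun eta => (gauss b eta)%:E) omega (@measurable_gaussE R d b)).
    (* Moving omega onto the Gaussian lets the almost-everywhere bound on S be used at eta
       itself. *)
    transitivity (\int[lam]_eta ((gauss b (vsub eta omega))%:E * S eta))%E.
      rewrite -[RHS](integral_translate lamL omega).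
      - by apply: eq_integral => eta _; rewrite vaddK.
      - by apply: emeasurable_funM => //; exact: measurable_calderon_sum.
      - by move=> x; apply: mule_ge0; [rewrite lee_fin gauss_ge0|exact: calderon_sum_ge0].
    transitivity (\int[lam]_eta ((gauss b (vsub eta omega))%:E * (cut K2 eta)%:E))%E; last first.
      rewrite -[LHS](integral_translate lamL omega).
      - by apply: eq_integral => eta _; rewrite vaddK EFinM.
      - by apply: emeasurable_funM => //; apply/measurable_EFinP; exact: measurable_cut.
      - by move=> x; apply: mule_ge0; rewrite lee_fin ?gauss_ge0 ?cut_ge0.
    apply: ge0_ae_eq_integral => //.
    - by apply: emeasurable_funM => //; exact: measurable_calderon_sum.
    - by apply: emeasurable_funM => //; apply/measurable_EFinP; exact: measurable_cut.
    - by move=> x _; apply: mule_ge0; [rewrite lee_fin gauss_ge0|exact: calderon_sum_ge0].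
    - by move=> x _; apply: mule_ge0; rewrite lee_fin ?gauss_ge0 ?cut_ge0.
    apply: filterS calderon_sum_le => xi hxi _; congr (_ * _)%E.
    by rewrite cutE // min_l.
  move: lo; rewrite eS -RintegralK // lee_fin => lo.
  rewrite (_ : (\int[lam]_xi _)%E =
     (Rintegral lam setT (fun xi => K2 * gauss b xi - gauss b xi * cut K2 (vadd xi omega)))%:E); last first.
    rewrite RintegralK; last exact: (integrableB measurableT (integrableRZl K2 ig) igc).
    by apply: eq_integral => xi _; congr EFin; ring.
  rewrite lee_fin RintegralB //; last exact: integrableRZl.
  by rewrite RintegralZl // -/(gauss_mass lam b) mulrBl lerD2l lerN2.
apply: filterS h => xi; rewrite lerD2l lerN2 -lee_fin cutE // le_min => /andP[].
by [].
Qed.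

Lemma calderon_bounds : {ae lam, forall xi,
  (C1%:E <= (D^-1)%:E * S xi <= C2%:E)%E}.
Proof.
apply: filterS2 calderon_sum_ge calderon_sum_le => xi h1 h2.
have e C : C%:E = ((D^-1)%:E * (C * D)%:E)%E.
  by rewrite -EFinM mulrCA mulVf ?mulr1 // gt_eqF.
by rewrite (e C1) (e C2) !lee_pmul2l ?lte_fin ?invr_gt0 // h1 h2.
Qed.

End Calderon.

Theorem mainTheorem8 (R : realType) (d : nat)
  (lam : {measure set (d.-tuple R) -> \bar R})
  (A P : 'M[R]_d) (psi : d.-tuple R -> R[i]) (C1 C2 : R) :
  is_lebesgue lam ->
  A \in unitmx -> P \in unitmx ->
  in_Bpi lam A psi ->
  0 < C1 -> C1 <= C2 ->
  disc_frame lam A P psi C1 C2 ->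
  (forall f, memL2 lam f ->
     ((C1 * `|\det P| * l2norm2 lam f)%:E <= cont_sum lam A psi f
        <= (C2 * `|\det P| * l2norm2 lam f)%:E)%E)
  /\ (forall F, is_fourierL2 lam psi F ->
       {ae lam, forall xi,
         (C1%:E <= (`|\det P|^-1)%:E *
            (\esum_(j in [set: int]) (abs2 (F (mxapp (mxpowz A^T j) xi)))%:E)
          <= C2%:E)%E})
  /\ (C1 = 1 -> C2 = 1 ->
       (forall f, memL2 lam f ->
          cont_sum lam A psi f = (`|\det P| * l2norm2 lam f)%:E)
       /\ (forall F, is_fourierL2 lam psi F ->
            {ae lam, forall xi,
              (\esum_(j in [set: int]) (abs2 (F (mxapp (mxpowz A^T j) xi)))%:E
               = (`|\det P|)%:E)%E})).
Proof.
move=> lamL uA uP hB C10 C12 hD.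
have cont := continuous_frame_bounds lamL uA uP hB C10 C12 hD.
have cald F (hF : is_fourierL2 lam psi F) := calderon_bounds lamL uA uP hB C10 C12 hD hF.
split; [exact: cont|split; [exact: cald|move=> e1 e2; split => [f hf|F hF]]].
  have := cont f hf; rewrite e1 e2 !mul1r => /andP[h1 h2].
  by apply/eqP; rewrite eq_le h1 h2.
apply: filterS (cald F hF) => xi; rewrite e1 e2 -eq_le => /eqP h.
have D0 : `|\det P| != 0 by rewrite normr_eq0 -unitfE -unitmxE.
by rewrite -[LHS]mul1e -(mulfV D0) EFinM -muleA -h mule1.
Qed.
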